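(* Let $\rho$ be an admissible function on an RD-space $\mathcal X$. Let $\{\tilde T_t\}_{t>0}$ be a continuous $(\epsilon_1,\epsilon_2,\epsilon_3)$-AOTI for some $\epsilon_1\in(0,1]$, $\epsilon_2,\epsilon_3>0$, and let $\{T_t\}_{t>0}$ be a family of linear operators bounded on $L^2(\mathcal X)$ with integrable kernels $T_t(x,y)$ such that, for some constants $C>0$, $\delta_2\in(0,\epsilon_2]$ and $\delta_1,\delta_3>0$, for all $t>0$ and $x,y\in\mathcal X$: (i) $|T_t(x,y)|\le C\frac{1}{V_t(x)+V(x,y)}\big[\frac{t}{t+d(x,y)}\big]^{\delta_2}\big[\frac{\rho(x)}{t+\rho(x)}\big]^{\delta_3}$; (ii) $|T_t(x,y)-\tilde T_t(x,y)|\le C\big[\frac{t}{t+\rho(x)}\big]^{\delta_1}\frac{1}{V_t(x)+V(x,y)}\big[\frac{t}{t+d(x,y)}\big]^{\delta_2}$. For $f\in L^1(\mathcal X)$ let $T^+(f)(x)=\sup_{t>0}|T_t(f)(x)|$ and $T^+_\rho(f)(x)=\sup_{0<t<\rho(x)}|T_t(f)(x)|$. Then the following are equivalent: (a) $f\in H^1_\rho(\mathcal X)$; (b) $f\in L^1(\mathcal X)$ and $\|T^+(f)\|_{L^1(\mathcal X)}<\infty$; (c) $f\in L^1(\mathcal X)$ and $\|T^+_\rho(f)\|_{L^1(\mathcal X)}<\infty$. Moreover, for all $f\in L^1(\mathcal X)$, $\|f\|_{H^1_\rho(\mathcal X)}\sim\|T^+(f)\|_{L^1(\mathcal X)}\sim\|T^+_\rho(f)\|_{L^1(\mathcal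 X)}$ with constants independent of $f$.
   Context: An RD-space is a triple $(\mathcal X,d,\mu)$ where $(\mathcal X,d)$ is a metric space and $\mu$ a regular Borel measure such that every ball $B(x,r)=\{y:d(x,y)<r\}$ has finite positive measure, $\mu$ is doubling, and there exist constants $0<\kappa\le n$, $C_2\ge1$ with $C_2^{-1}\lambda^\kappa\mu(B(x,r))\le\mu(B(x,\lambda r))\le C_2\lambda^n\mu(B(x,r))$ for all $x$, $0<r<\operatorname{diam}(\mathcal X)/2$, $1\le\lambda<\operatorname{diam}(\mathcal X)/(2r)$; $\mu(\mathcal X)=\infty$. $V_r(x)=\mu(B(x,r))$, $V(x,y)=\mu(B(x,d(x,y)))$. A positive function $\rho$ on $\mathcal X$ is admissible if there exist constants $C_3,k_0>0$ such that for all $x,y$, $\rho(y)\le C_3[\rho(x)]^{1/(1+k_0)}[\rho(x)+d(x,y)]^{k_0/(1+k_0)}$. Test functions: for $x\in\mathcal X$, $r>0$, $\beta\in(0,1]$, $\gamma>0$, $\mathcal G(x,r,\beta,\gamma)$ is the Banach space of functions $f$ for which there is $C_f$ with $|f(y)|\le C_f\frac{1}{V_r(x)+V(x,y)}\big(\frac{r}{r+d(x,y)}\big)^\gamma$ for all $y$ and $|f(y)-f(y')|\le C_f\big(\frac{d(y,y')}{r+d(x,y)}\big)^\beta\frac{1}{V_r(x)+V(x,y)}\big(\frac{r}{r+d(x,y)}\big)^\gamma$ whenever $d(y,y')\le[r+d(x,y)]/2$; $\|f\|_{\mathcal G(x,r,\beta,\gamma)}$ is the infimum of such $C_f$. For $\epsilon\in(0,1]$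 and $\beta,\gamma\in(0,\epsilon]$, $\mathcal G^\epsilon_0(x,r,\beta,\gamma)$ is the closure of $\mathcal G(x,r,\epsilon,\epsilon)$ in $\mathcal G(x,r,\beta,\gamma)$. Fix $x_1\in\mathcal X$ and put $\mathcal G^\epsilon_0(\beta,\gamma)=\mathcal G^\epsilon_0(x_1,1,\beta,\gamma)$, with dual $(\mathcal G^\epsilon_0(\beta,\gamma))'$ carrying the weak-* topology. Hardy space: fix $\epsilon\in(0,1)$, $\beta,\gamma\in(0,\epsilon)$. For $f\in(\mathcal G^\epsilon_0(\beta,\gamma))'$, $G_\rho(f)(x)=\sup\{|\langle f,\varphi\rangle|:\varphi\in\mathcal G^\epsilon_0(\beta,\gamma),\ \|\varphi\|_{\mathcal G(x,r,\beta,\gamma)}\le1\text{ for some }r\in(0,\rho(x))\}$; $H^1_\rho(\mathcal X)=\{f:\|f\|_{H^1_\rho}=\|G_\rho(f)\|_{L^1}<\infty\}$ (its elements are $L^1$ functions). Continuous AOTI: for $\epsilon_1\in(0,1]$, $\epsilon_2,\epsilon_3>0$, a family $\{\tilde S_t\}_{t>0}$ of bounded linear integral operators on $L^2(\mathcal X)$ with kernels $\tilde S_t(x,y)$ is a continuous $(\epsilon_1,\epsilon_2,\epsilon_3)$-AOTI if there is $C_6>0$ such that for all $t>0$ and $x,x',y,y'$: (i) $|\tilde S_t(x,y)|\le C_6\frac{1}{V_t(x)+V(x,y)}\big[\frac{t}{t+d(x,y)}\big]^{\epsilon_2}$; (ii) $|\tilde S_t(x,y)-\tilde S_t(x',y)|\le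 C_6\big[\frac{d(x,x')}{t+d(x,y)}\big]^{\epsilon_1}\frac{1}{V_t(x)+V(x,y)}\big[\frac{t}{t+d(x,y)}\big]^{\epsilon_2}$ for $d(x,x')\le[t+d(x,y)]/2$; (iii) the same with $x$ and $y$ interchanged; (iv) $|[\tilde S_t(x,y)-\tilde S_t(x,y')]-[\tilde S_t(x',y)-\tilde S_t(x',y')]|\le C_6\big[\frac{d(x,x')}{t+d(x,y)}\big]^{\epsilon_1}\big[\frac{d(y,y')}{t+d(x,y)}\big]^{\epsilon_1}\frac{1}{V_t(x)+V(x,y)}\big[\frac{t}{t+d(x,y)}\big]^{\epsilon_3}$ for $d(x,x')\le[t+d(x,y)]/3$, $d(y,y')\le[t+d(x,y)]/3$; (v) $\int\tilde S_t(x,z)\,d\mu(z)=1=\int\tilde S_t(z,y)\,d\mu(z)$. *)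

(* Defs.v *)
From HB Require Import structures.
From mathcomp Require Import all_boot all_order all_algebra.
From mathcomp Require Import all_classical all_reals all_analysis.
Set Implicit Arguments.
Unset Strict Implicit.
Unset Printing Implicit Defensive.
Import Order.TTheory GRing.Theory Num.Theory.
Local Open Scope classical_set_scope.
Local Open Scope ring_scope.

Section RDDefs.
Context {R : realType} {dsp : measure_display} {T : measurableType dsp}.

Definition dball (d : T -> T -> R) (x : T) (r : R) : set T := [set y | d x y < r].

Definition is_metric (d : T -> T -> R) : Prop :=
  (forall x y, 0 <= d x y) /\ (forall x y, d x y = 0 <-> x = y) /\
  (forall x y, d x y = d y x) /\ (forall x y z, d x z <= d x y + d y z).

Definition dopen (d : T -> T -> R) (A : set T) : Prop :=
  forall x, A x -> exists2 r, 0 < r & dball d x r `<=` A.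

Definition ddiam (d : T -> T -> R) : \bar R :=
  ereal_sup [set z | exists x y, z = (d x y)%:E].

Definition Vol (d : T -> T -> R) (mu : {measure set T -> \bar R}) (x : T) (r : R) : R :=
  fine (mu (dball d x r)).

Definition Vxy (d : T -> T -> R) (mu : {measure set T -> \bar R}) (x y : T) : R :=
  Vol d mu x (d x y).

Definition RD_space (d : T -> T -> R) (mu : {measure set T -> \bar R}) : Prop :=
  is_metric d /\
  (@measurable dsp T = <<s dopen d >>) /\
  (forall A, measurable A ->
     mu A = ereal_inf [set mu U | U in [set U | dopen d U /\ A `<=` U]]) /\
  (forall x r, 0 < r -> (0 < mu (dball d x r))%E /\ (mu (dball d x r) < +oo)%E) /\
  (exists C1 : R, forall x r, 0 < r ->
     (mu (dball d x (2 * r)) <= C1%:E * mu (dball d x r))%E) /\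
  (exists kappa n C2 : R, 0 < kappa <= n /\ 1 <= C2 /\
     forall x r lambda, 0 < r -> ((2 * r)%:E < ddiam d)%E ->
       1 <= lambda -> ((lambda * (2 * r))%:E < ddiam d)%E ->
       C2^-1 * lambda `^ kappa * Vol d mu x r <= Vol d mu x (lambda * r) /\
       Vol d mu x (lambda * r) <= C2 * lambda `^ n * Vol d mu x r) /\
  mu setT = +oo%E.

Definition admissible (d : T -> T -> R) (rho : T -> R) : Prop :=
  (forall x, 0 < rho x) /\
  exists C3 k0 : R, 0 < C3 /\ 0 < k0 /\
    forall x y, rho y <= C3 * (rho x) `^ (1 / (1 + k0))
                        * (rho x + d x y) `^ (k0 / (1 + k0)).

Definition decay (d : T -> T -> R) (mu : {measure set T -> \bar R})
    (x : T) (t : R) (g : R) (y : T) : R :=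
  (Vol d mu x t + Vxy d mu x y)^-1 * (t / (t + d x y)) `^ g.

Definition Gbound (d : T -> T -> R) (mu : {measure set T -> \bar R})
    (x : T) (r beta gamma : R) (f : T -> R) (C : R) : Prop :=
  0 <= C /\
  (forall y, `|f y| <= C * decay d mu x r gamma y) /\
  (forall y y', d y y' <= (r + d x y) / 2 ->
     `|f y - f y'| <= C * (d y y' / (r + d x y)) `^ beta * decay d mu x r gamma y).

(* ||f||_{G(x,r,beta,gamma)} (= +oo iff f is not in G(x,r,beta,gamma)) *)
Definition Gnorm (d : T -> T -> R) (mu : {measure set T -> \bar R})
    (x : T) (r beta gamma : R) (f : T -> R) : \bar R :=
  ereal_inf [set C%:E | C in Gbound d mu x r beta gamma f].

Definition G0 (d : T -> T -> R) (mu : {measure set T -> \bar R})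
    (x1 : T) (eps beta gamma : R) : set (T -> R) :=
  [set f | (Gnorm d mu x1 1 beta gamma f < +oo)%E /\
     forall e : R, 0 < e -> exists g : T -> R,
       (Gnorm d mu x1 1 eps eps g < +oo)%E /\
       (Gnorm d mu x1 1 beta gamma (fun y => (f y - g y)%R) < e%:E)%E].

Definition L1 (mu : {measure set T -> \bar R}) (f : T -> R) : Prop :=
  mu.-integrable setT (EFin \o f).

(* grand maximal function G_rho(f)(x) of an L^1 function f, acting on test
   functions by <f,phi> = int f phi dmu *)
Definition Grho (d : T -> T -> R) (mu : {measure set T -> \bar R})
    (rho : T -> R) (x1 : T) (eps beta gamma : R) (f : T -> R) (x : T) : \bar R :=
  ereal_sup [set `|Rintegral mu setT (fun y => f y * phi y)|%:E
            | phi in [set phi | G0 d mu x1 eps beta gamma phi /\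
                 exists r, 0 < r < rho x /\ (Gnorm d mu x r beta gamma phi <= 1)%E]].

Definition H1norm (d : T -> T -> R) (mu : {measure set T -> \bar R})
    (rho : T -> R) (x1 : T) (eps beta gamma : R) (f : T -> R) : \bar R :=
  (\int[mu]_x Grho d mu rho x1 eps beta gamma f x)%E.

Definition kop (mu : {measure set T -> \bar R}) (K : T -> T -> R) (f : T -> R) (x : T) : R :=
  Rintegral mu setT (fun y => K x y * f y).

Definition L2_kernel_op (mu : {measure set T -> \bar R}) (K : T -> T -> R) : Prop :=
  measurable_fun setT (fun p : T * T => K p.1 p.2) /\
  exists M : R, forall f : T -> R, measurable_fun setT f ->
    (\int[mu]_y ((f y) ^+ 2)%:E < +oo)%E ->
    (\int[mu]_x ((kop mu K f x) ^+ 2)%:E <= M%:E * \int[mu]_y ((f y) ^+ 2)%:E)%E.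

Definition cAOTI (d : T -> T -> R) (mu : {measure set T -> \bar R})
    (S : R -> T -> T -> R) (e1 e2 e3 : R) : Prop :=
  (forall t, 0 < t -> L2_kernel_op mu (S t)) /\
  exists C6 : R, 0 < C6 /\ forall t, 0 < t -> forall x x' y y' : T,
    (`|S t x y| <= C6 * decay d mu x t e2 y) /\
    (d x x' <= (t + d x y) / 2 ->
       `|S t x y - S t x' y| <= C6 * (d x x' / (t + d x y)) `^ e1 * decay d mu x t e2 y) /\
    (d y y' <= (t + d x y) / 2 ->
       `|S t x y - S t x y'| <= C6 * (d y y' / (t + d x y)) `^ e1 * decay d mu x t e2 y) /\
    (d x x' <= (t + d x y) / 3 -> d y y' <= (t + d x y) / 3 ->
       `|(S t x y - S t x y') - (S t x' y - S t x' y')|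
         <= C6 * (d x x' / (t + d x y)) `^ e1 * (d y y' / (t + d x y)) `^ e1
               * decay d mu x t e3 y) /\
    (Rintegral mu setT (fun z => S t x z) = 1 /\ Rintegral mu setT (fun z => S t z y) = 1).

Definition Tplus (mu : {measure set T -> \bar R}) (K : R -> T -> T -> R)
    (f : T -> R) (x : T) : \bar R :=
  ereal_sup [set `|kop mu (K t) f x|%:E | t in [set t : R | 0 < t]].

Definition Tplus_rho (mu : {measure set T -> \bar R}) (rho : T -> R) (K : R -> T -> T -> R)
    (f : T -> R) (x : T) : \bar R :=
  ereal_sup [set `|kop mu (K t) f x|%:E | t in [set t : R | 0 < t < rho x]].

End RDDefs.

(* Main.v *)
Require Import Defs.
From HB Require Import structures.
From mathcomp Require Import all_boot all_order all_algebra.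
From mathcomp Require Import all_classical all_reals all_analysis.
From mathcomp Require Import measurable_realfun ring lra.
Import Order.TTheory GRing.Theory Num.Theory.
Import numFieldNormedType.Exports HBNNSimple.
Local Open Scope classical_set_scope.
Local Open Scope ring_scope.
Set Implicit Arguments.
Unset Strict Implicit.
Unset Printing Implicit Defensive.

(**
The constants d, mu, rho enter only through doubling (mu X = oo forces infinite
diameter) and the slow variation of rho.  All kernels are compared with
K g x t y = (t / (t + d x y)) ^ g / V x (t + d x y).

Upper bounds for the maximal functions of T.  For t < rho x the difference
T_t - S_t, for t >= rho x the operator T_t itself, and the part of
K e x (rho x) that a test function leaves outside the ball of radius rho x, are
all dominated by one kernel W x y with sup_y int W x y dx < oo, so they only
cost a multiple of |f|_1.  Conversely |f|_1 <= int T^+_rho f by duality: the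
adjoint T_t^* (h 1_{t < rho}) tends to h pointwise for continuous |h| <= 1.

Grand maximal function.  Following Uchiyama, a test function phi at scale r is
smoothed at the scale eta r, psi y = int phi z S_{eta r}(pi z, y) dz; phi - psi is
a test function at the scale eta^2 r with a norm smaller by a factor C eta^e, and
<f, psi> = int phi z (S_{eta r} f)(pi z) dz.  Choosing pi z to nearly minimise
|S_{eta r} f| on a small ball around z bounds |S_{eta r} f (pi z)| by the
(p - 1)-st power of M g x times g z, where g = v ^ (1/p), v <= S^+_rho f and M is
the Hardy-Littlewood maximal operator; p is so close to 1 that the loss
eta ^ (- n (p - 1)) per step is absorbed by the factor C eta^e.  Summing the
iterates and using the L^p boundedness of M gives
int G f <= C (int S^+_rho f + |f|_1) for every kernel S with the size, regularity
and cancellation of an approximation of the identity.  It is applied to the given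
S, and to a Lipschitz bump kernel whose rows are admissible test functions.
*)

(** * Lower integrals and series indexed by the integers *)

(** The hub of the argument is [grand_max], built with a single exponent [e] that is at most every
    exponent in the data. Up to constants it dominates [Grho] pointwise, and also the maximal
    function of [St], whose rows are test functions of exponent [e]. The rows of [St] cannot be fed
    to [Grho] directly: they are only [e1]-regular, and for [e1] below [beta] they need not be
    admissible there. Hence the detour through the bump kernel: the bound of T^+ by the Hardy norm
    passes from [St] to [grand_max], then to the bump kernel, then to [Grho]. Each direction leaves
    an L1 error, so the L1 lower bound is applied twice, to T and to the bump kernel. The shape of W
    is forced by rho: the comparisons give min(r / rho x, rho x / r)^e / V x r with r = t + d x y,
    where rho depends on the variable of integration. Slow variation moves rho from x to y at the
    price of the factor [a] in the exponent, and a dyadic sum over balls about y then has a bounded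
    integral in x. The root v^(1/p) appears because M is bounded on L^p only for p > 1, while the
    final estimate is in L1. *)

Section lower_integral.
Context d (T : measurableType d) (R : realType) (mu : {measure set T -> \bar R}).
Local Open Scope ereal_scope.

Lemma le_lower_integral (F G : T -> \bar R) :
  (forall x, 0 <= F x) -> (forall x, F x <= G x) ->
  \int[mu]_x F x <= \int[mu]_x G x.
Proof.
move=> F0 FG; have G0 x : 0 <= G x by exact: le_trans (F0 x) (FG x).
rewrite !ge0_integralTE//; apply: ereal_sup_le => _ [h hF <-].
by exists h => // x; exact: le_trans (hF x) (FG x).
Qed.

(* The integral of a nonnegative function that is not known to be measurable (here
   the maximal functions) is a supremum over the simple functions below it: it is
   monotone, but additive only up to a measurable summand. *)
Lemma lower_integral_le_affine (F U G : T -> \bar R) (a : R) : (0 < a)%R ->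
  (forall x, 0 <= F x) -> (forall x, 0 <= U x) -> (forall x, 0 <= G x) ->
  measurable_fun setT G ->
  (forall x, F x <= a%:E * U x + G x) ->
  \int[mu]_x F x <= a%:E * \int[mu]_x U x + \int[mu]_x G x.
Proof.
move=> a0 F0 U0 G0 mG FUG.
rewrite [X in X <= _](ge0_integralTE mu F0); apply: ge_ereal_sup => _ [h hF <-].
rewrite -integralT_nnsfun.
(* The positive part of h - G is measurable, and k / a lies below U; so its integral is bounded by
   the lower integral of U although U itself may not be measurable. *)
pose k x := maxe ((h x)%:E - G x) 0.
have mh : measurable_fun setT (fun x => (h x)%:E) by exact/measurable_EFinP.
have mk : measurable_fun setT k.
  by apply: measurable_maxe => //; exact: emeasurable_funB.
have k0 x : 0 <= k x by rewrite /k le_max lexx orbT.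
have hkG x : (h x)%:E <= k x + G x.
  case Gx : (G x) => [g| |]; last by have := G0 x; rewrite Gx.
    by rewrite /k Gx -EFinB -EFin_max -EFinD lee_fin -lerBlDr le_max lexx.
  exact: le_trans (leey _) (leeDr _ (k0 x)).
have kU x : (a^-1)%:E * k x <= U x.
  rewrite lee_pdivrMl// /k ge_max; apply/andP; split; last first.
    by rewrite mule_ge0// lee_fin ltW.
  have := le_trans (hF x) (FUG x); have := G0 x; case: (G x) => [g| |]// _.
    by rewrite leeBlDr.
  by move=> _; exact: leNye.
apply: (@le_trans _ _ (\int[mu]_x (k x + G x))).
  apply: ge0_le_integral => //.
  - by move=> x _; rewrite lee_fin.
  - exact: emeasurable_funD.
rewrite ge0_integralD//; apply: leeD => //.
rewrite (_ : \int[mu]_x k x = a%:E * \int[mu]_x ((a^-1)%:E * k x)).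
  apply: lee_wpmul2l; first by rewrite lee_fin ltW.
  apply: le_lower_integral => // x; rewrite mule_ge0// lee_fin invr_ge0 ltW//.
rewrite ge0_integralZl_EFin//; last by rewrite invr_ge0 ltW.
by rewrite muleA -EFinM mulfV ?mul1e// gt_eqF.
Qed.

Lemma lower_integral_leZ (F U : T -> \bar R) (a : R) : (0 < a)%R ->
  (forall x, 0 <= F x) -> (forall x, 0 <= U x) -> (forall x, F x <= a%:E * U x) ->
  \int[mu]_x F x <= a%:E * \int[mu]_x U x.
Proof.
move=> a0 F0 U0 FU.
have := @lower_integral_le_affine F U (cst 0) a a0 F0 U0.
by rewrite integral0 adde0; apply => // x; rewrite ?adde0.
Qed.

Lemma measurable_ereal_sup_count (I : countType) (F : I -> T -> \bar R) :
  (forall i, measurable_fun setT (F i)) ->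
  measurable_fun setT (fun x => ereal_sup [set F i x | i in setT]).
Proof.
move=> mF _; apply: (measurability _ (ErealGenOInfty.measurableE R)) => //.
move=> _ [_ [r ->] <-]; rewrite setTI.
rewrite (_ : _ @^-1` _ = \bigcup_i (F i @^-1` `]r%:E, +oo[)).
  apply: countable_bigcupT_measurable => [|i]; first exact: countableP.
  by rewrite -[X in measurable X]setTI; exact/mF/emeasurable_itv.
apply/seteqP; split => x /=; rewrite ?in_itv/= ?andbT.
  by move=> /ereal_sup_gt[_ [i _ <-] rF]; exists i => //=; rewrite in_itv/= andbT.
move=> [i _ /=]; rewrite in_itv/= andbT => /lt_le_trans; apply.
by apply: ereal_sup_ubound; exists i.
Qed.

End lower_integral.

Section series.
Context (R : realType).

Lemma nneseries_le_bound (u : nat -> R) (M : R) : (forall n, 0 <= u n) ->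
  (forall n, \sum_(0 <= k < n) u k <= M) ->
  (\sum_(n <oo) (u n)%:E <= M%:E)%E.
Proof.
move=> u0 uM; apply: lime_le.
  by apply: is_cvg_nneseries => n _ _; rewrite lee_fin.
by apply: nearW => n; rewrite sumEFin lee_fin.
Qed.

Lemma le_nneseries_term (u : nat -> \bar R) n : (forall k, 0 <= u k)%E ->
  (u n <= \sum_(k <oo) u k)%E.
Proof.
move=> u0; apply: le_trans (nneseries_lim_ge n.+1 _) => //.
by rewrite big_nat_recr//= leeDr// sume_ge0.
Qed.

Lemma nneseries_geometric_le (c q : R) : 0 <= c -> 0 < q < 1 ->
  (\sum_(n <oo) (c * q ^+ n)%:E <= (c / (1 - q))%:E)%E.
Proof.
move=> c0 /andP[q0 q1]; apply: nneseries_le_bound => [n|n].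
  by rewrite mulr_ge0// exprn_ge0// ltW.
have := @geometric_le_lim R n c q c0 q0; apply.
by rewrite ger0_norm// ltW.
Qed.

(** [Negz k] is -(k + 1), so pairing it with [Posz k] meets every integer exactly once and reduces
    to a series over the naturals. *)
Definition zseries (F : int -> \bar R) : \bar R :=
  (\sum_(k <oo) (F (Posz k) + F (Negz k)))%E.

Lemma le_zseries_term (F : int -> \bar R) j : (forall k, 0 <= F k)%E ->
  (F j <= zseries F)%E.
Proof.
move=> F0; have h k : (0 <= F (Posz k) + F (Negz k))%E by rewrite adde_ge0.
case: j => k; apply: le_trans (le_nneseries_term k h);
  by [rewrite leeDl | rewrite leeDr].
Qed.

Lemma zseries_ge0 (F : int -> \bar R) : (forall k, 0 <= F k)%E ->
  (0 <= zseries F)%E.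
Proof. by move=> F0; apply: nneseries_ge0 => k _ _; rewrite adde_ge0. Qed.

Lemma le_zseries (F G : int -> \bar R) : (forall k, 0 <= F k)%E ->
  (forall k, F k <= G k)%E -> (zseries F <= zseries G)%E.
Proof.
move=> F0 FG; apply: lee_nneseries => [k _ _|k _]; first by rewrite adde_ge0.
by rewrite leeD.
Qed.

Lemma zseries_le_bound (F : int -> R) (M : R) : (forall k, 0 <= F k) ->
  (forall n, \sum_(0 <= k < n) (F (Posz k) + F (Negz k)) <= M) ->
  (zseries (fun k => (F k)%:E) <= M%:E)%E.
Proof.
move=> F0 FM; apply: (@nneseries_le_bound (fun k => F (Posz k) + F (Negz k))) => // n.
by rewrite addr_ge0.
Qed.

Lemma zseries_geometric_le (q : R) : 0 < q < 1 ->
  (zseries (fun k => (q ^+ `|k|%N)%:E) <= (2 / (1 - q))%:E)%E.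
Proof.
move=> q01; apply: le_trans (nneseries_geometric_le _ q01) => //.
case/andP: q01 => q0 q1.
apply: lee_nneseries => k _ => [_|]; rewrite -EFinD lee_fin.
  by rewrite addr_ge0// exprn_ge0// ltW.
rewrite /= mulrDl mul1r lerD2l exprS.
by rewrite ler_piMl ?exprn_ge0 ?ltW.
Qed.

Lemma zseries_le_telescope (F G : int -> R) (M : R) :
  (forall k, 0 <= F k) -> (forall k, F k <= G k - G (k - 1)) ->
  (forall k, 0 <= G k) -> (forall k, G k <= M) ->
  (zseries (fun k => (F k)%:E) <= M%:E)%E.
Proof.
move=> F0 FG G0 GM; apply: zseries_le_bound => // n.
(* The first n pairs are the indices -n, ..., n - 1, whose increments of G telescope. *)
suff : \sum_(0 <= k < n) (F k + F (Negz k)) <= G (n%:Z - 1) - G (- n%:Z - 1).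
  by move=> /le_trans; apply; rewrite lerBlDr; apply: le_trans (GM _) _; rewrite lerDl.
elim: n => [|n ih]; first by rewrite big_geq// subr_ge0 oppr0 sub0r lexx.
rewrite big_nat_recr//=.
have := FG n%:Z; have := FG (Negz n).
have -> : Negz n = - (n%:Z) - 1 by rewrite NegzE -addn1 PoszD opprD.
have -> : n.+1%:Z - 1 = n%:Z by rewrite -addn1 PoszD addrK.
have -> : - n.+1%:Z - 1 = - n%:Z - 1 - 1 by rewrite -addn1 PoszD opprD.
by move: ih; lra.
Qed.

Lemma dyadic_bracket (r : R) : 0 < r -> exists k : int, 2 ^ k <= r < 2 ^ (k + 1).
Proof.
move=> r0; pose k := Num.floor (ln r / ln 2).
have l2 : 0 < ln 2 :> R by rewrite ln_gt0// ltr1n.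
have e (m : int) : (2 : R) ^ m = expR (m%:~R * ln 2).
  by rewrite -powR_intmul// /powR gt_eqF.
exists k; rewrite !e -[X in _ <= X]lnK ?posrE// -[X in X < _]lnK ?posrE//.
rewrite ler_expR ltr_expR -ler_pdivlMr// -ltr_pdivrMr//.
exact: floor_itv.
Qed.

End series.

Section zseries_integral.
Context d (T : measurableType d) (R : realType) (mu : {measure set T -> \bar R}).

Lemma integral_zseries (F : int -> T -> \bar R) :
  (forall k, measurable_fun setT (F k)) -> (forall k x, 0 <= F k x)%E ->
  (\int[mu]_x zseries (fun k => F k x) = zseries (fun k => \int[mu]_x F k x))%E.
Proof.
move=> mF F0; rewrite integral_nneseries//.
- by apply: eq_eseriesr => k _; rewrite ge0_integralD.
- by move=> k; exact: emeasurable_funD.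
- by move=> k x _; rewrite adde_ge0.
Qed.

Lemma measurable_zseries (F : int -> T -> \bar R) :
  (forall k, measurable_fun setT (F k)) -> (forall k x, 0 <= F k x)%E ->
  measurable_fun setT (fun x => zseries (fun k => F k x)).
Proof.
move=> mF F0; apply: ge0_emeasurable_sum => [k x _ _|k _].
- by rewrite adde_ge0.
- exact: emeasurable_funD.
Qed.

End zseries_integral.

(** * Doubling metric measure spaces *)


(** The main theorem speaks of a plain measure, whereas Tonelli and Fubini need the sigma-finite
    structure. Sigma-finiteness is derived from the balls and the measure is then repackaged, with
    an equality to rewrite along. *)
Lemma sigma_finite_pack dsp (T : measurableType dsp) (R : realType)
    (mu : {measure set T -> \bar R}) : sigma_finite setT mu ->
  exists nu : {sigma_finite_measure set T -> \bar R},
    (nu : {measure set T -> \bar R}) = mu.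
Proof.
case: mu => m [a b] sf.
pose mm : {measure set T -> \bar R} := Measure.Pack (@Measure.Class _ _ _ _ a b).
pose nu := HB.pack_for {sigma_finite_measure set T -> \bar R} m mm
  (@Measure_isSigmaFinite.Build dsp T R mm sf).
by exists nu.
Qed.

Record doubling_space (R : realType) dsp (X : measurableType dsp)
    (d : X -> X -> R) (mu : {measure set X -> \bar R}) (D n : R) : Prop :=
  DoublingSpace {
    ds_metric : is_metric d;
    ds_borel : @measurable dsp X = <<s dopen d >>;
    ds_ball : forall x r, 0 < r -> (0 < mu (dball d x r) < +oo)%E;
    ds_D1 : 1 <= D;
    ds_n0 : 0 < n;
    ds_doubling : forall x r l, 0 < r -> 1 <= l ->
      Vol d mu x (l * r) <= D * l `^ n * Vol d mu x r }.

Section doubling.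
Context (R : realType) dsp (X : measurableType dsp) (d : X -> X -> R)
  (mu : {measure set X -> \bar R}) (D n : R).
Hypothesis DS : doubling_space d mu D n.
Local Notation V := (Vol d mu).
Local Notation B := (dball d).

Lemma dm_ge0 x y : 0 <= d x y.
Proof. by have [H _] := ds_metric DS; exact: H. Qed.

Lemma dm_refl x : d x x = 0.
Proof. by have [_ [H _]] := ds_metric DS; exact/H. Qed.

Lemma dm_sym x y : d x y = d y x.
Proof. by have [_ [_ [H _]]] := ds_metric DS; exact: H. Qed.

Lemma dm_triangle y x z : d x z <= d x y + d y z.
Proof. by have [_ [_ [_ H]]] := ds_metric DS; exact: H. Qed.

Lemma dopen_measurable (A : set X) : dopen d A -> measurable A.
Proof. by move=> oA; rewrite (ds_borel DS); exact: sub_sigma_algebra. Qed.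

Lemma dopen_ball x r : dopen d (B x r).
Proof.
move=> y; rewrite /dball/= => yr; exists (r - d x y); first by rewrite subr_gt0.
by move=> z; rewrite /dball/= => yz; have := dm_triangle y x z; lra.
Qed.

Lemma measurable_dball x r : measurable (B x r).
Proof. exact/dopen_measurable/dopen_ball. Qed.

Lemma measure_dball x r : 0 < r -> mu (B x r) = (V x r)%:E.
Proof.
by move=> r0; have /andP[m0 mo] := ds_ball DS x r0; rewrite fineK// ge0_fin_numE// ltW.
Qed.

Lemma Vol_gt0 x r : 0 < r -> 0 < V x r.
Proof. by move=> r0; rewrite -lte_fin -measure_dball//; case/andP: (ds_ball DS x r0). Qed.

Lemma Vol_ge0 x r : 0 <= V x r.
Proof. exact: fine_ge0. Qed.

Lemma le_Vol x y r s : 0 < s -> d x y + r <= s -> V x r <= V y s.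
Proof.
move=> s0 h; have [r0|r0] := ltP 0 r.
  rewrite -lee_fin -!measure_dball//; apply: le_measure; rewrite ?inE;
    [exact: measurable_dball|exact: measurable_dball|].
  move=> z; rewrite /dball/= => xz; have := dm_triangle x y z.
  by rewrite (dm_sym y x); lra.
rewrite /Vol (_ : B x r = set0) ?measure0 ?fine_ge0//.
by apply/seteqP; split => // z; rewrite /dball/=; have := dm_ge0 x z; lra.
Qed.

Lemma le_Vol_doubling x y r s : 0 < s -> s <= d x y + r ->
  V x r <= D * ((d x y + r) / s) `^ n * V y s.
Proof.
move=> s0 h; have h0 : 0 < d x y + r by exact: lt_le_trans h.
apply: le_trans (@le_Vol x y r (d x y + r) h0 (lexx _)) _.
rewrite {1}(_ : d x y + r = (d x y + r) / s * s); last by rewrite divfK ?gt_eqF.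
by apply: (ds_doubling DS) => //; rewrite ler_pdivlMr ?mul1r.
Qed.

Lemma doubling_D0 : 0 < D.
Proof. exact: lt_le_trans (ds_D1 DS). Qed.

(** A packing argument: [e]-separated points of the ball carry disjoint balls of radius e / 2, each
    of measure at least [c], inside a ball of finite measure, so their number is bounded. If no
    finite net existed, a separated list could be extended forever. *)
Lemma separated_net (x0 : X) (N e : R) : 0 < N -> 0 < e ->
  exists s : seq X, forall x, d x0 x < N -> exists2 z, z \in s & d x z < e.
Proof.
move=> N0 e0.
pose P (s : seq X) := [/\ all (fun z => d x0 z < N) s &
  pairwise (fun x y => e <= d x y) s].
(* For z in the ball, d x0 z + N is below 2 N. The extra [e] keeps the ratio at least 1, which also
   covers the case where e / 2 exceeds d x0 z + N. *)
pose c := (D * ((2 * N + e) / (e / 2)) `^ n)^-1 * V x0 N.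
have q0 : 0 < (2 * N + e) / (e / 2) by rewrite divr_gt0// ?divr_gt0//; lra.
have c0 : 0 < c.
  by rewrite mulr_gt0 ?Vol_gt0// invr_gt0 mulr_gt0 ?powR_gt0// doubling_D0.
have cV z : d x0 z < N -> c <= V z (e / 2).
  move=> zN; rewrite /c mulrC ler_pdivrMr; last by rewrite mulr_gt0 ?powR_gt0// doubling_D0.
  rewrite mulrC; have e20 : 0 < e / 2 by rewrite divr_gt0.
  have [h|h] := leP (e / 2) (d x0 z + N).
    apply: le_trans (le_Vol_doubling e20 h) _; apply: ler_wpM2r; first exact: Vol_ge0.
    apply: ler_wpM2l; first exact/ltW/doubling_D0.
    apply: ge0_ler_powR; rewrite ?nnegrE ?(ltW q0) ?(ltW (ds_n0 DS))//.
      by rewrite divr_ge0 ?(ltW e20)//; have := dm_ge0 x0 z; lra.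
    by rewrite ler_pM2r ?invr_gt0//; lra.
  apply: le_trans (@le_Vol x0 z N (e / 2) e20 (ltW h)) _.
  rewrite ler_peMl ?Vol_ge0//.
  rewrite -[leLHS]mulr1 ler_pM// ?(ds_D1 DS)//.
  rewrite -{1}(powRr0 ((2 * N + e) / (e / 2))) ler_powR ?(ltW (ds_n0 DS))//.
  by rewrite ler_pdivlMr//; lra.
have bnd s : P s -> c * (size s)%:R <= V x0 (N + e).
  move=> [sN sp].
  suff : ((c * (size s)%:R)%:E <= mu (\big[setU/set0]_(z <- s) B z (e / 2)))%E.
    rewrite -lee_fin => /le_trans; apply; rewrite -measure_dball ?addr_gt0//.
    apply: le_measure; rewrite ?inE; [|exact: measurable_dball|].
      by apply: bigsetU_measurable => z _; exact: measurable_dball.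
    elim: s sN {sp} => [|z s ih] /=; first by rewrite big_nil => _ y [].
    move=> /andP[zN sN]; rewrite big_cons subUset; split; last exact: ih.
    move=> y; rewrite /dball/= => zy; have := dm_triangle z x0 y; lra.
  elim: s sN sp => [|z s ih]; first by rewrite /= mulr0.
  rewrite [all _ _]/= pairwise_cons => /andP[zN sN] /andP[zs sp].
  rewrite big_cons measureU.
  - rewrite [size _]/= -natr1 mulrDr mulr1 addrC EFinD leeD ?ih//.
    apply: (@le_trans _ _ (V z (e / 2))%:E); first by rewrite lee_fin cV.
    by rewrite -measure_dball ?divr_gt0.
  - exact: measurable_dball.
  - by apply: bigsetU_measurable => w _; exact: measurable_dball.
  - apply/seteqP; split => // y [zy].
    elim: s zs {ih sN sp} => [|w s ih]; first by rewrite big_nil.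
    rewrite [all _ _]/= => /andP[zw zs]; rewrite big_cons => -[wy|]; last exact: ih.
    have := dm_triangle y z w; move: zy wy zw; rewrite /dball/= (dm_sym w y); lra.
apply: contrapT => /forallNP H.
suff step m : exists s, P s /\ size s = m.
  have [m Hm] : exists m : nat, V x0 (N + e) / c < m%:R.
    by exists (Num.truncn (V x0 (N + e) / c)).+1; exact: truncnS_gt.
  have [s [/bnd + sm]] := step m.
  by rewrite sm mulrC leNgt -ltr_pdivrMr// Hm.
elim: m => [|m [s [[sN sp] sm]]]; first by exists [::].
have /existsNP[x /not_implyP[xN Hx]] := H s.
exists (x :: s); split; last by rewrite /= sm.
split; rewrite /= ?xN// sp andbT.
apply/allP => z zs; rewrite leNgt; apply/negP => xz.
by apply: Hx; exists z.
Qed.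

Lemma separable (x0 : X) : exists y : nat -> X,
  forall x e, 0 < e -> exists i, d x (y i) < e.
Proof.
have N0 (m : nat) : 0 < m.+1%:R :> R by [].
have e0 (m : nat) : 0 < m.+1%:R^-1 :> R by rewrite invr_gt0.
pose net (p : nat * nat) := projT1 (cid (separated_net x0 (N0 p.1) (e0 p.2))).
pose y i := if unpickle i is Some (p, j) then nth x0 (net p) j else x0.
exists y => x e he.
have [a Ha] : exists a : nat, d x0 x < a.+1%:R.
  by exists (Num.truncn (d x0 x)); exact: truncnS_gt.
have [b] := ltr_add_invr he; rewrite add0r => Hb.
have [z zs xz] := projT2 (cid (separated_net x0 (N0 a) (e0 b))) x Ha.
exists (pickle ((a, b), index z (net (a, b)))).
by rewrite /y pickleK nth_index//; apply: lt_trans Hb.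
Qed.

Lemma sigma_finite_doubling (x0 : X) : sigma_finite setT mu.
Proof.
exists (fun k : nat => B x0 k.+1%:R).
  apply/seteqP; split => // x _; exists (Num.truncn (d x0 x)) => //.
  by rewrite /dball/=; exact: truncnS_gt.
move=> k; split; first exact: measurable_dball.
by have /andP[] := ds_ball DS x0 (ltr0Sn R k).
Qed.

(** Measurability is meant for the product sigma-algebra. Separability writes the set where d < c as
    a countable union of products of balls centred at the dense sequence. *)
Lemma measurable_dist : measurable_fun setT (fun p : X * X => d p.1 p.2).
Proof.
have [[x0 _]|X0] := pselect (exists x0 : X, True); last first.
  have E (A : set (X * X)) : A = set0.
    by apply/seteqP; split => // -[x ? _]; apply: X0; exists x.
  by move=> _ A _; rewrite (E (_ `&` _)).
have [y Hy] := separable x0.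
move=> _; apply: (measurability _ (RGenInftyO.measurableE R)) => //.
move=> _ [_ [c ->] <-]; rewrite setTI.
rewrite (_ : _ @^-1` _ = \bigcup_i \bigcup_m
    (B (y i) m.+1%:R^-1 `*` B (y i) (c - m.+1%:R^-1))).
  apply: bigcup_measurable => i _; apply: bigcup_measurable => m _.
  by apply: measurableX; exact: measurable_dball.
apply/seteqP; split => [[x z]|[x z]]; rewrite /= in_itv/=.
  move=> xzc; have [m] := @ltr_add_invr R 0 ((c - d x z) / 2) ltac:(lra).
  rewrite add0r => Hm.
  have [i Hi] := Hy x m.+1%:R^-1 ltac:(by rewrite invr_gt0).
  exists i => //; exists m => //; rewrite /dball/= (dm_sym _ x); split => //.
  have := dm_triangle x (y i) z; rewrite (dm_sym (y i) x).
  by move: (m.+1%:R^-1) Hm Hi => e; lra.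
move=> [i _ [m _]]; rewrite /dball/= => -[h1 h2].
have := dm_triangle (y i) x z; rewrite (dm_sym x (y i)).
by move: (m.+1%:R^-1) h1 h2 => e; lra.
Qed.

Lemma dcontinuous_measurable (f : X -> R) :
  (forall x e, 0 < e -> exists2 r, 0 < r & forall y, d x y < r -> `|f x - f y| < e) ->
  measurable_fun setT f.
Proof.
move=> cf _; apply: (measurability _ (RGenInftyO.measurableE R)) => //.
move=> _ [_ [c ->] <-]; rewrite setTI; apply: dopen_measurable => x.
rewrite /= in_itv/= => fxc.
have [r r0 Hr] := cf x (c - f x) ltac:(by rewrite subr_gt0).
exists r => // y /Hr; rewrite /= in_itv/= ltr_norml => /andP[]; lra.
Qed.

End doubling.

(** * The Hardy-Littlewood maximal theorem *)


Section maximal.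
Context (R : realType) dsp (X : measurableType dsp) (d : X -> X -> R)
  (mu : {measure set X -> \bar R}) (D n : R).
Hypothesis DS : doubling_space d mu D n.
Variables (c : nat -> X) (r : nat -> R).
Hypothesis r0 : forall i, 0 < r i.
Local Notation B i := (dball d (c i) (r i)).
Local Notation Vb i := (Vol d mu (c i) (r i)).
Let C3 := D * 3 `^ n.

Let C30 : 0 < C3.
Proof. by rewrite mulr_gt0 ?powR_gt0// (doubling_D0 DS). Qed.

Let mB i : measurable (B i). Proof. exact: measurable_dball DS _ _. Qed.

(* Vitali's covering argument, as an induction on the finite family of balls *)
Lemma vitali_weak_finite (g : X -> \bar R) (l : R) (s : seq nat) :
  measurable_fun setT g -> (forall x, 0 <= g x)%E -> 0 < l ->
  (forall i, i \in s -> (l%:E * mu (B i) <= \int[mu]_(x in B i) g x)%E) ->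
  (l%:E * mu (\big[setU/set0]_(i <- s) B i) <=
     C3%:E * \int[mu]_(x in \big[setU/set0]_(i <- s) B i) g x)%E.
Proof.
move=> mg g0 l0.
have mU s' : measurable (\big[setU/set0]_(i <- s') B i).
  by apply: bigsetU_measurable.
have mg' A : measurable_fun A g by exact: measurable_funTS.
have [m] := ubnP (size s); elim: m s => // m ih s /ltnSE sm Hs.
case: s sm Hs => [|i0 s0]; first by move=> _ _; rewrite big_nil measure0 mule0 integral_set0 mule0.
set s := i0 :: s0 => sm Hs.
have [j js jmax] : exists2 j, j \in s & forall i, i \in s -> r i <= r j.
  rewrite /s; elim: (s0) (i0) => [|a s' ih'] b.
    by exists b => [|i]; rewrite inE// => /eqP ->.
  have [j ja jm] := ih' a; have [jb|jb] := leP (r b) (r j).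
    exists j; first by rewrite inE ja orbT.
    by move=> i; rewrite inE => /orP[/eqP ->//|/jm].
  exists b; first by rewrite inE eqxx.
  move=> i; rewrite inE => /orP[/eqP ->//|/jm ij].
  by apply: ltW; exact: le_lt_trans ij jb.
pose s1 := [seq i <- s | `[< B i `&` B j = set0 >]].
have s1s : (size s1 < size s)%N.
  rewrite size_filter -(count_predC (fun i => `[< B i `&` B j = set0 >]) s).
  rewrite -[X in (X < _)%N]addn0 ltn_add2l -has_count; apply/hasP; exists j => //=.
  apply/negP => /asboolP; rewrite setIid => /seteqP[/(_ (c j)) + _]; apply.
  by rewrite /dball/= (dm_refl DS) r0.
have := ih s1 (leq_trans s1s sm) _.
have Hs1 i : i \in s1 -> (l%:E * mu (B i) <= \int[mu]_(x in B i) g x)%E.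
  by rewrite mem_filter => /andP[_ /Hs].
move=> /(_ Hs1) {}ih.
have sub1 : \big[setU/set0]_(i <- s) B i `<=`
    dball d (c j) (3 * r j) `|` \big[setU/set0]_(i <- s1) B i.
  move=> x; rewrite -!bigcup_seq => -[i /= si xi].
  have [ij|/eqP/set0P[y [yi yj]]] := pselect (B i `&` B j = set0).
    by right; exists i => //=; rewrite mem_filter si andbT; apply/asboolP.
  left; move: xi yi yj (jmax _ si); rewrite /dball/= => xi yi yj ij.
  have := dm_triangle DS y (c j) x; have := dm_triangle DS (c i) y x.
  by rewrite (dm_sym DS y (c i)); lra.
have dis : B j `&` \big[setU/set0]_(i <- s1) B i = set0.
  apply/seteqP; split => // x [xj]; rewrite -bigcup_seq => -[i /=].
  rewrite mem_filter => /andP[/asboolP ij _] xi.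
  by have : (B i `&` B j) x by []; rewrite ij.
apply: (@le_trans _ _ (l%:E * (mu (dball d (c j) (3 * r j)) +
    mu (\big[setU/set0]_(i <- s1) B i)))%E).
  apply: lee_wpmul2l; first by rewrite lee_fin ltW.
  apply: le_trans (measureU2 _ _ _).
  - apply: le_measure; rewrite ?inE//.
    by apply: measurableU => //; exact: (measurable_dball DS).
  - exact: (measurable_dball DS).
  - exact: mU.
rewrite ge0_muleDr//.
apply: (@le_trans _ _ (C3%:E * (\int[mu]_(x in B j) g x +
    \int[mu]_(x in \big[setU/set0]_(i <- s1) B i) g x))%E).
  rewrite ge0_muleDr ?integral_ge0//; apply: leeD => //.
  apply: (@le_trans _ _ (C3%:E * (l%:E * mu (B j)))%E); last first.
    by apply: lee_wpmul2l; [rewrite lee_fin ltW|exact: Hs].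
  rewrite muleCA; apply: lee_wpmul2l; first by rewrite lee_fin ltW.
  rewrite !(measure_dball DS) ?mulr_gt0// -EFinM lee_fin /C3.
  by apply: (ds_doubling DS) => //; lra.
apply: lee_wpmul2l; first by rewrite lee_fin ltW.
rewrite -ge0_integral_setU//; last first.
  by apply/disj_setPRL => x xs xj; have : set0 x by rewrite -dis.
apply: ge0_subset_integral => //; first exact: measurableU.
rewrite subUset; split => x.
  by move=> xj; rewrite -bigcup_seq; exists j.
rewrite -!bigcup_seq => -[i /=]; rewrite mem_filter => /andP[_ si] xi.
by exists i.
Qed.

Lemma vitali_weak (g : X -> \bar R) (l : R) (P : nat -> Prop) :
  measurable_fun setT g -> (forall x, 0 <= g x)%E -> 0 < l ->
  (forall i, P i -> (l%:E * mu (B i) <= \int[mu]_(x in B i) g x)%E) ->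
  (mu (\bigcup_(i in P) B i) <= (C3 / l)%:E * \int[mu]_x g x)%E.
Proof.
move=> mg g0 l0 HP.
pose U m := \big[setU/set0]_(i <- [seq i <- iota 0 m | `[< P i >]]) B i.
have mU m : measurable (U m) by apply: bigsetU_measurable.
have UE : \bigcup_(i in P) B i = \bigcup_m U m.
  apply/seteqP; split => x.
    move=> [i Pi xi]; exists i.+1 => //; rewrite /U -bigcup_seq; exists i => //.
    by rewrite /mkset mem_filter mem_iota /= add0n ltnSn andbT; apply/asboolP.
  move=> [m _]; rewrite /U -bigcup_seq => -[i /=]; rewrite mem_filter.
  by move=> /andP[/asboolP Pi _] xi; exists i.
have ndU : nondecreasing_seq U.
  move=> a b ab; apply/subsetPset => x; rewrite /U -!bigcup_seq => -[i /=].
  rewrite mem_filter mem_iota /= add0n => /andP[Pi ia] xi; exists i => //=.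
  by rewrite mem_filter mem_iota /= add0n Pi (leq_trans ia).
rewrite UE; have cU := @nondecreasing_cvg_mu _ _ _ mu _ mU (bigcupT_measurable _ mU) ndU.
rewrite -(cvg_lim _ cU)//; apply: lime_le; first by apply/cvg_ex; eexists; exact: cU.
apply: nearW => m /=.
have := @vitali_weak_finite g l [seq i <- iota 0 m | `[< P i >]] mg g0 l0.
have h i : i \in [seq i <- iota 0 m | `[< P i >]] ->
    (l%:E * mu (B i) <= \int[mu]_(x in B i) g x)%E.
  by rewrite mem_filter => /andP[/asboolP Pi _]; exact: HP.
move=> /(_ h); rewrite -/(U m) => {}h.
rewrite mulrC EFinM -muleA lee_pdivlMl//; apply: le_trans h _.
apply: lee_wpmul2l; first by rewrite lee_fin ltW.
by apply: ge0_subset_integral.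
Qed.

Definition bavg (g : X -> \bar R) i : \bar R :=
  ((Vb i)^-1)%:E * \int[mu]_(x in B i) g x.

(** The supremum runs over a fixed countable family of balls, with the indicator selecting those
    that contain x; this makes it measurable. A [covering_family] is rich enough for it to control
    the averages over all balls. *)
Definition maxfun (g : X -> \bar R) (x : X) : \bar R :=
  ereal_sup [set bavg g i * (\1_(B i) x)%:E | i in setT]%E.

Let Vb0 i : 0 < Vb i. Proof. exact: (Vol_gt0 DS). Qed.

Lemma bavg_ge0 g i : (forall x, 0 <= g x)%E -> (0 <= bavg g i)%E.
Proof.
move=> g0; rewrite /bavg mule_ge0 ?integral_ge0//.
by rewrite lee_fin invr_ge0 ltW.
Qed.

Lemma bavg_le_maxfun g i x : B i x -> (bavg g i <= maxfun g x)%E.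
Proof.
by move=> xi; apply: ereal_sup_ubound; exists i => //; rewrite indicE mem_set// mule1.
Qed.

Lemma maxfun_ge0 g x : (forall x, 0 <= g x)%E -> (0 <= maxfun g x)%E.
Proof.
move=> g0; apply: le_trans (ereal_sup_ubound _); last by exists 0%N.
by rewrite mule_ge0 ?bavg_ge0// lee_fin.
Qed.

Lemma measurable_maxfun g : measurable_fun setT (maxfun g).
Proof.
apply: measurable_ereal_sup_count => i.
by apply: emeasurable_funM => //; apply/measurable_EFinP; exact: measurable_indic.
Qed.

Lemma maxfun_gt g (l : R) x : 0 <= l ->
  (l%:E < maxfun g x)%E <-> exists2 i, (l%:E < bavg g i)%E & B i x.
Proof.
move=> l0; split => [/ereal_sup_gt[_ [i _ <-]]|[i li xi]]; last first.
  exact: lt_le_trans (bavg_le_maxfun _ xi).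
rewrite indicE; case: (boolP (x \in B i)); rewrite ?inE ?notin_setE => xi.
  by rewrite mule1 => li; exists i.
by rewrite mule0 lte_fin ltNge l0.
Qed.

(** Dyadic form of Marcinkiewicz interpolation between the weak (1,1) bound and the trivial
    L-infinity bound: sum over the levels 2^k, apply the weak bound at level k to the part of g
    above 2^(k - 1), and exchange sum and integral. The remaining sum over k is geometric because p
    - 1 > 0. *)
Lemma maxfun_strong_type (p : R) : 1 < p -> exists C : R, 0 < C /\
  forall g : X -> \bar R, measurable_fun setT g -> (forall x, 0 <= g x)%E ->
  (\int[mu]_x (poweR (maxfun g x) p) <= C%:E * \int[mu]_x (poweR (g x) p))%E.
Proof.
move=> p1; pose s := p - 1; have s0 : 0 < s by rewrite subr_gt0.
have p0 : 0 < p by exact: lt_trans p1.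
pose q : R := 2^-1 `^ s.
have q1 : q < 1.
  have := @gt0_ltr_powR R s s0 2^-1 1; rewrite powR1; apply; rewrite ?nnegrE ?invr_ge0//.
  by rewrite invf_lt1// ltr1n.
have q0 : 0 < q by rewrite powR_gt0 ?invr_gt0.
pose b := C3 * 4 `^ p * 2.
have b0 : 0 < b by rewrite /b mulr_gt0// mulr_gt0 ?powR_gt0.
pose K := b / (1 - q).
have K0 : 0 < K by rewrite divr_gt0// subr_gt0.
have t0 (k : int) : 0 < 2 ^ k :> R by rewrite exprz_gt0.
exists (K * 2 `^ s); split; first by rewrite mulr_gt0 ?powR_gt0.
move=> g mg g0.
pose E (k : int) := [set x | (2 ^ k)%:E < maxfun g x]%E.
have mE k : measurable (E k).
  rewrite /E -[X in measurable X]setTI; apply: emeasurable_fun_o_infty => //.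
  exact: measurable_maxfun.
(* If 2^j <= M g x < 2^(j + 1), the strict level set is only guaranteed to contain x at index j - 1;
   the shift by 2 makes that single term at least (M g x)^p. *)
pose a (k : int) : R := (2 ^ (k + 2)) `^ p.
have aE k : a k = 4 `^ p * (2 ^ k) `^ p.
  rewrite /a expfzDr// mulrC powRM ?(ltW (t0 _))//; congr (_ `^ _ * _).
  by rewrite -exprnP expr2 -natrM.
have a0 k : 0 <= a k by exact: powR_ge0.
have pw x : (poweR (maxfun g x) p <= zseries (fun k => (a k)%:E * (\1_(E k) x)%:E))%E.
  have f0 (k : int) : (0 <= (a k)%:E * (\1_(E k) x)%:E)%E by rewrite mule_ge0 ?lee_fin.
  have := maxfun_ge0 x g0; case Mx : (maxfun g x) => [m| |]// m0; last first.
    rewrite poweRyr ?gt_eqF//; rewrite leye_eq; apply/eqP/eq_infty => t.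
    pose k := Num.truncn t.
    apply: le_trans (le_zseries_term k%:Z f0).
    rewrite indicE mem_set; last by rewrite /E /= Mx ltry.
    rewrite mule1 lee_fin; apply: le_trans (ltW (truncnS_gt t)) _.
    apply: (@le_trans _ _ (2 ^ (k%:Z + 2))); last first.
      by rewrite /a le1r_powR ?(ltW p1)// -exprnP -natrX ler1n expn_gt0.
    rewrite -PoszD -exprnP -natrX ler_nat -/k.
    by apply: leq_trans (ltn_expl _ (ltnSn 1)) _; rewrite leq_exp2l// addn2 ltnW.
  rewrite poweR_EFin; move: m0; rewrite lee_fin le_eqVlt => /predU1P[<-|m0].
    by rewrite powR0 ?gt_eqF// zseries_ge0.
  have [j /andP[jm mj]] := dyadic_bracket m0.
  apply: le_trans (le_zseries_term (j - 1) f0).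
  rewrite indicE mem_set.
    rewrite mule1 lee_fin /a -addrA; apply: ge0_ler_powR; rewrite ?nnegrE ?(ltW p0) ?(ltW m0) ?(ltW (t0 _))//.
    exact: ltW.
  rewrite /E/= Mx lte_fin; apply: lt_le_trans jm.
  by rewrite expfzDr// -[ltRHS]mulr1 ltr_pM2l// -exprnN expr1 invf_lt1// ltr1n.
(* Below the level 2^(k - 1), g contributes at most half of 2^k mu (B i) on a ball, so a ball with
   average above 2^k still has average at least 2^(k - 1) for the truncated function. *)
pose S (k : int) := [set z | (2 ^ (k - 1))%:E < g z]%E.
pose gk (k : int) x := (g x * (\1_(S k) x)%:E)%E.
have mgk k : measurable_fun setT (gk k).
  apply: emeasurable_funM => //; apply/measurable_EFinP; apply: measurable_indic.
  by rewrite -[X in measurable X]setTI; exact: emeasurable_fun_o_infty.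
have gk0 k x : (0 <= gk k x)%E by rewrite mule_ge0// lee_fin.
have muE k : (mu (E k) <= (C3 / 2 ^ (k - 1))%:E * \int[mu]_x gk k x)%E.
  have -> : E k = \bigcup_(i in [set i | (2 ^ k)%:E < bavg g i]%E) B i.
    apply/seteqP; split => x.
      by move=> /(maxfun_gt _ _ (ltW (t0 k)))[i ki xi]; exists i.
    by move=> [i ki xi]; apply/(maxfun_gt _ _ (ltW (t0 k))); exists i.
  apply: vitali_weak => // i /= ki.
  have k2 : 2 ^ k = 2 ^ (k - 1) + 2 ^ (k - 1) :> R.
    by rewrite -{1}(subrK 1 k) expfzDr// expr1z mulr_natr mulr2n.
  have : ((2 ^ k)%:E * mu (B i) <= \int[mu]_(x in B i) g x)%E.
    by rewrite muleC (measure_dball DS)// -lee_pdivlMl//; exact: ltW.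
  have : (\int[mu]_(x in B i) g x <= \int[mu]_(x in B i) gk k x + (2 ^ (k - 1))%:E * mu (B i))%E.
    rewrite -integral_cst// -ge0_integralD//; last first.
    - by move=> x _; rewrite lee_fin ltW.
    - exact: measurable_funTS.
    apply: ge0_le_integral => //; first exact: measurable_funTS.
      by apply: emeasurable_funD => //; exact: measurable_funTS.
    move=> x _; rewrite /gk indicE.
    case: (boolP (x \in _)); rewrite ?inE ?notin_setE/= => h.
      by rewrite mule1 leeDl// lee_fin ltW.
    by rewrite mule0 add0e leNgt; apply/negP.
  move=> h1 h2; have := le_trans h2 h1; rewrite k2 EFinD.
  rewrite ge0_muleDl ?lee_fin ?(ltW (t0 _))// leeD2rE//.
  by rewrite (measure_dball DS).
pose bk (k : int) := a k * (C3 / 2 ^ (k - 1)).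
have bk0 k : 0 <= bk k by rewrite mulr_ge0// divr_ge0 ?ltW.
have bkE k : bk k = b * (2 ^ k) `^ s.
  rewrite /bk aE /b expfzDr// -exprnN expr1 invfM invrK.
  have -> : (2 ^ k) `^ p = (2 ^ k) `^ s * 2 ^ k :> R.
    by rewrite /s mulrC mulr_powRB1// ltW.
  by field; rewrite gt_eqF.
apply: (@le_trans _ _ (\int[mu]_x zseries (fun k => (a k)%:E * (\1_(E k) x)%:E))%E).
  by apply: le_lower_integral => // x; exact: poweR_ge0.
rewrite integral_zseries; first last.
- by move=> k x; rewrite mule_ge0 ?lee_fin.
- by move=> k; apply: measurable_funeM; apply/measurable_EFinP; exact: measurable_indic.
apply: (@le_trans _ _ (zseries (fun k => \int[mu]_x ((bk k)%:E * gk k x)))%E).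
  apply: le_zseries => k.
    by apply: integral_ge0 => x _; rewrite mule_ge0 ?lee_fin.
  have -> : (\int[mu]_x ((a k)%:E * (\1_(E k) x)%:E) = (a k)%:E * mu (E k))%E.
    have m1 : measurable_fun setT (fun x => (\1_(E k) x)%:E : \bar R).
      by apply/measurable_EFinP; exact: measurable_indic.
    have p1' x : setT x -> (0 <= (\1_(E k) x)%:E :> \bar R)%E by rewrite lee_fin.
    by rewrite (ge0_integralZl_EFin mu measurableT p1' m1 (a0 k)) integral_indic ?setIT.
  rewrite ge0_integralZl_EFin// /bk EFinM -muleA.
  by apply: lee_wpmul2l; [rewrite lee_fin|exact: muE].
rewrite -integral_zseries; first last.
- by move=> k x; rewrite mule_ge0 ?lee_fin.
- by move=> k; apply: measurable_funeM.
rewrite -ge0_integralZl_EFin//; first last.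
- by rewrite mulr_ge0 ?powR_ge0 ?ltW.
- exact: (measurableT_comp (measurable_poweR p) mg).
- by move=> x _; exact: poweR_ge0.
apply: le_lower_integral => [x|x].
  by apply: zseries_ge0 => k; rewrite mule_ge0 ?lee_fin.
case gx : (g x) => [y| |]; last by have := g0 x; rewrite gx.
- have y0 : 0 <= y by rewrite -lee_fin -gx.
  pose F k := bk k * (y * \1_(S k) x).
  rewrite (_ : (fun k => _) = (fun k => (F k)%:E)); last first.
    by apply/funext => k; rewrite /gk gx.
  rewrite poweR_EFin -EFinM.
  (* A capped primitive: for 2^(k - 1) < y its increment is exactly b y (2^k)^s, because K (1 - q) =
     b, and it never exceeds K 2^s y^p. *)
  pose G (k : int) := K * y * (Num.min (2 ^ k) (2 * y)) `^ s.
  have m0 (k : int) : 0 <= Num.min (2 ^ k) (2 * y) by rewrite le_min (ltW (t0 k)) mulr_ge0.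
  have Ky0 : 0 <= K * y by rewrite mulr_ge0// ltW.
  apply: (@zseries_le_telescope _ F G).
  + by move=> k; apply: mulr_ge0 => //; apply: mulr_ge0.
  + move=> k; rewrite /F indicE.
    case: (boolP (x \in S k)); rewrite ?inE ?notin_setE /S/= gx lte_fin => h.
      have k1 : 2 ^ (k - 1) = 2 ^ k * 2^-1 :> R by rewrite expfzDr// -exprnN expr1.
      rewrite mulr1 bkE /G !min_l; last 2 first.
      * by move: h; rewrite k1; lra.
      * by move: h; have := t0 k; rewrite k1; lra.
      rewrite k1 powRM ?invr_ge0 ?(ltW (t0 _))// -/q /K le_eqVlt; apply/orP; left.
      by apply/eqP; field; rewrite subr_eq0 gt_eqF.
    rewrite !mulr0 subr_ge0 /G; apply: ler_wpM2l => //.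
    apply: ge0_ler_powR; rewrite ?nnegrE ?(ltW s0)//.
    rewrite le_min !ge_min lexx orbT andbT; apply/orP; left.
    by rewrite ler_eXz2l ?ltr1n// lerBlDr lerDl.
  + by move=> k; rewrite mulr_ge0 ?powR_ge0.
  + move=> k; apply: (@le_trans _ _ (K * y * (2 * y) `^ s)).
      apply: ler_wpM2l => //; apply: ge0_ler_powR; rewrite ?nnegrE ?(ltW s0) ?mulr_ge0//.
      by rewrite ge_min lexx orbT.
    rewrite powRM// -(mulr_powRB1 y0 p0) -/s le_eqVlt; apply/orP; left; apply/eqP; ring.
- by rewrite poweRyr ?gt_eqF// gt0_muley ?leey// lte_fin mulr_gt0 ?powR_gt0.
Qed.

End maximal.

(** * Poisson-type kernels *)


Lemma powR_lt1 (R : realType) (x g : R) : 0 <= x < 1 -> 0 < g -> x `^ g < 1.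
Proof.
move=> /andP[x0 x1] g0; have := @gt0_ltr_powR R g g0 x 1.
by rewrite powR1; apply; rewrite ?nnegrE.
Qed.

Lemma powR_ge1 (R : realType) (x g : R) : 1 <= x -> 0 <= g -> 1 <= x `^ g.
Proof. by move=> x1 g0; rewrite -(powRr0 x) ler_powR. Qed.

Lemma le_powRl (R : realType) (x y g : R) : 0 <= g -> 0 <= x -> x <= y ->
  x `^ g <= y `^ g.
Proof.
move=> g0 x0 xy; apply: ge0_ler_powR; rewrite ?nnegrE//; exact: le_trans xy.
Qed.

Lemma powR_expr (R : realType) (x g : R) (m : nat) : 0 <= x ->
  (x `^ g) ^+ m = (x ^+ m) `^ g.
Proof.
move=> x0; elim: m => [|m ih]; first by rewrite !expr0 powR1.
by rewrite !exprS ih powRM// exprn_ge0.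
Qed.

Lemma dyadic_bracket_nat (R : realType) (y : R) : 1 <= y ->
  exists m : nat, 2 ^+ m <= y < 2 ^+ m.+1.
Proof.
move=> y1; have [k /andP[ky yk]] := dyadic_bracket (lt_le_trans ltr01 y1).
case: k ky yk => m my ym.
  exists m; have -> : 2 ^+ m.+1 = 2 ^ (m%:Z + 1) :> R by rewrite expfzDr// expr1z -exprnP exprSr.
  by rewrite exprnP my.
exfalso; move: ym; rewrite ltNge => /negP; apply; apply: le_trans y1.
rewrite NegzE intS opprD addrAC addNr add0r -exprnN invf_le1 ?exprn_gt0//.
by rewrite -natrX ler1n expn_gt0.
Qed.

Lemma measurable_fun_inv dY (Y : measurableType dY) (R : realType) (h : Y -> R) :
  measurable_fun setT h -> measurable_fun setT (fun y => (h y)^-1).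
Proof.
move=> mh; rewrite (_ : (fun y => _) = (fun y => h y * (h y ^+ 2) `^ (-1))).
  apply: measurable_funM => //; apply: (measurableT_comp (measurable_powR (-1))).
  exact: measurable_funX.
apply/funext => y; rewrite powR_inv1 ?sqr_ge0//.
have [->|h0] := eqVneq (h y) 0; first by rewrite invr0 mul0r.
by rewrite expr2 invfM mulrA mulfV// mul1r.
Qed.

(** Every ball about x lies in a family member that also contains x and has comparable radius. By
    doubling, averages over arbitrary balls are then dominated by [maxfun] of the family. *)
Record covering_family (R : realType) dsp (X : measurableType dsp)
    (d : X -> X -> R) (c : nat -> X) (r : nat -> R) : Prop := CoveringFamily {
  cf_gt0 : forall i, 0 < r i;
  cf_ball : forall (x : X) (s : R), 0 < s -> exists i,
    [/\ dball d (c i) (r i) x, dball d x s `<=` dball d (c i) (r i) & r i <= 8 * s] }.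

(** Equivalent to [decay] up to constants, by [decay_le_kern] and [kern_le_decay]. A single volume
    at the radius t + d x y lets one application of doubling compare two kernels. *)
HB.lock Definition kern (R : realType) dsp (X : measurableType dsp) (d : X -> X -> R)
    (mu : {measure set X -> \bar R}) (g : R) (x : X) (t : R) (y : X) : R :=
  (t / (t + d x y)) `^ g / Vol d mu x (t + d x y).

Section kernel.
Context (R : realType) dsp (X : measurableType dsp) (d : X -> X -> R)
  (mu : {sigma_finite_measure set X -> \bar R}) (D n : R).
Hypothesis DS : doubling_space d mu D n.
Local Notation V := (Vol d mu).
Local Notation K := (kern d mu).

Lemma le_Vol_ratio (x y : X) (r s L : R) : 0 < s -> 1 <= L ->
  d x y + r <= L * s -> V x r <= D * L `^ n * V y s.
Proof.
move=> s0 L1 h; apply: le_trans (ds_doubling DS _ s0 L1).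
by apply: (le_Vol DS) => //; rewrite mulr_gt0//; exact: lt_le_trans L1.
Qed.

Lemma measurable_dist2 dY (Y : measurableType dY) (f f' : Y -> X) :
  measurable_fun setT f -> measurable_fun setT f' ->
  measurable_fun setT (fun y => d (f y) (f' y)).
Proof.
move=> mf mf'.
have mp : measurable_fun setT (fun y => (f y, f' y)) by apply/measurable_fun_pairP.
exact: (measurableT_comp (measurable_dist DS) mp).
Qed.

(** The volume is the measure of a section of the measurable set of pairs (y, z) with d (f y) z < h
    y, hence measurable in y by sigma-finiteness. *)
Lemma measurable_Vol dY (Y : measurableType dY) (f : Y -> X) (h : Y -> R) :
  measurable_fun setT f -> measurable_fun setT h ->
  measurable_fun setT (fun y => V (f y) (h y)).
Proof.
move=> mf mh; rewrite /Vol.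
pose A : set (Y * X) := [set p | d (f p.1) p.2 < h p.1].
have mA : measurable A.
  rewrite /A -[X in measurable X]setTI; apply: (measurable_fun_ltr _ _ measurableT (Y := [set true])) => //.
  - by apply: measurable_dist2 => //; exact: (measurableT_comp mf measurable_fst).
  - exact: (measurableT_comp mh measurable_fst).
rewrite (_ : (fun y => _) = fine \o (mu \o xsection A)).
  by apply: measurableT_comp => //; exact: measurable_fun_xsection.
apply/funext => y /=; congr (fine (mu _)); apply/seteqP; split => z /=.
  by rewrite xsectionE.
by rewrite xsectionE.
Qed.

Lemma measurable_kern dY (Y : measurableType dY) (f f' : Y -> X) (t : Y -> R) g :
  measurable_fun setT f -> measurable_fun setT f' -> measurable_fun setT t ->
  measurable_fun setT (fun y => K g (f y) (t y) (f' y)).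
Proof.
move=> mf mf' mt; under eq_fun do rewrite kern.unlock.
have md : measurable_fun setT (fun y => d (f y) (f' y)).
  exact: measurable_dist2.
have ms : measurable_fun setT (fun y => t y + d (f y) (f' y)) by exact: measurable_funD.
apply: measurable_funM; last by apply: measurable_fun_inv; exact: measurable_Vol.
apply: (measurableT_comp (measurable_powR g)); apply: measurable_funM => //.
exact: measurable_fun_inv.
Qed.

Lemma kern_ge0 (g : R) (x : X) (t : R) (y : X) : 0 <= K g x t y.
Proof. by rewrite kern.unlock mulr_ge0 ?powR_ge0// invr_ge0 (Vol_ge0 d mu). Qed.

Lemma kern_ratio (x : X) (t : R) (y : X) : 0 < t -> 0 < t / (t + d x y) <= 1.
Proof.
move=> t0; have := dm_ge0 DS x y => dd.
have t1 : 0 < t + d x y by rewrite ltr_wpDr.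
by rewrite divr_gt0//= ler_pdivrMr// mul1r lerDl.
Qed.

Lemma kern_exponent (g : R) (g' : R) (x : X) (t : R) (y : X) : 0 < t -> g <= g' -> K g' x t y <= K g x t y.
Proof.
move=> t0 gg; rewrite !kern.unlock; apply: ler_wpM2r; first by rewrite invr_ge0 (Vol_ge0 d mu).
by apply: ger_powR => //; exact: kern_ratio.
Qed.

Lemma kern_le_Vol (g : R) (x : X) (t : R) (y : X) : 0 < t -> 0 <= g -> K g x t y <= (V x t)^-1.
Proof.
move=> t0 g0; have := dm_ge0 DS x y => dd; rewrite kern.unlock -[leRHS]mul1r.
have /andP[h1 h2] := kern_ratio x y t0.
apply: ler_pM; rewrite ?powR_ge0 ?invr_ge0 ?(Vol_ge0 d mu)//.
  by have := le_powRl g0 (ltW h1) h2; rewrite powR1.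
rewrite lef_pV2 ?posrE ?(Vol_gt0 DS) ?ltr_wpDr//.
by apply: (le_Vol DS); rewrite ?(dm_refl DS) ?ltr_wpDr//; lra.
Qed.

(** The comparison principle behind most later kernel estimates: only two scalar inequalities have
    to be checked, one between the decay ratios (constant A) and one saying that the second ball
    lies in an L-fold enlargement of the first. *)
Lemma kern_comparison (g : R) (x x' y y' : X) (t t' A L : R) :
  0 <= g -> 0 < t -> 0 < t' -> 1 <= L -> 0 <= A ->
  t / (t + d x y) <= A * (t' / (t' + d x' y')) ->
  d x' x + (t' + d x' y') <= L * (t + d x y) ->
  K g x t y <= A `^ g * (D * L `^ n) * K g x' t' y'.
Proof.
move=> g0 t0 t'0 L1 A0 h1 h2.
have s0 : 0 < t + d x y by rewrite ltr_wpDr// (dm_ge0 DS).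
have s'0 : 0 < t' + d x' y' by rewrite ltr_wpDr// (dm_ge0 DS).
have hV := le_Vol_ratio s0 L1 h2.
have /andP[q0 _] := kern_ratio x y t0.
have /andP[q'0 _] := kern_ratio x' y' t'0.
rewrite !kern.unlock mulrACA; apply: ler_pM; rewrite ?powR_ge0 ?invr_ge0 ?(Vol_ge0 d mu)//.
  by rewrite -powRM ?(ltW q'0)//; apply: le_powRl => //; exact: ltW.
rewrite ler_pdivlMr ?(Vol_gt0 DS)// mulrC ler_pdivrMr ?(Vol_gt0 DS)//.
Qed.

Lemma kern_sym (g : R) (x : X) (t : R) (y : X) : 0 <= g -> 0 < t ->
  K g x t y <= D * 2 `^ n * K g y t x.
Proof.
move=> g0 t0; have := @kern_comparison g x y y x t t 1 2 g0 t0 t0.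
rewrite powR1 !mul1r; apply => //.
- by rewrite ler1n.
- by rewrite (dm_sym DS y x).
- by rewrite (dm_sym DS y x); lra.
Qed.

Lemma kern_move (g : R) (z : X) (z' : X) (t : R) (y : X) : 0 <= g -> 0 < t -> d z z' <= t / 2 ->
  K g z t y <= 2 `^ g * (D * 2 `^ n) * K g z' t y.
Proof.
move=> g0 t0 h; have zy := dm_ge0 DS z y; have z'y := dm_ge0 DS z' y.
have T1 := dm_triangle DS z z' y; have T2 := dm_triangle DS z' z y.
move: T1 T2; rewrite (dm_sym DS z' z) => T1 T2.
apply: kern_comparison => //; rewrite ?ler1n//; last first.
  by rewrite (dm_sym DS z' z); lra.
rewrite mulrA ler_pdivrMr ?ltr_wpDr// mulrAC ler_pdivlMr ?ltr_wpDr//.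
rewrite -mulrA [leRHS]mulrCA -[in leLHS](mul1r t) -subr_ge0.
rewrite (_ : _ - _ = t * (2 * (t + d z y) - (t + d z' y))); last by ring.
by rewrite mulr_ge0 ?(ltW t0)//; lra.
Qed.

Lemma kern_scale (g : R) (x : X) (r : R) (r' : R) (y : X) (L : R) : 0 <= g -> 0 < r' -> r' <= r -> r <= L * r' ->
  K g x r y <= L `^ g * K g x r' y.
Proof.
move=> g0 r'0 rr rL; have xy := dm_ge0 DS x y.
have r0 : 0 < r by exact: lt_le_trans rr.
have L0 : 0 <= L.
  have := lt_le_trans r0 rL; rewrite pmulr_lgt0//; exact: ltW.
have /andP[q0 _] := kern_ratio x y r0.
have /andP[q'0 _] := kern_ratio x y r'0.
rewrite !kern.unlock mulrA; apply: ler_pM; rewrite ?powR_ge0 ?invr_ge0 ?(Vol_ge0 d mu)//.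
  rewrite -powRM ?(ltW q'0)//; apply: le_powRl => //; first exact: ltW.
  rewrite ler_pdivrMr ?ltr_wpDr// mulrAC mulrA ler_pdivlMr ?ltr_wpDr//.
  rewrite -subr_ge0.
  rewrite (_ : _ - _ = (L * r' - r) * d x y + r' * (L * r - r)); last by ring.
  rewrite addr_ge0// ?mulr_ge0// ?(ltW r'0)//; first by lra.
  have L1 : 1 <= L by rewrite -(ler_pM2r r'0) mul1r (le_trans rr).
  by rewrite -{2}(mul1r r) -mulrBl mulr_ge0 ?subr_ge0// ltW.
rewrite lef_pV2 ?posrE ?(Vol_gt0 DS) ?ltr_wpDr//.
by apply: (le_Vol DS); rewrite ?(dm_refl DS) ?ltr_wpDr//; lra.
Qed.

Lemma decay_le_kern (g : R) (x : X) (t : R) (y : X) : 0 < t -> decay d mu x t g y <= D * 2 `^ n * K g x t y.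
Proof.
move=> t0; have xy := dm_ge0 DS x y; rewrite /decay /Vxy kern.unlock.
rewrite mulrC mulrCA; apply: ler_wpM2l; first exact: powR_ge0.
have Vt := Vol_gt0 DS x t0.
have Vp : 0 < V x t + V x (d x y) by rewrite ltr_wpDr// (Vol_ge0 d mu).
rewrite ler_pdivlMr ?(Vol_gt0 DS) ?ltr_wpDr// mulrC ler_pdivrMr//.
have [h|h] := leP (d x y) t.
  apply: (@le_trans _ _ (D * 2 `^ n * V x t)).
    by apply: le_Vol_ratio => //; rewrite ?ler1n// (dm_refl DS); lra.
  apply: ler_wpM2l; first by rewrite mulr_ge0 ?powR_ge0// ltW// (doubling_D0 DS).
  by rewrite lerDl (Vol_ge0 d mu).
apply: (@le_trans _ _ (D * 2 `^ n * V x (d x y))).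
  apply: le_Vol_ratio => //; rewrite ?ler1n//; first by lra.
  by rewrite (dm_refl DS); lra.
apply: ler_wpM2l; first by rewrite mulr_ge0 ?powR_ge0// ltW// (doubling_D0 DS).
by rewrite lerDr ltW.
Qed.

Lemma kern_le_decay (g : R) (x : X) (t : R) (y : X) : 0 < t -> K g x t y <= 2 * decay d mu x t g y.
Proof.
move=> t0; have xy := dm_ge0 DS x y; rewrite /decay /Vxy kern.unlock mulrA mulrC.
apply: ler_wpM2r; first exact: powR_ge0.
have Vt := Vol_gt0 DS x t0.
have Vp : 0 < V x t + V x (d x y) by rewrite ltr_wpDr// (Vol_ge0 d mu).
rewrite -[leLHS]mul1r ler_pdivrMr ?(Vol_gt0 DS) ?ltr_wpDr// mulrAC ler_pdivlMr// mul1r.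
rewrite mulr_natl mulr2n; apply: lerD; apply: (le_Vol DS); rewrite ?(dm_refl DS) ?ltr_wpDr//; lra.
Qed.

(** * Kernel integrals and convolutions, estimated through the maximal operator *)

Section covering_family.
Variables (c : nat -> X) (r : nat -> R).
Hypothesis cov : covering_family d c r.

Let r0 := cf_gt0 cov.
Let covering := cf_ball cov.
Local Notation M := (maxfun d mu c r).

Lemma ball_integral_le_maxfun (G : X -> \bar R) (x : X) (s : R) : measurable_fun setT G ->
  (forall z, 0 <= G z)%E -> 0 < s ->
  (\int[mu]_(z in dball d x s) G z <= (D * 16 `^ n * V x s)%:E * M G x)%E.
Proof.
move=> mG G0 s0; have [i [xi sub ri]] := covering x s0.
have Vi := Vol_gt0 DS (c i) (r0 i).
apply: (@le_trans _ _ ((V (c i) (r i))%:E * bavg d mu c r G i)%E).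
  rewrite /bavg muleA -EFinM mulfV ?gt_eqF// mul1e.
  by apply: ge0_subset_integral => //;
    [exact: (measurable_dball DS)|exact: (measurable_dball DS)|exact: measurable_funTS].
apply: (@le_trans _ _ ((V (c i) (r i))%:E * M G x)%E).
  by apply: lee_wpmul2l; [rewrite lee_fin ltW|exact: bavg_le_maxfun].
apply: lee_wpmul2r; first by apply: (maxfun_ge0 DS).
(* The constant 16 is 2 * 8: the family ball contains x and has radius at most 8 s. *)
rewrite lee_fin; apply: le_Vol_ratio => //; first by rewrite ler1n.
by move: xi; rewrite /dball/=; lra.
Qed.

(** On the dyadic shell where t + d x z is about 2^m t the kernel is at most 2^(- m g) over the
    volume of the ball of radius 2^m t; each shell costs one average of G, and the factors 2^(- m g)
    sum to a constant. *)
Lemma kern_maxfun (g : R) : 0 < g -> exists C : R, 0 < C /\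
  forall (G : X -> \bar R) (x : X) (t : R), measurable_fun setT G -> (forall z, 0 <= G z)%E ->
  0 < t -> (\int[mu]_z ((K g x t z)%:E * G z) <= C%:E * M G x)%E.
Proof.
move=> g0; pose q : R := 2^-1 `^ g.
have q1 : q < 1 by apply: powR_lt1; rewrite // invr_ge0 ler0n invf_lt1// ltr1n.
have q0 : 0 < q by rewrite powR_gt0.
have D0 := doubling_D0 DS.
pose E := D * 16 `^ n * (D * 2 `^ n).
have E0 : 0 < E by rewrite mulr_gt0// mulr_gt0 ?powR_gt0.
exists (E / (1 - q)); split; first by rewrite divr_gt0 ?subr_gt0.
move=> G x t mG G0 t0.
have t2 (m : nat) : 0 < 2 ^+ m * t by rewrite mulr_gt0 ?exprn_gt0.
pose F (m : nat) z := ((q ^+ m / V x (2 ^+ m * t))%:E *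
  ((\1_(dball d x (2 ^+ m.+1 * t)) z)%:E * G z))%E.
have m1 (m : nat) : measurable_fun setT (fun z => (\1_(dball d x (2 ^+ m.+1 * t)) z)%:E * G z)%E.
  apply: emeasurable_funM => //; apply/measurable_EFinP; apply: measurable_indic.
  exact: (measurable_dball DS).
have i0 (m : nat) z : (0 <= (\1_(dball d x (2 ^+ m.+1 * t)) z)%:E * G z)%E.
  by rewrite mule_ge0// lee_fin.
have a0 (m : nat) : 0 <= q ^+ m / V x (2 ^+ m * t).
  by rewrite divr_ge0 ?(Vol_ge0 d mu)// exprn_ge0// ltW.
have F0 m z : (0 <= F m z)%E by rewrite mule_ge0// lee_fin.
have mF m : measurable_fun setT (F m) by exact: measurable_funeM.
have h z : ((K g x t z)%:E * G z <= \sum_(m <oo) F m z)%E.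
  have xz := dm_ge0 DS x z.
  have s0 : 0 < t + d x z by rewrite ltr_wpDr.
  have [m] := @dyadic_bracket_nat R ((t + d x z) / t) ltac:(by rewrite ler_pdivlMr// mul1r lerDl).
  rewrite ler_pdivlMr// ltr_pdivrMr// => /andP[mz zm].
  apply: le_trans (le_nneseries_term m (F0^~ z)).
  rewrite /F indicE mem_set; last by rewrite /dball/=; lra.
  rewrite mul1e; apply: lee_wpmul2r => //; rewrite lee_fin kern.unlock.
  apply: ler_pM; rewrite ?powR_ge0 ?invr_ge0 ?(Vol_ge0 d mu)//.
    rewrite /q powR_expr ?invr_ge0//.
    apply: le_powRl; rewrite ?(ltW g0)//; first by rewrite divr_ge0 ?(ltW s0) ?(ltW t0).
    by rewrite exprVn ler_pdivrMr// mulrC ler_pdivlMr ?exprn_gt0// mulrC.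
  rewrite lef_pV2 ?posrE ?(Vol_gt0 DS)//.
  by apply: (le_Vol DS) => //; rewrite (dm_refl DS) add0r.
apply: (@le_trans _ _ (\int[mu]_z \sum_(m <oo) F m z)%E).
  by apply: le_lower_integral => // z; rewrite mule_ge0// lee_fin kern_ge0.
rewrite integral_nneseries//.
have hm m : (\int[mu]_z F m z <= (E * q ^+ m)%:E * M G x)%E.
  rewrite /F ge0_integralZl_EFin//.
  have -> : (\int[mu]_z ((\1_(dball d x (2 ^+ m.+1 * t)) z)%:E * G z) =
      \int[mu]_(z in dball d x (2 ^+ m.+1 * t)) G z)%E.
    rewrite [RHS]integral_mkcond; apply: eq_integral => z _.
    rewrite /patch indicE; case: ifPn => _; by rewrite ?mul1e ?mul0e.
  apply: (@le_trans _ _ ((q ^+ m / V x (2 ^+ m * t))%:E *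
      ((D * 16 `^ n * V x (2 ^+ m.+1 * t))%:E * M G x))%E).
    by apply: lee_wpmul2l; [rewrite lee_fin|exact: ball_integral_le_maxfun].
  rewrite muleA -EFinM; apply: lee_wpmul2r; first by apply: (maxfun_ge0 DS).
  rewrite lee_fin /E mulrAC ler_pdivrMr ?(Vol_gt0 DS)//.
  have := @le_Vol_ratio x x (2 ^+ m.+1 * t) (2 ^+ m * t) 2 (t2 m) ltac:(by rewrite ler1n)
    ltac:(by rewrite (dm_refl DS) add0r exprS mulrA).
  move=> h2; rewrite -!mulrA [leLHS](_ : _ = q ^+ m * (D * 16 `^ n * V x (2 ^+ m.+1 * t))); last by ring.
  rewrite [leRHS](_ : _ = q ^+ m * (D * 16 `^ n * (D * 2 `^ n * V x (2 ^+ m * t)))); last by ring.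
  apply: ler_wpM2l; first by rewrite exprn_ge0// ltW.
  by apply: ler_wpM2l => //; rewrite mulr_ge0 ?powR_ge0// ltW.
apply: le_trans (lee_nneseries _ (fun m _ => hm m)) _.
  by move=> m _ _; exact: integral_ge0.
have : (0 <= M G x)%E by by apply: (maxfun_ge0 DS).
case: (M G x) => [y| |]// y0; last first.
  by rewrite gt0_muley ?leey// lte_fin divr_gt0// subr_gt0.
have -> : (\sum_(m <oo) ((E * q ^+ m)%:E * y%:E) = \sum_(m <oo) (E * y * q ^+ m)%:E)%E.
  by apply: eq_eseriesr => m _; rewrite -EFinM mulrAC.
rewrite -EFinM (_ : E / (1 - q) * y = E * y / (1 - q)); last by rewrite mulrAC.
apply: nneseries_geometric_le; last by rewrite q0.
by rewrite mulr_ge0// ?(ltW E0)// -lee_fin.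
Qed.

Lemma kern_integral (g : R) : 0 < g -> exists C : R, 0 < C /\ forall (x : X) (t : R), 0 < t ->
  (\int[mu]_z (K g x t z)%:E <= C%:E)%E.
Proof.
move=> g0; have [C [C0 HC]] := kern_maxfun g0; exists C; split => // x t t0.
have := HC (fun=> 1%R%:E) x t (measurable_cst _) (fun=> lee01) t0.
under eq_integral do rewrite mule1; move=> /le_trans; apply.
rewrite -[leRHS]mule1; apply: lee_wpmul2l; first by rewrite lee_fin ltW.
apply: ge_ereal_sup => _ [i _ <-].
have -> : bavg d mu c r (fun=> 1%:E) i = 1%E.
  rewrite /bavg integral_cst; last exact: (measurable_dball DS).
  by rewrite mul1e (measure_dball DS)// -EFinM mulVf// gt_eqF// (Vol_gt0 DS).
by rewrite mul1e lee_fin indicE; case: (_ \in _).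
Qed.

Lemma kern_integralC (g : R) : 0 < g -> exists C : R, 0 < C /\ forall (y : X) (t : R), 0 < t ->
  (\int[mu]_z (K g z t y)%:E <= C%:E)%E.
Proof.
move=> g0; have [C [C0 HC]] := kern_integral g0.
have c0 : 0 < D * 2 `^ n by rewrite mulr_gt0 ?powR_gt0// (doubling_D0 DS).
exists (D * 2 `^ n * C); split; first by rewrite mulr_gt0.
move=> y t t0; apply: (@le_trans _ _ ((D * 2 `^ n)%:E * \int[mu]_z (K g y t z)%:E)%E).
  apply: lower_integral_leZ => // z; rewrite ?lee_fin ?kern_ge0//.
  by apply: kern_sym => //; exact: ltW.
by rewrite [leRHS]EFinM; apply: lee_wpmul2l; [rewrite lee_fin ltW|exact: HC].
Qed.

Lemma kern_conv (g : R) : 0 < g -> exists C : R, 0 < C /\ forall (x y : X) (t s : R), 0 < t -> t <= s ->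
  (\int[mu]_z (K g z t y * K g x s z)%:E <= (C * K g x s y)%:E)%E.
Proof.
move=> g0; have [C1 [C10 HC1]] := kern_integral g0; have [C2 [C20 HC2]] := kern_integralC g0.
have D0 := doubling_D0 DS.
pose L := 2 `^ g * (D * 8 `^ n).
have L0 : 0 < L by rewrite !mulr_gt0 ?powR_gt0.
exists (L * (C1 + C2)); split; first by rewrite mulr_gt0// addr_gt0.
move=> x y t s t0 ts; have s0 : 0 < s by exact: lt_le_trans ts.
have ker z : K g z t y * K g x s z <= L * K g x s y * (K g z t y + K g x s z).
  have T := dm_triangle DS z x y; have zy := dm_ge0 DS z y; have xz := dm_ge0 DS x z.
  have T2 := dm_triangle DS x z y; have xy := dm_ge0 DS x y.
  have T3 := dm_triangle DS y x z.
  move: T2 T3; rewrite (dm_sym DS z x) (dm_sym DS y z) => T2 T3.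
  have k0 := kern_ge0 g x s y.
  (* Either z is close enough to y for [K g x s z] to be comparable with [K g x s y], or d z y is so
     large that [K g z t y] itself is below a multiple of it; the second case uses t <= s. The other
     factor is then integrated. *)
  have [h|h] := leP (2 * d z y) (s + d x y).
    have : K g x s z <= L * K g x s y.
      apply: kern_comparison => //; rewrite ?(ltW g0) ?ler1n//; last first.
        by rewrite (dm_refl DS); lra.
      rewrite mulrA ler_pdivrMr ?ltr_wpDr// mulrAC ler_pdivlMr ?ltr_wpDr//.
      rewrite -subr_ge0 (_ : _ - _ = s * (2 * (s + d x z) - (s + d x y))); last by ring.
      by rewrite mulr_ge0 ?(ltW s0)//; lra.
    move=> /(ler_wpM2l (kern_ge0 g z t y)) /le_trans; apply.
    rewrite mulrC mulrDr lerDl; apply: mulr_ge0 (kern_ge0 _ _ _ _).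
    by apply: mulr_ge0 (kern_ge0 _ _ _ _); exact: ltW.
  have : K g z t y <= L * K g x s y.
    apply: kern_comparison => //; rewrite ?(ltW g0) ?ler1n//; last first.
      by lra.
    rewrite mulrA ler_pdivrMr ?ltr_wpDr// mulrAC ler_pdivlMr ?ltr_wpDr//.
    apply: (@le_trans _ _ (t * (2 * d z y))); first by apply: ler_wpM2l; lra.
    apply: (@le_trans _ _ (s * (2 * d z y))); first by apply: ler_wpM2r; lra.
    rewrite -subr_ge0 (_ : _ - _ = 2 * s * t); last by ring.
    by rewrite !mulr_ge0// ltW.
  move=> /(ler_wpM2r (kern_ge0 g x s z)) /le_trans; apply.
  rewrite mulrDr lerDr; apply: mulr_ge0 (kern_ge0 _ _ _ _).
  by apply: mulr_ge0 (kern_ge0 _ _ _ _); exact: ltW.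
have mk1 : measurable_fun setT (fun z => K g z t y) by exact: measurable_kern.
have mk2 : measurable_fun setT (fun z => K g x s z) by exact: measurable_kern.
have K0 : 0 <= L * K g x s y by rewrite mulr_ge0 ?kern_ge0// ltW.
apply: (@le_trans _ _ ((L * K g x s y)%:E *
    (\int[mu]_z (K g z t y)%:E + \int[mu]_z (K g x s z)%:E))%E).
  rewrite -ge0_integralD//; first last.
  - exact/measurable_EFinP.
  - by move=> z _; rewrite lee_fin kern_ge0.
  - exact/measurable_EFinP.
  - by move=> z _; rewrite lee_fin kern_ge0.
  rewrite -ge0_integralZl_EFin//; first last.
  - by apply: emeasurable_funD; exact/measurable_EFinP.
  - by move=> z _; rewrite -EFinD lee_fin addr_ge0 ?kern_ge0.
  apply: le_lower_integral => z; first by rewrite lee_fin mulr_ge0 ?kern_ge0.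
  by rewrite -EFinD -EFinM lee_fin.
rewrite (_ : L * _ * _ = L * K g x s y * (C1 + C2)); last by ring.
rewrite [leRHS]EFinM; apply: lee_wpmul2l; first by rewrite lee_fin.
by rewrite EFinD addeC leeD ?HC1 ?HC2.
Qed.

End covering_family.
End kernel.

(** * Admissible functions *)


Lemma dyadic_covering_family (R : realType) dsp (X : measurableType dsp)
    (d : X -> X -> R) (mu : {measure set X -> \bar R}) (D n : R) (x0 : X) :
  doubling_space d mu D n -> exists c r, covering_family d c r.
Proof.
move=> DS; have [y Hy] := separable DS x0.
exists (fun i => if unpickle i is Some (a, k) then let _ : nat * int := (a, k) in y a else x0).
exists (fun i => if unpickle i is Some (a, k) then let _ : nat * int := (a, k) in 2 ^ k else 1).
split; first by move=> i; case: unpickle => [[a k]|//]; rewrite exprz_gt0.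
(* This gives 2 s < 2^k <= 4 s: with the centre within s of x, the radius 2^k suffices to contain
   the ball of radius s about x. *)
move=> x s s0; have [k /andP[k1 k2]] := @dyadic_bracket R (4 * s) ltac:(by rewrite mulr_gt0).
have k3 : 2 ^ (k + 1) = 2 ^ k * 2 :> R by rewrite expfzDr// expr1z.
have [a xa] := Hy x s s0.
exists (pickle (a, k)); rewrite pickleK /=; split; last by lra.
  by rewrite /dball/= (dm_sym DS); lra.
move=> z; rewrite /dball/= => xz; have := dm_triangle DS x (y a) z.
by rewrite (dm_sym DS (y a) x); lra.
Qed.

(** Here [a] stands for 1 / (1 + k0), so that 1 - a is k0 / (1 + k0). *)
Record admissible_weight (R : realType) (X : Type) (d : X -> X -> R)
    (rho : X -> R) (C3 a : R) : Prop := AdmissibleWeight {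
  aw_gt0 : forall x, 0 < rho x;
  aw_const : 0 < C3;
  aw_exponent : 0 < a < 1;
  aw_bound : forall x y, rho y <= C3 * rho x `^ a * (rho x + d x y) `^ (1 - a) }.

Section admissible_function.
Context (R : realType) dsp (X : measurableType dsp) (d : X -> X -> R)
  (mu : {sigma_finite_measure set X -> \bar R}) (D n : R).
Hypothesis DS : doubling_space d mu D n.
Local Notation V := (Vol d mu).
Local Notation K := (kern d mu).
Variables (rho : X -> R) (C3 a : R).
Hypothesis RA : admissible_weight d rho C3 a.

Let rho0 := aw_gt0 RA.
Let C30 := aw_const RA.
Let a01 := aw_exponent RA.
Let adm := aw_bound RA.

Let a0 : 0 < a. Proof. by case/andP: a01. Qed.
Let a1 : 0 < 1 - a. Proof. by case/andP: a01 => _; rewrite subr_gt0. Qed.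

Let powRa (t : R) : 0 < t -> t `^ a * t `^ (1 - a) = t.
Proof.
move=> t0; have e : a + (1 - a) = 1 by rewrite addrC subrK.
rewrite -powRD; first by rewrite e powRr1 ?ltW.
by rewrite (gt_eqF t0) implybT.
Qed.

Lemma admissible_ge1 (x : X) : 1 <= C3.
Proof.
have := adm x x; rewrite (dm_refl DS) addr0 -mulrA powRa// -{1}(mul1r (rho x)).
by rewrite ler_pM2r.
Qed.

Lemma admissible_max (x y : X) (r : R) : d x y <= r -> 0 < r ->
  rho y <= 2 * C3 * Num.max (rho x) r.
Proof.
move=> dr r0; have x0 := rho0 x.
have m0 : 0 < Num.max (rho x) r by rewrite lt_max x0.
apply: le_trans (adm x y) _; rewrite -(powRa m0).
rewrite [leRHS](_ : _ = C3 * (Num.max (rho x) r `^ a * (2 * Num.max (rho x) r `^ (1 - a)))); last by ring.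
rewrite -[leLHS]mulrA; apply: ler_wpM2l; first exact: ltW.
have h1 : rho x `^ a <= Num.max (rho x) r `^ a.
  by apply: le_powRl; [exact: ltW|exact: ltW|rewrite le_max lexx].
have h2 : (rho x + d x y) `^ (1 - a) <= 2 * Num.max (rho x) r `^ (1 - a).
  apply: (@le_trans _ _ ((2 * Num.max (rho x) r) `^ (1 - a))).
    apply: le_powRl; [exact: ltW|by rewrite addr_ge0 ?(dm_ge0 DS) ?(ltW (rho0 _))|].
    rewrite mulr_natl mulr2n; apply: lerD; first by rewrite le_max lexx.
    by apply: le_trans dr _; rewrite le_max lexx orbT.
  rewrite powRM ?(ltW m0)//; apply: ler_wpM2r; first exact: powR_ge0.
  by apply: ler1_powR; rewrite ?ler1n// lerBlDr lerDl ltW.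
by apply: ler_pM; rewrite ?powR_ge0.
Qed.

(** It measures, multiplicatively, how far the scale r is from the critical scale rho x; positive
    powers of it are the gain of the error terms away from that scale. *)
Definition scale_ratio (x : X) (r : R) : R := Num.min (r / rho x) (rho x / r).

Lemma scale_ratio_gt0 x r : 0 < r -> 0 < scale_ratio x r.
Proof. by move=> r0; rewrite lt_min !divr_gt0. Qed.

Lemma scale_ratio_le1 x r : 0 < r -> scale_ratio x r <= 1.
Proof.
move=> r0; rewrite ge_min; have [h|h] := leP r (rho x).
  by rewrite ler_pdivrMr// mul1r h.
by apply/orP; right; rewrite ler_pdivrMr// mul1r ltW.
Qed.

(** Against r / rho y the bound is linear, by [admissible_max], and is weakened to the power [a]
    because the ratio is at most 1. Against rho y / r the power is genuine: admissibility only gives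
    rho x <= C rho y^a r^(1 - a). *)
Lemma scale_ratio_swap (x y : X) (r : R) : d x y <= r -> 0 < r ->
  scale_ratio x r <= (1 + 2 * C3) * scale_ratio y r `^ a.
Proof.
move=> dr r0; have x0 := rho0 x; have y0 := rho0 y.
have mx0 := scale_ratio_gt0 x r0; have mx1 := scale_ratio_le1 x r0.
have C2 : 0 <= 2 * C3 by rewrite mulr_ge0// ltW.
have C12 : 1 <= 1 + 2 * C3 by rewrite lerDl.
suff [h1 h2] : scale_ratio x r <= (1 + 2 * C3) * (r / rho y) `^ a /\
    scale_ratio x r <= (1 + 2 * C3) * (rho y / r) `^ a.
  by rewrite {2}/scale_ratio; have [_|_] := leP (r / rho y) (rho y / r).
split.
  have mr : scale_ratio x r <= 2 * C3 * (r / rho y).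
    have := admissible_max dr r0; rewrite /scale_ratio mulrA => h.
    rewrite ler_pdivlMr//; apply: le_trans (ler_wpM2l (ltW mx0) h) _.
    rewrite /scale_ratio; have [h'|h'] := leP r (rho x).
      apply: (@le_trans _ _ (r / rho x * (2 * C3 * rho x))).
        by apply: ler_wpM2r; [rewrite mulr_ge0// ltW|rewrite ge_min lexx].
      by rewrite mulrCA divfK ?gt_eqF.
    rewrite -[leRHS]mul1r; apply: ler_wpM2r; first by rewrite mulr_ge0// ltW.
    exact: mx1.
  have u0 : 0 <= r / rho y by rewrite divr_ge0 ?ltW.
  apply: (@le_trans _ _ (scale_ratio x r `^ a)).
    by apply: ger1_powR; [rewrite mx0 mx1|case/andP: a01 => _ /ltW].
  apply: (@le_trans _ _ ((2 * C3 * (r / rho y)) `^ a)); first by apply: le_powRl => //; exact: ltW.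
  rewrite powRM//; apply: ler_wpM2r; first exact: powR_ge0.
  apply: (@le_trans _ _ ((1 + 2 * C3) `^ a)); first by apply: le_powRl => //; [exact: ltW|rewrite lerDr].
  by apply: ler1_powR => //; case/andP: a01 => _ /ltW.
have [h|h] := leP r (rho y).
  apply: le_trans mx1 _; rewrite -[leLHS]mulr1; apply: ler_pM => //.
  by apply: powR_ge1; [rewrite ler_pdivlMr ?mul1r|exact: ltW].
apply: (@le_trans _ _ (rho x / r)); first by rewrite ge_min lexx orbT.
rewrite ler_pdivrMr//; apply: le_trans (adm y x) _.
have h2 : (rho y + d y x) `^ (1 - a) <= 2 * r `^ (1 - a).
  apply: (@le_trans _ _ ((2 * r) `^ (1 - a))).
    apply: le_powRl; [exact: ltW|by rewrite addr_ge0 ?(dm_ge0 DS) ?(ltW (rho0 _))|].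
    by rewrite (dm_sym DS y x); lra.
  rewrite powRM ?(ltW r0)//; apply: ler_wpM2r; first exact: powR_ge0.
  by apply: ler1_powR; rewrite ?ler1n// lerBlDr lerDl ltW.
apply: (@le_trans _ _ (C3 * rho y `^ a * (2 * r `^ (1 - a)))).
  by apply: ler_wpM2l => //; rewrite mulr_ge0 ?powR_ge0// ltW.
have e : (rho y / r) `^ a * r `^ a = rho y `^ a.
  by rewrite -powRM ?divr_ge0 ?(ltW r0) ?(ltW y0)// divfK ?gt_eqF.
rewrite -(mulrA _ _ r) -{3}(powRa r0) (mulrA (_ `^ _)) e.
rewrite [leLHS](_ : _ = 2 * C3 * (rho y `^ a * r `^ (1 - a))); last by ring.
by apply: ler_wpM2r; rewrite ?mulr_ge0 ?powR_ge0// lerDr.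
Qed.

(** Admissibility based at z bounds rho x by C rho z^a times ((1 + A) rho x)^(1 - a); dividing by
    rho x^(1 - a) and taking the power 1 / a gives the claim. *)
Lemma admissible_near (A : R) : 0 <= A -> exists c : R, 1 <= c /\
  forall x z, d x z <= A * rho x -> rho x <= c * rho z.
Proof.
move=> A0; have A1 : 1 <= 1 + A by rewrite lerDl.
have CA : 0 <= C3 * (1 + A) by rewrite mulr_ge0 ?(ltW C30)// (le_trans ler01).
exists (1 + (C3 * (1 + A)) `^ a^-1); split; first by rewrite lerDl powR_ge0.
move=> x z xz; have x0 := rho0 x; have z0 := rho0 z.
rewrite mulrDl mul1r; have [h|h] := leP (rho x) (rho z).
  by rewrite (le_trans h)// lerDl mulr_ge0 ?powR_ge0// ltW.
apply: (@le_trans _ _ ((C3 * (1 + A)) `^ a^-1 * rho z)); last by rewrite lerDr ltW.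
have h2 : (rho z + d z x) `^ (1 - a) <= (1 + A) * rho x `^ (1 - a).
  apply: (@le_trans _ _ (((1 + A) * rho x) `^ (1 - a))).
    apply: le_powRl; [exact: ltW|by rewrite addr_ge0 ?(dm_ge0 DS) ?(ltW (rho0 _))|].
    by rewrite (dm_sym DS z x) mulrDl mul1r lerD// ltW.
  rewrite powRM ?(ltW x0) ?(le_trans ler01 A1)//; apply: ler_wpM2r; first exact: powR_ge0.
  by apply: ler1_powR => //; rewrite lerBlDr lerDl ltW.
have h3 : rho x `^ a <= C3 * (1 + A) * rho z `^ a.
  rewrite -(ler_pM2r (powR_gt0 (1 - a) x0)) powRa//.
  apply: le_trans (adm z x) _.
  rewrite [leRHS](_ : _ = C3 * rho z `^ a * ((1 + A) * rho x `^ (1 - a))); last by ring.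
  by apply: ler_wpM2l => //; rewrite mulr_ge0 ?powR_ge0// ltW.
have := @le_powRl _ _ _ a^-1 _ _ h3; rewrite invr_ge0 (ltW a0) powR_ge0 => /(_ isT isT).
by rewrite powRM ?powR_ge0// -!powRrM mulfV ?gt_eqF// !powRr1 ?(ltW x0) ?(ltW z0).
Qed.

(* [rho] need not be measurable; this is an upper semicontinuous majorant, between
   [rho] and [C3 * rho]. *)
Definition rho_maj (x : X) : R :=
  inf [set C3 * rho y `^ a * (rho y + d y x) `^ (1 - a) | y in setT].

Let maj_lb (x : X) : lbound [set C3 * rho y `^ a * (rho y + d y x) `^ (1 - a) | y in setT] (rho x).
Proof. by move=> _ [y _ <-]; exact: adm. Qed.

Lemma rho_le_maj (x : X) : rho x <= rho_maj x.
Proof. by apply: lb_le_inf; [exists (C3 * rho x `^ a * (rho x + d x x) `^ (1 - a)), x|exact: maj_lb]. Qed.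

Lemma rho_maj_gt0 (x : X) : 0 < rho_maj x.
Proof. exact: lt_le_trans (rho_le_maj x). Qed.

Lemma rho_maj_le (x : X) : rho_maj x <= C3 * rho x.
Proof.
apply: ge_inf; first by exists (rho x); exact: maj_lb.
by exists x => //; rewrite (dm_refl DS) addr0 -mulrA powRa.
Qed.

Lemma measurable_rho_maj : measurable_fun setT rho_maj.
Proof.
move=> _; apply: (measurability _ (RGenInftyO.measurableE R)) => //.
move=> _ [_ [c ->] <-]; rewrite setTI; apply: (dopen_measurable DS) => x.
rewrite /= in_itv/= => /inf_lt[|_ [y _ <-] yc].
  by exists (C3 * rho x `^ a * (rho x + d x x) `^ (1 - a)), x.
pose F := C3 * rho y `^ a * (rho y + d y x) `^ (1 - a).
have y0 := rho0 y.
have F0 : 0 < F.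
  by rewrite /F !mulr_gt0 ?powR_gt0// ltr_wpDr// (dm_ge0 DS).
(* Moving x by less than h multiplies rho y + d y x by a factor below 1 + h / rho y = c / F, so the
   competitor y still gives a value below c. *)
pose h := rho y * ((c - F) / F).
have h0 : 0 < h by rewrite mulr_gt0// divr_gt0// subr_gt0.
exists h => // z; rewrite /dball/= => xz; rewrite /= in_itv/=.
apply: (@le_lt_trans _ _ (C3 * rho y `^ a * (rho y + d y z) `^ (1 - a))).
  by apply: ge_inf; [exists (rho z); exact: maj_lb|exists y].
have xy0 := dm_ge0 DS y x; have xz0 := dm_ge0 DS x z.
pose l := 1 + d x z / rho y.
have l1 : 1 <= l by rewrite /l lerDl divr_ge0// ltW.
have yz : rho y + d y z <= l * (rho y + d y x).
  have := dm_triangle DS x y z; rewrite /l mulrDl mul1r => T.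
  have : d x z <= d x z / rho y * (rho y + d y x).
    by rewrite mulrDr divfK ?gt_eqF// lerDl mulr_ge0// divr_ge0// ltW.
  by lra.
have hl : (rho y + d y z) `^ (1 - a) <= l * (rho y + d y x) `^ (1 - a).
  apply: (@le_trans _ _ ((l * (rho y + d y x)) `^ (1 - a))).
    by apply: le_powRl => //; [exact: ltW|rewrite addr_ge0 ?(dm_ge0 DS) ?(ltW (rho0 _))//].
  have s0 : 0 <= rho y + d y x by rewrite addr_ge0// ltW.
  rewrite (powRM _ (le_trans ler01 l1) s0).
  apply: ler_wpM2r; first exact: powR_ge0.
  by apply: ler1_powR => //; rewrite lerBlDr lerDl ltW.
apply: (@le_lt_trans _ _ (l * F)).
  rewrite /F mulrCA; apply: ler_wpM2l => //.
  by rewrite mulr_ge0 ?powR_ge0// ltW.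
rewrite /l mulrDl mul1r -ltrBrDl -ltr_pdivlMr// ltr_pdivrMr// mulrC.
exact: xz.
Qed.

(* The weight 2^(-|k| g) on the ball of radius 2^k rho(y) makes the integral in [x]
   bounded uniformly in [y]. *)
Definition wker (g : R) (x y : X) : \bar R :=
  zseries (fun k => ((2^-1 `^ g) ^+ `|k|%N *
    (\1_(dball d y (2 ^ k * rho_maj y)) x / V y (2 ^ k * rho_maj y)))%:E).

Let wterm_ge0 (g : R) (x y : X) (k : int) : 0 <= (2^-1 `^ g) ^+ `|k|%N *
    (\1_(dball d y (2 ^ k * rho_maj y)) x / V y (2 ^ k * rho_maj y)) :> R.
Proof.
by rewrite mulr_ge0 ?exprn_ge0 ?powR_ge0// divr_ge0// (Vol_ge0 d mu).
Qed.

Lemma wker_ge0 (g : R) (x y : X) : (0 <= wker g x y)%E.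
Proof. by apply: zseries_ge0 => k; rewrite lee_fin wterm_ge0. Qed.

Let t0 (y : X) (k : int) : 0 < 2 ^ k * rho_maj y.
Proof. by rewrite mulr_gt0 ?rho_maj_gt0// exprz_gt0. Qed.

Lemma measurable_wker (g : R) : measurable_fun setT (fun p : X * X => wker g p.1 p.2).
Proof.
apply: measurable_zseries => [k|k p]; last by rewrite lee_fin wterm_ge0.
have mr : measurable_fun setT (fun p : X * X => 2 ^ k * rho_maj p.2).
  by apply: measurable_funM => //; exact: (measurableT_comp measurable_rho_maj measurable_snd).
apply/measurable_EFinP; apply: measurable_funM => //; apply: measurable_funM; last first.
  by apply: measurable_fun_inv; apply: (measurable_Vol DS) => //; exact: measurable_snd.
rewrite (_ : (fun p => _) = \1_[set p : X * X | d p.2 p.1 < 2 ^ k * rho_maj p.2]); last first.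
  apply/funext => p; rewrite !indicE; congr (_%:R); congr nat_of_bool.
apply: measurable_indic; rewrite -[X in measurable X]setTI.
apply: (measurable_fun_ltr _ _ measurableT (Y := [set true])) => //.
by apply: (measurable_dist2 DS); [exact: measurable_snd|exact: measurable_fst].
Qed.

Lemma wker_integral (g : R) : 0 < g -> exists C : R, 0 < C /\ forall y,
  (\int[mu]_x wker g x y <= C%:E)%E.
Proof.
move=> g0; pose q : R := 2^-1 `^ g.
have q1 : q < 1 by apply: powR_lt1; rewrite // invr_ge0 ler0n invf_lt1// ltr1n.
have q0 : 0 < q by rewrite powR_gt0.
exists (2 / (1 - q)); split; first by rewrite divr_gt0// subr_gt0.
move=> y; rewrite integral_zseries.
- apply: le_trans (zseries_geometric_le _); last by rewrite q0 q1.
  apply: le_zseries => k; first by apply: integral_ge0 => x _; rewrite lee_fin wterm_ge0.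
  have -> : (\int[mu]_x ((2^-1 `^ g) ^+ `|k|%N *
      (\1_(dball d y (2 ^ k * rho_maj y)) x / V y (2 ^ k * rho_maj y)))%:E =
    (q ^+ `|k|%N / V y (2 ^ k * rho_maj y))%:E *
      \int[mu]_x (\1_(dball d y (2 ^ k * rho_maj y)) x)%:E)%E.
    rewrite -ge0_integralZl_EFin//.
    + apply: eq_integral => x _; rewrite -EFinM; congr (_%:E); rewrite -/q; ring.
    + by apply/measurable_EFinP; apply: measurable_indic; exact: (measurable_dball DS).
    + by rewrite divr_ge0 ?(Vol_ge0 d mu)// exprn_ge0// ltW.
  rewrite integral_indic//; last exact: (measurable_dball DS).
  by rewrite setIT (measure_dball DS)// -EFinM divfK// gt_eqF// (Vol_gt0 DS).
- move=> k; apply/measurable_EFinP; apply: measurable_funM => //; apply: measurable_funM => //.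
  by apply: measurable_indic; exact: (measurable_dball DS).
- by move=> k x; rewrite lee_fin wterm_ge0.
Qed.

(** One term of the series suffices, the one whose ball about y has radius comparable to r. After
    [scale_ratio_swap] the left side is governed by the ratio at y, which decays like 2^(-|k|) to
    the power [g * a]. *)
Lemma scale_ratio_le_wker (g : R) : 0 < g -> exists C : R, 0 < C /\
  forall (x y : X) (r : R), 0 < r -> d x y < r ->
  ((scale_ratio x r `^ g / V x r)%:E <= C%:E * wker (g * a) x y)%E.
Proof.
move=> g0; have D0 := doubling_D0 DS.
pose A := 1 + 2 * C3; have A0 : 0 < A by rewrite ltr_wpDr// mulr_ge0// ltW.
pose B := C3 + 2; have B0 : 0 < B by rewrite addr_gt0.
pose C := A `^ g * B `^ (g * a) * (D * 3 `^ n).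
have C0 : 0 < C by rewrite !mulr_gt0 ?powR_gt0.
exists C; split => // x y r r0 xyr.
have y0 := rho0 y; have ym := rho_le_maj y; have my := rho_maj_le y.
have m0 := rho_maj_gt0 y.
have [k0] := @dyadic_bracket R (r / rho_maj y) ltac:(by rewrite divr_gt0).
(* The index is raised by one so that the radius 2^k rho_maj y exceeds r > d x y and the indicator
   at x equals 1. *)
rewrite ler_pdivlMr// ltr_pdivrMr//; set k := k0 + 1.
have kk : 2 ^ k = 2 * 2 ^ k0 :> R by rewrite /k expfzDr// expr1z mulrC.
move=> /andP[h1 h2].
have f0 (j : int) : (0 <= ((2^-1 `^ (g * a)) ^+ `|j|%N *
    (\1_(dball d y (2 ^ j * rho_maj y)) x / V y (2 ^ j * rho_maj y)))%:E)%E.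
  by rewrite lee_fin wterm_ge0.
apply: (@le_trans _ _ (C%:E * _)%E); last first.
  by apply: lee_wpmul2l; [rewrite lee_fin ltW|exact: (le_zseries_term k f0)].
rewrite -EFinM lee_fin indicE mem_set; last first.
  by rewrite /dball/= (dm_sym DS); exact: lt_trans h2.
rewrite mul1r.
have hV : (V x r)^-1 <= D * 3 `^ n * (V y (2 ^ k * rho_maj y))^-1.
  rewrite ler_pdivlMr ?(Vol_gt0 DS)// mulrC ler_pdivrMr ?(Vol_gt0 DS)//.
  apply: (le_Vol_ratio DS) => //; rewrite ?ler1n//.
  by rewrite (dm_sym DS) kk; lra.
have hm : scale_ratio y r <= B * 2^-1 ^+ `|k|%N.
  have h2k : r / rho y <= C3 * 2 ^ k.
    rewrite ler_pdivrMr//; apply: le_trans (ltW h2) _.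
    by rewrite (mulrC C3) -mulrA; apply: ler_wpM2l => //; rewrite ltW// exprz_gt0.
  have h3k : rho y / r <= 2 * (2 ^ k)^-1.
    have k00 : 0 < 2 ^ k0 :> R by rewrite exprz_gt0.
    rewrite kk invfM mulrA mulfV// mul1r ler_pdivrMr// ler_pdivlMl//.
    by apply: le_trans h1; apply: ler_wpM2l => //; exact: ltW.
  have aux (j : int) : r / rho y <= C3 * 2 ^ j -> rho y / r <= 2 * (2 ^ j)^-1 ->
      scale_ratio y r <= B * 2^-1 ^+ `|j|%N.
    case: j => m j1 j2; rewrite /scale_ratio ge_min; apply/orP.
      right; apply: le_trans j2 _; rewrite absz_nat exprVn -exprnP.
      by apply: ler_wpM2r; rewrite ?invr_ge0 ?exprn_ge0// /B lerDr ltW.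
    left; apply: le_trans j1 _; rewrite NegzE -exprnN abszN absz_nat exprVn.
    by apply: ler_wpM2r; rewrite ?invr_ge0 ?exprn_ge0// /B lerDl.
  exact: aux.
have hq : (scale_ratio x r) `^ g <= A `^ g * B `^ (g * a) * (2^-1 `^ (g * a)) ^+ `|k|%N.
  have := scale_ratio_swap (ltW xyr) r0; rewrite -/A => hs.
  have s0 := scale_ratio_gt0 y r0.
  apply: (@le_trans _ _ ((A * scale_ratio y r `^ a) `^ g)).
    by apply: le_powRl => //; [exact: ltW|rewrite ltW// scale_ratio_gt0].
  rewrite powRM ?powR_ge0 ?(ltW A0)// -mulrA; apply: ler_wpM2l; first exact: powR_ge0.
  rewrite -powRrM (mulrC a g).
  rewrite powR_expr ?invr_ge0//.
  rewrite -powRM ?(ltW B0)// ?exprn_ge0 ?invr_ge0//.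
  by apply: le_powRl => //; [rewrite mulr_ge0 ?ltW|exact: ltW].
apply: le_trans (ler_pM _ _ hq hV) _; rewrite ?powR_ge0 ?invr_ge0 ?(Vol_ge0 d mu)//.
by rewrite /C le_eqVlt; apply/orP; left; apply/eqP; ring.
Qed.



End admissible_function.

(** * Fubini for kernels and density of continuous functions *)


Section real_integrals.
Context (R : realType) dsp (X : measurableType dsp).

Lemma abs_Rintegral_le (mu : {measure set X -> \bar R}) (h : X -> R) :
  measurable_fun setT h ->
  (`|Rintegral mu setT h|%:E <= \int[mu]_x `|h x|%:E)%E.
Proof.
move=> mh; have := @le_abse_integral _ _ _ mu setT (EFin \o h) measurableT.
move=> /(_ ((measurable_EFinP _ _).2 mh)); apply: le_trans; rewrite /Rintegral.
case: (integral _ _ _) => [z| |] //=; by rewrite ?normr0 ?leey.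
Qed.

Lemma L1_measurable (mu : {measure set X -> \bar R}) (f : X -> R) :
  L1 mu f -> measurable_fun setT f.
Proof. by move=> /integrableP[mf _]; exact/measurable_EFinP. Qed.

Lemma L1_fin (mu : {measure set X -> \bar R}) (f : X -> R) :
  L1 mu f -> (\int[mu]_x `|f x|%:E < +oo)%E.
Proof. by move=> /integrableP[_]. Qed.

Lemma L1_bounded_mul (mu : {measure set X -> \bar R}) (q f : X -> R) (M : R) :
  measurable_fun setT q -> (forall y, `|q y| <= M) -> L1 mu f ->
  L1 mu (fun y => q y * f y).
Proof.
move=> mq qM lf; have mf := L1_measurable lf.
apply: (@le_integrable _ _ _ mu setT measurableT _ (fun y => M%:E * (f y)%:E)%E).
- by apply/measurable_EFinP; exact: measurable_funM.
- move=> y _; rewrite /= lee_fin normrM [leRHS]normrM.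
  by apply: ler_wpM2r => //; apply: le_trans (qM y) _; exact: ler_norm.
- exact: integrableZl.
Qed.

Lemma Rintegral_EFin (mu : {measure set X -> \bar R}) (f : X -> R) :
  L1 mu f -> (Rintegral mu setT f)%:E = (\int[mu]_x (f x)%:E)%E.
Proof. by move=> lf; rewrite /Rintegral fineK//; exact: integrable_fin_num. Qed.

Variable mu : {sigma_finite_measure set X -> \bar R}.

(** The uniform column bound gives integrability on the product. The row bound makes the inner
    integral in y converge at every x, not merely almost every one, so both iterated integrals are
    identified pointwise. *)
Lemma kernel_fubini (Q : X -> X -> R) (C : R) (f : X -> R) : 0 <= C ->
  measurable_fun setT (fun p : X * X => Q p.1 p.2) ->
  (forall y, (\int[mu]_x `|Q x y|%:E <= C%:E)%E) ->
  (forall x, exists M : R, forall y, `|Q x y| <= M) -> L1 mu f ->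
  [/\ L1 mu (fun y => Rintegral mu setT (Q^~ y) * f y),
      L1 mu (fun x => Rintegral mu setT (fun y => Q x y * f y)) &
      Rintegral mu setT (fun y => Rintegral mu setT (Q^~ y) * f y) =
      Rintegral mu setT (fun x => Rintegral mu setT (fun y => Q x y * f y))].
Proof.
move=> C0 mQ QC QM lf; have mf := L1_measurable lf.
pose Phi (p : X * X) := (Q p.1 p.2 * f p.2)%:E.
have mQ1 y : measurable_fun setT (Q^~ y) by exact: (measurableT_comp mQ (pair2_measurable y)).
have mQ2 x : measurable_fun setT (Q x) by exact: (measurableT_comp mQ (pair1_measurable x)).
have mPhi : measurable_fun setT Phi.
  apply/measurable_EFinP; apply: measurable_funM => //.
  exact: (measurableT_comp mf measurable_snd).
have lQ y : L1 mu (Q^~ y).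
  apply/integrableP; split; first exact/measurable_EFinP.
  by apply: le_lt_trans (QC y) _; rewrite ltry.
have iPhi : (mu \x mu)%E.-integrable setT Phi.
  apply/integrable21ltyP => //.
  apply: (@le_lt_trans _ _ (\int[mu]_y (C%:E * `|f y|%:E))%E); last first.
    rewrite ge0_integralZl_EFin//; last by apply/measurable_EFinP; exact: measurableT_comp.
    by apply: lte_mul_pinfty => //; exact: L1_fin.
  apply: le_lower_integral => y; first exact: integral_ge0.
  rewrite /Phi /=; under eq_integral do rewrite normrM EFinM.
  rewrite ge0_integralZr//; last by apply/measurable_EFinP; exact: measurableT_comp.
  by apply: lee_wpmul2r => //; exact: QC.
have GE y : fubini_G mu Phi y = (Rintegral mu setT (Q^~ y) * f y)%:E.
  rewrite /fubini_G /Phi /= EFinM Rintegral_EFin//.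
  by have := integralZr measurableT (lQ y) (f y).
have FE x : fubini_F mu Phi x = (Rintegral mu setT (fun y => Q x y * f y))%:E.
  rewrite /fubini_F /Phi /= Rintegral_EFin//.
  by have [M HM] := QM x; apply: L1_bounded_mul lf.
have l2 : L1 mu (fun x => Rintegral mu setT (fun y => Q x y * f y)).
  rewrite /L1 (_ : _ \o _ = fubini_F mu Phi); first exact: (integrable_fubini_F iPhi).
  by apply/funext => x; rewrite FE.
have l1 : L1 mu (fun y => Rintegral mu setT (Q^~ y) * f y).
  apply/integrableP; split.
    rewrite (_ : _ \o _ = fubini_G mu Phi); first exact: (measurable_fubini_G iPhi).
    by apply/funext => y; rewrite GE.
  apply: (@le_lt_trans _ _ (\int[mu]_y (C%:E * `|f y|%:E))%E); last first.
    rewrite ge0_integralZl_EFin//; last by apply/measurable_EFinP; exact: measurableT_comp.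
    by apply: lte_mul_pinfty => //; exact: L1_fin.
  apply: le_lower_integral => // y; rewrite /= normrM EFinM.
  by apply: lee_wpmul2r => //; apply: le_trans (abs_Rintegral_le mu (mQ1 y)) (QC y).
split => //; apply: EFin_inj; rewrite !Rintegral_EFin//.
rewrite (eq_integral (fubini_G mu Phi)); last by move=> y _; rewrite GE.
rewrite [RHS](eq_integral (fubini_F mu Phi)); last by move=> x _; rewrite FE.
exact: esym (Fubini iPhi).
Qed.

End real_integrals.

Lemma clamp_lipschitz (R : realFieldType) (a b w : R) : a - b <= w -> b - a <= w ->
  - w <= Num.min 1 (Num.max 0 a) - Num.min 1 (Num.max 0 b) <= w.
Proof.
move=> ? ?; case: (leP 0 a) => ?; case: (leP 0 b) => ?;
  repeat match goal with |- context [Num.min ?x ?y] => case: (leP x y) => ? end;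
  apply/andP; split; lra.
Qed.

Lemma max_lipschitz (R : realFieldType) (a b c e : R) :
  `|Num.max a b - Num.max c e| <= `|a - c| + `|b - e|.
Proof.
have := ler_norm (a - c); have := ler_norm (b - e).
have := ler_norm (c - a); have := ler_norm (e - b).
rewrite (distrC c a) (distrC e b); move: `|a - c| `|b - e| => u v ? ? ? ?.
by rewrite ler_norml; case: (leP a b) => ?; case: (leP c e) => ?; apply/andP; split; lra.
Qed.

Lemma cvg0_small (R : realType) (F : nat -> \bar R) (e : R) : F k @[k --> \oo] --> 0%E ->
  0 < e -> exists k, (F k <= e%:E)%E.
Proof.
move=> /fine_cvgP[[N' _ HN'] cF] e0; have [N _ HN] := (cvgrPdist_le _ _).1 cF e e0.
exists (maxn N N'); have := HN _ (leq_maxl N N'); have := HN' _ (leq_maxr N N').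
rewrite /= sub0r normrN => fin h1; rewrite -(fineK fin) lee_fin.
exact: le_trans (ler_norm _) h1.
Qed.

(** * Density of continuous functions for the measure |f| mu *)

Section continuous_density.
Context (R : realType) dsp (X : measurableType dsp) (d : X -> X -> R)
  (mu : {measure set X -> \bar R}) (D n : R).
Hypothesis DS : doubling_space d mu D n.

Definition dcontinuous (h : X -> R) := forall x e, 0 < e ->
  exists2 r, 0 < r & forall y, d x y < r -> `|h x - h y| < e.

Lemma dcontinuous_lipschitz (h : X -> R) (L : R) : 0 <= L ->
  (forall x y, `|h x - h y| <= L * d x y) -> dcontinuous h.
Proof.
move=> L0 hL x e e0; exists (e / (L + 1)) => [|y].
  by rewrite divr_gt0// ltr_wpDl.
rewrite ltr_pdivlMr ?ltr_wpDl// => xy; apply: le_lt_trans (hL x y) _.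
by apply: le_lt_trans xy; have := dm_ge0 DS x y; lra.
Qed.

Variable f : X -> R.
Hypothesis lf : L1 mu f.

(* The sets whose indicator is approximated by continuous functions in L1(|f| mu)
   form a sigma-algebra containing the balls. *)
Let approximable (A : set X) := measurable A /\ forall e : R, 0 < e ->
  exists h : X -> R, [/\ dcontinuous h, forall x, 0 <= h x <= 1 &
    (\int[mu]_x (`|f x| * `|h x - \1_A x|)%:E <= e%:E)%E].

Let mf : measurable_fun setT (fun x => `|f x|).
Proof. by apply: measurableT_comp => //; exact: L1_measurable lf. Qed.

Let mint (h : X -> R) (A : set X) : measurable A -> dcontinuous h ->
  measurable_fun setT (fun x => (`|f x| * `|h x - \1_A x|)%:E).
Proof.
move=> mA ch; apply/measurable_EFinP; apply: measurable_funM => //.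
apply: measurableT_comp => //; apply: measurable_funB.
  exact: (dcontinuous_measurable DS).
exact: measurable_indic.
Qed.

Let lfn : mu.-integrable setT (fun y => `|f y|%:E).
Proof. exact: integrable_norm lf. Qed.

Let approximable_ball x r : approximable (dball d x r).
Proof.
have mB := measurable_dball DS x r.
split => // e e0.
(* Lipschitz cut-offs of slope k: zero outside the ball, and equal to 1 at each given point of it
   once k is large, so dominated convergence applies. *)
pose h (k : nat) y := Num.min 1 (Num.max 0 (k%:R * (r - d x y))).
have hl k y z : `|h k y - h k z| <= k%:R * d y z.
  have k0 : 0 <= k%:R :> R by [].
  have T1 := dm_triangle DS y x z; have T2 := dm_triangle DS z x y.
  rewrite (dm_sym DS z y) in T2.
  have A1 : k%:R * (d x z - d x y) <= k%:R * d y z by apply: ler_wpM2l => //; lra.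
  have A2 : k%:R * (d x y - d x z) <= k%:R * d y z by apply: ler_wpM2l => //; lra.
  have A3 : 0 <= k%:R * d y z by rewrite mulr_ge0// (dm_ge0 DS).
  rewrite /h !mulrBr ler_norml; move: A1 A2 A3; rewrite !mulrBr.
  move: (k%:R * r) (k%:R * d x y) (k%:R * d x z) (k%:R * d y z) => a b c w A1 A2 A3.
  by apply: clamp_lipschitz; lra.
have ch k : dcontinuous (h k) by apply: (@dcontinuous_lipschitz _ k%:R).
have h01 k y : 0 <= h k y <= 1.
  by rewrite /h le_min ler01 le_max lexx/= ge_min lexx.
have h_out k y : ~ dball d x r y -> h k y = 0.
  rewrite /dball/= => /negP; rewrite -leNgt => ry; rewrite /h max_l ?min_r//.
  by rewrite mulr_ge0_le0 ?subr_le0//.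
pose g k y := (`|f y| * `|h k y - \1_(dball d x r) y|)%:E.
have cg : (\int[mu]_y g k y)%E @[k --> \oo] --> (\int[mu]_y (cst 0%E y))%E.
  apply: (@dominated_cvg _ _ _ mu setT measurableT g _ (fun y => `|f y|%:E)).
  - by move=> k; exact: mint.
  - move=> y _; have [yB|yB] := pselect (dball d x r y); last first.
      rewrite (_ : g^~ y = fun=> 0%E); first exact: cvg_cst.
      apply/funext => k; rewrite /g h_out// indicE memNset//.
      by rewrite subrr normr0 mulr0.
    apply: cvg_near_cst; have ry : 0 < r - d x y by rewrite subr_gt0.
    exists (Num.truncn (r - d x y)^-1).+1 => // k /= hk.
    rewrite /g indicE mem_set// /h max_r; last by rewrite mulr_ge0// ltW.
    rewrite min_l ?subrr ?normr0 ?mulr0// -ler_pdivrMr// mul1r.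
    by apply: le_trans (ltW (truncnS_gt _)) _; rewrite ler_nat.
  - by [].
  - exact: lfn.
  - move=> k y _; rewrite /g /= lee_fin normrM !normr_id ler_piMr//.
    have /andP[a b] := h01 k y; rewrite indicE; case: (_ \in _) => /=;
      by rewrite ler_norml; lra.
rewrite integral0 in cg.
have [k Hk] := cvg0_small cg e0.
by exists (h k); split => // y; exact: h01.
Qed.

Let approximableU A B : approximable A -> approximable B -> approximable (A `|` B).
Proof.
move=> [mA HA] [mB HB]; split; first exact: measurableU.
move=> e e0; have e20 : 0 < e / 2 by rewrite divr_gt0.
have [h [ch h01 hA]] := HA _ e20; have [k [ck k01 kB]] := HB _ e20.
exists (fun x => Num.max (h x) (k x)); split.
- move=> x z z0; have [r r0 Hr] := ch x z z0; have [s s0 Hs] := ck x z z0.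
  exists (Num.min r s); first by rewrite lt_min r0.
  move=> y; rewrite lt_min => /andP[/Hr + /Hs].
  rewrite !ltr_norml => /andP[? ?] /andP[? ?].
  by case: (leP (h x) (k x)) => ?; case: (leP (h y) (k y)) => ?; apply/andP; split; lra.
- move=> x; have /andP[? ?] := h01 x; have /andP[? ?] := k01 x.
  by rewrite le_max ge_max; apply/andP; split; [apply/orP; left|apply/andP].
- apply: (@le_trans _ _ (\int[mu]_x ((`|f x| * `|h x - \1_A x|)%:E +
     (`|f x| * `|k x - \1_B x|)%:E))%E).
    apply: le_lower_integral => x; rewrite lee_fin ?mulr_ge0// -mulrDr.
    apply: ler_wpM2l => //.
    have -> : \1_(A `|` B) x = Num.max (\1_A x) (\1_B x) :> R.
      rewrite !indicE in_setU; case: (x \in A); case: (x \in B) => /=;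
        by rewrite ?maxxx// ?(max_l ler01) ?(max_r ler01).
    exact: max_lipschitz.
  rewrite ge0_integralD//; [|exact: mint|exact: mint].
  by rewrite [leRHS](_ : _ = (e / 2)%:E + (e / 2)%:E)%E ?leeD// -EFinD -splitr.
Qed.

Let approximable0 : approximable set0.
Proof.
split => // e e0; exists (cst 0); split.
- by move=> x z z0; exists 1 => // y _; rewrite /= subrr normr0.
- by move=> x; rewrite /= lexx ler01.
- rewrite (eq_integral (cst 0%E)) ?integral0 ?lee_fin ?ltW// => x _.
  by rewrite indicE in_set0 /= subr0 normr0 mulr0.
Qed.

Let approximable_sigma_algebra : sigma_algebra setT approximable.
Proof.
split.
- exact: approximable0.
- move=> A [mA HA]; split; first exact: measurableD.
  move=> e /HA[h [ch h01 hA]]; exists (fun x => 1 - h x); split.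
  + move=> x z z0; have [r r0 Hr] := ch x z z0; exists r => // y /Hr.
    by rewrite (_ : 1 - h x - _ = - (h x - h y)) ?normrN//; ring.
  + by move=> x; have /andP[? ?] := h01 x; apply/andP; split; lra.
  + apply: le_trans hA; apply: le_lower_integral => x; rewrite lee_fin//.
    apply: ler_wpM2l => //; rewrite setTD !indicE in_setC.
    by case: (x \in A) => /=; rewrite -normrN le_eqVlt; apply/orP; left;
      apply/eqP; congr (`|_|); ring.
- move=> A HA; pose G m := \big[setU/set0]_(i < m) A i.
  have aG m : approximable (G m).
    elim: m => [|m ih]; rewrite /G ?big_ord0 ?big_ord_recr/=; last exact: approximableU.
    exact: approximable0.
  have mA i : measurable (A i) by have [] := HA i.
  have mG m : measurable (G m) by have [] := aG m.
  have mU : measurable (\bigcup_k A k) by exact: bigcupT_measurable.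
  split => // e e0; have e20 : 0 < e / 2 by rewrite divr_gt0.
  have UG : \bigcup_k A k = \bigcup_m G m.
    apply/seteqP; split => [x [k _ xk]|x [m _]].
      by exists k.+1 => //; rewrite /G -bigcup_mkord; exists k => //=.
    by rewrite /G -bigcup_mkord => -[k _ xk]; exists k.
  pose g m y := (`|f y| * `|\1_(G m) y - \1_(\bigcup_k A k) y|)%:E.
  have cg : (\int[mu]_y g k y)%E @[k --> \oo] --> (\int[mu]_y (cst 0%E y))%E.
    apply: (@dominated_cvg _ _ _ mu setT measurableT g _ (fun y => `|f y|%:E)).
    - move=> m; apply/measurable_EFinP; apply: measurable_funM => //.
      by apply: measurableT_comp => //; apply: measurable_funB; exact: measurable_indic.
    - move=> y _; apply: cvg_near_cst.
      have [[k _ yk]|yU] := pselect ((\bigcup_k A k) y); last first.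
        exists 0%N => // m _; rewrite /g !indicE !memNset ?subrr ?normr0 ?mulr0//.
        by move=> yG; apply: yU; rewrite UG; exists m.
      exists k.+1 => // m /= km; rewrite /g !indicE !mem_set ?subrr ?normr0 ?mulr0//.
        by exists k.
      by rewrite /G -bigcup_mkord; exists k.
    - by [].
    - exact: lfn.
    - move=> k y _; rewrite /g /= lee_fin normrM !normr_id ler_piMr//.
      by rewrite !indicE; do 2 case: (_ \in _) => /=;
        rewrite ?subrr ?subr0 ?sub0r ?normrN ?normr0 ?normr1.
  rewrite integral0 in cg.
  have [k Hk] := cvg0_small cg e20.
  have [_ /(_ _ e20)[h [ch h01 hG]]] := aG k.
  exists h; split => //.
  apply: (@le_trans _ _ (\int[mu]_x ((`|f x| * `|h x - \1_(G k) x|)%:E + g k x))%E).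
    apply: le_lower_integral => x; rewrite lee_fin ?mulr_ge0// -mulrDr.
    by apply: ler_wpM2l => //; exact: ler_distD.
  rewrite ge0_integralD//.
  + by rewrite [leRHS](_ : _ = (e / 2)%:E + (e / 2)%:E)%E ?leeD// -EFinD -splitr.
  + exact: mint.
  + by move=> x _; rewrite lee_fin mulr_ge0.
  + apply/measurable_EFinP; apply: measurable_funM => //.
    by apply: measurableT_comp => //; apply: measurable_funB; exact: measurable_indic.
Qed.

Let approximable_measurable A : measurable A -> approximable A.
Proof.
rewrite (ds_borel DS); move: A; apply: smallest_sub; first exact: approximable_sigma_algebra.
move=> U oU; have [a0 aC aU] := approximable_sigma_algebra.
have [[x0 _]|X0] := pselect (exists x0 : X, True); last first.
  rewrite (_ : U = set0)//; apply/seteqP; split => // x Ux.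
  by apply: X0; exists x.
have [y Hy] := separable DS x0.
pose F (i : nat) := if unpickle i is Some (a, m) then
  let _ : nat * nat := (a, m) in
  if `[< dball d (y a) m.+1%:R^-1 `<=` U >] then dball d (y a) m.+1%:R^-1 else set0
  else set0.
rewrite (_ : U = \bigcup_i F i).
  apply: aU => i; rewrite /F; case: unpickle => [[a m]|//] /=.
  by case: ifP => _; [exact: approximable_ball|exact: a0].
apply/seteqP; split => [x Ux|x [i _]]; last first.
  by rewrite /F; case: unpickle => [[a m]|//] /=; case: ifP => // /asboolP H xb; exact: H.
have [r r0 Hr] := oU _ Ux.
have [m] := @ltr_add_invr R 0 (r / 2) ltac:(by rewrite divr_gt0).
rewrite add0r => Hm.
have [a xa] := Hy x m.+1%:R^-1 ltac:(by rewrite invr_gt0).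
exists (pickle (a, m)) => //; rewrite /F pickleK /= asboolT.
  by rewrite /dball/= (dm_sym DS).
move=> z; rewrite /dball/= => az; apply: Hr; rewrite /dball/=.
have := dm_triangle DS (y a) x z; move: (m.+1%:R^-1) xa az Hm => w; lra.
Qed.

(** The sign of f is 2 1_A - 1 with A the set where f >= 0. With an approximation h of the
    indicator, 2 h - 1 replaces the sign at the cost of 2 |f| |h - 1_A|; this is why h is taken at
    precision e / 2. *)
Lemma L1_norm_dcontinuous (e : R) : 0 < e -> exists h : X -> R,
  [/\ dcontinuous h, forall x, `|h x| <= 1 &
    (\int[mu]_x `|f x|%:E <= (Rintegral mu setT (fun x => f x * h x))%:E + e%:E)%E].
Proof.
move=> e0; have e20 : 0 < e / 2 by rewrite divr_gt0.
have mf0 := L1_measurable lf.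
pose A := [set x | 0 <= f x].
have mA : measurable A.
  rewrite /A -[X in measurable X]setTI.
  by apply: (measurable_fun_ler _ _ measurableT (Y := [set true])).
have [_ /(_ _ e20)[h [ch h01 hA]]] := approximable_measurable mA.
have ch2 : dcontinuous (fun x => 2 * h x - 1).
  move=> x z z0; have [r r0 Hr] := ch x (z / 2) ltac:(by rewrite divr_gt0).
  exists r => // y /Hr; rewrite !ltr_norml => /andP[? ?]; apply/andP; split; lra.
have b1 x : `|2 * h x - 1| <= 1 by have /andP[? ?] := h01 x; rewrite ler_norml; lra.
exists (fun x => 2 * h x - 1); split => //.
have mh := dcontinuous_measurable DS ch2.
have lfh : L1 mu (fun x => f x * (2 * h x - 1)).
  have := L1_bounded_mul mh b1 lf; congr (L1 mu _); apply/funext => x; exact: mulrC.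
have m1 := mint mA ch.
have i1 : mu.-integrable setT (fun x => (`|f x| * `|h x - \1_A x|)%:E).
  apply/integrableP; split => //.
  under eq_integral do rewrite gee0_abs ?lee_fin//.
  by apply: le_lt_trans hA _; rewrite ltry.
rewrite Rintegral_EFin//.
apply: (@le_trans _ _ (\int[mu]_x ((f x * (2 * h x - 1))%:E +
    2%:E * (`|f x| * `|h x - \1_A x|)%:E))%E).
  apply: le_integral => //.
    by apply: integrableD => //; exact: integrableZl.
  move=> x _; rewrite lee_fin.
  have /andP[? ?] := h01 x; rewrite indicE.
  have [fx|fx] := leP 0 (f x).
    rewrite mem_set// ger0_norm//= ler0_norm; last by lra.
    by rewrite -subr_ge0 (_ : _ - _ = 0) //; ring.
  rewrite memNset; last by rewrite /A/=; apply/negP; rewrite -ltNge.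
  rewrite ltr0_norm//= ger0_norm; last by lra.
  by rewrite -subr_ge0 (_ : _ - _ = 0) //; ring.
rewrite integralD//; last exact: integrableZl.
apply: leeD => //; rewrite integralZl//.
apply: le_trans (lee_wpmul2l _ hA) _; first by rewrite lee_fin.
by rewrite -EFinM mulrC divfK.
Qed.

End continuous_density.

(** * The error operator and the lower bound by the L1 norm *)


Ltac nonneg := repeat first [assumption | (apply: ltW; assumption) | exact: powR_ge0
  | exact: kern_ge0 | exact: normr_ge0 | exact: Vol_ge0 | exact: ler01 | exact: ler0n | apply: divr_ge0 | apply: mulr_ge0 | apply: addr_ge0 | apply: exprn_ge0].
Ltac positive := repeat first [assumption | exact: ltr01 | exact: ltr0Sn | apply: powR_gt0 | apply: divr_gt0 | apply: mulr_gt0 | apply: addr_gt0 | apply: exprn_gt0].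

Lemma exp_half_small (R : realType) (e : R) : 0 < e -> exists N : nat,
  forall m, (N <= m)%N -> 2^-1 ^+ m <= e.
Proof.
move=> e0; exists (Num.truncn e^-1).+1 => m Nm.
rewrite exprVn -[leRHS]invrK lef_pV2 ?posrE ?invr_gt0 ?exprn_gt0//.
apply: le_trans (ltW (truncnS_gt _)) _; rewrite -natrX ler_nat.
exact: leq_trans Nm (ltnW (ltn_expl _ _)).
Qed.

Section comparison.
Context (R : realType) dsp (X : measurableType dsp) (d : X -> X -> R)
  (mu : {sigma_finite_measure set X -> \bar R}) (D n : R).
Hypothesis DS : doubling_space d mu D n.
Local Notation V := (Vol d mu).
Local Notation K := (kern d mu).
Variables (c : nat -> X) (r : nat -> R).
Hypothesis cov : covering_family d c r.
Variables (rho : X -> R) (C3 a : R).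
Hypothesis RA : admissible_weight d rho C3 a.

Let rho0 := aw_gt0 RA.
Let C30 := aw_const RA.
Let a01 := aw_exponent RA.
Let adm := aw_bound RA.
Local Notation W := (wker d mu rho C3 a).

Definition Eop (g : R) (f : X -> R) (x : X) : \bar R :=
  (\int[mu]_y (W g x y * `|f y|%:E))%E.

Lemma Eop_ge0 (g : R) (f : X -> R) (x : X) : (0 <= Eop g f x)%E.
Proof. by apply: integral_ge0 => y _; rewrite mule_ge0 ?wker_ge0. Qed.

Let mWf (g : R) (f : X -> R) : measurable_fun setT f ->
  measurable_fun setT (fun p : X * X => W g p.1 p.2 * `|f p.2|%:E)%E.
Proof.
move=> mf; apply: emeasurable_funM.
  exact: (measurable_wker DS RA).
apply/measurable_EFinP; apply: measurableT_comp => //.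
exact: (measurableT_comp mf measurable_snd).
Qed.

Let Wf0 (g : R) (f : X -> R) (p : X * X) : (0 <= W g p.1 p.2 * `|f p.2|%:E)%E.
Proof. by rewrite mule_ge0 ?wker_ge0. Qed.

Lemma measurable_Eop (g : R) (f : X -> R) : measurable_fun setT f ->
  measurable_fun setT (Eop g f).
Proof. move=> mf; exact: (measurable_fun_fubini_tonelli_F _ (mWf g mf) (Wf0 g f)). Qed.

Lemma Eop_integral (g : R) : 0 < g -> exists C : R, 0 < C /\
  forall f : X -> R, measurable_fun setT f ->
  (\int[mu]_x Eop g f x <= C%:E * \int[mu]_y `|f y|%:E)%E.
Proof.
move=> g0; have [C [C0 HC]] := wker_integral DS RA g0.
exists C; split => // f mf.
have mn : measurable_fun setT (fun y => `|f y|%:E).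
  by apply/measurable_EFinP; exact: measurableT_comp.
rewrite /Eop (fubini_tonelli _ (mWf g mf) (Wf0 g f)) /=.
rewrite -ge0_integralZl_EFin//; last exact: ltW.
apply: le_lower_integral => y; first by apply: integral_ge0 => x _; exact: (Wf0 g f (x, y)).
have mWy : measurable_fun setT (W g ^~ y).
  exact: (measurableT_comp (measurable_wker DS RA g) (pair2_measurable y)).
rewrite ge0_integralZr//; last by move=> x _; exact: wker_ge0.
by apply: lee_wpmul2r => //; exact: HC.
Qed.

Lemma kern_split (e : R) (x : X) (t : R) (y : X) : 0 < t ->
  K e x t y = (t / (t + d x y)) `^ (e / 2) * K (e / 2) x t y.
Proof.
move=> t0; have /andP[q0 _] := kern_ratio DS x y t0.
rewrite !kern.unlock mulrA -powRD; last by rewrite (gt_eqF q0) implybT.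
by rewrite -splitr.
Qed.

(** Put r = t + d x y. In each regime the prefactor times t / r is at most [scale_ratio x r], and d
    x y < r because t > 0, so [scale_ratio_le_wker] applies. The third case is t = rho x, where no
    prefactor is required. *)
Lemma kern_le_wker (e : R) : 0 < e -> exists C : R, 0 < C /\
  forall (x y : X) (t : R), 0 < t ->
  [/\ t <= rho x -> (((t / (t + rho x)) `^ e * K e x t y)%:E <= C%:E * W (e * a) x y)%E,
      rho x <= t -> (((rho x / (t + rho x)) `^ e * K e x t y)%:E <= C%:E * W (e * a) x y)%E &
      rho x <= t -> t <= rho x -> ((K e x t y)%:E <= C%:E * W (e * a) x y)%E].
Proof.
move=> e0; have [C [C0 HC]] := scale_ratio_le_wker DS RA e0.
exists C; split => // x y t t0; have x0 := rho0 x; have xy := dm_ge0 DS x y.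
have R0 : 0 < t + d x y by rewrite ltr_wpDr.
have := HC x y (t + d x y) R0; rewrite ltrDr => /(_ t0) h.
have red (q : R) : 0 <= q -> q * (t / (t + d x y)) <= scale_ratio rho x (t + d x y) ->
    ((q `^ e * K e x t y)%:E <= C%:E * W (e * a) x y)%E.
  move=> q0 hq; apply: le_trans h; rewrite lee_fin kern.unlock mulrA.
  apply: ler_wpM2r; first by rewrite invr_ge0 (Vol_ge0 d mu).
  rewrite -powRM ?divr_ge0 ?(ltW t0) ?(ltW R0)//; apply: le_powRl => //; first exact: ltW.
  by rewrite mulr_ge0// divr_ge0 ?(ltW t0) ?(ltW R0).
have tr : 0 < t + rho x by rewrite addr_gt0.
split => [tx|xt|xt tx].
- apply: red; first by rewrite divr_ge0 ?(ltW t0) ?(ltW tr).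
  rewrite /scale_ratio le_min; apply/andP; split.
    apply: (@le_trans _ _ (t / (t + rho x))).
      rewrite ler_piMr ?divr_ge0 ?(ltW t0) ?(ltW tr)//.
      by rewrite ler_pdivrMr// mul1r; lra.
    rewrite ler_pdivrMr// mulrAC ler_pdivlMr//.
    by apply: ler_pM; lra.
  rewrite mulrA; apply: ler_wpM2r; first by rewrite invr_ge0 ltW.
  rewrite mulrAC ler_pdivrMr//; apply: (@le_trans _ _ (t * rho x)); first by apply: ler_wpM2l; lra.
  by rewrite mulrC; apply: ler_wpM2l; lra.
- apply: red; first by rewrite divr_ge0 ?(ltW x0) ?(ltW tr).
  apply: (@le_trans _ _ (rho x / (t + d x y))).
    rewrite mulrA; apply: ler_wpM2r; first by rewrite invr_ge0 ltW.
    by rewrite mulrAC ler_pdivrMr//; apply: ler_wpM2l; lra.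
  rewrite /scale_ratio le_min lexx andbT ler_pdivrMr// mulrAC ler_pdivlMr//.
  by apply: ler_pM; lra.
- have tE : t = rho x by apply/eqP; rewrite eq_le tx xt.
  have := red 1 ler01; rewrite powR1 !mul1r; apply.
  rewrite /scale_ratio le_min -tE lexx andbT.
  rewrite ler_pdivrMr// mulrAC ler_pdivlMr//.
  by apply: ler_pM; lra.
Qed.

Lemma kop_le_Eop (g C : R) (q f : X -> R) (x : X) : 0 <= C ->
  measurable_fun setT q -> measurable_fun setT f ->
  (forall y, (`|q y|%:E <= C%:E * W g x y)%E) ->
  (`|Rintegral mu setT (fun y => (q y * f y)%R)|%:E <= C%:E * Eop g f x)%E.
Proof.
move=> C0 mq mf qW; apply: le_trans (abs_Rintegral_le mu _) _.
  exact: measurable_funM.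
rewrite /Eop -ge0_integralZl_EFin//; last 2 first.
- by move=> y _; rewrite mule_ge0 ?wker_ge0.
- exact: (measurableT_comp (mWf g mf) (pair1_measurable x)).
apply: le_lower_integral => // y; rewrite normrM EFinM muleA.
by apply: lee_wpmul2r.
Qed.

Lemma Tplus_rho_ge0 (T : R -> X -> X -> R) (f : X -> R) (x : X) : 0 < rho x ->
  (0 <= Tplus_rho mu rho T f x)%E.
Proof.
move=> x0; apply: le_trans (ereal_sup_ubound _); last first.
  by exists (rho x / 2) => //=; rewrite divr_gt0//= ltr_pdivrMr//; lra.
by rewrite lee_fin.
Qed.

(** * The L1 norm is at most the integral of the local maximal function *)

Section lower_bound.
Variables (S T : R -> X -> X -> R) (e Cs : R).
Hypothesis e0 : 0 < e.
Hypothesis Cs0 : 0 < Cs.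
Hypothesis mS : forall t, 0 < t -> measurable_fun setT (fun p : X * X => S t p.1 p.2).
Hypothesis mT : forall t, 0 < t -> measurable_fun setT (fun p : X * X => T t p.1 p.2).
Hypothesis Sb : forall t x y, 0 < t -> `|S t x y| <= Cs * K e x t y.
Hypothesis Tb : forall t x y, 0 < t -> `|T t x y| <= Cs * K e x t y.
Hypothesis TS : forall t x y, 0 < t ->
  `|T t x y - S t x y| <= Cs * (t / (t + rho x)) `^ e * K e x t y.
Hypothesis S1 : forall t y, 0 < t -> Rintegral mu setT (fun z => S t z y) = 1.
Variable f : X -> R.
Hypothesis lf : L1 mu f.

Section pairing.
Variable h : X -> R.
Hypothesis ch : dcontinuous d h.
Hypothesis h1 : forall x, `|h x| <= 1.

Let t (m : nat) : R := 2^-1 ^+ m.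
Let t0 m : 0 < t m. Proof. by rewrite exprn_gt0// invr_gt0. Qed.
(** A measurable substitute for the set where t m < rho: it is contained in it, since rho_maj <= C3
    rho, and these sets increase to the whole space. *)
Let E m := [set x | t m < rho_maj d rho C3 a x / C3].
Let mh : measurable_fun setT h. Proof. exact: (dcontinuous_measurable DS). Qed.

Let mE m : measurable (E m).
Proof.
rewrite /E -[X in measurable X]setTI.
apply: (measurable_fun_ltr _ _ measurableT (Y := [set true])) => //.
by apply: measurable_funM => //; exact: (measurable_rho_maj DS RA).
Qed.

Let Ex m x : E m x -> t m < rho x.
Proof.
rewrite /E/= => /lt_le_trans; apply; rewrite ler_pdivrMr// mulrC.
exact: (rho_maj_le DS RA).
Qed.

Let b m x := h x * \1_(E m) x.
Let b1 m x : `|b m x| <= 1.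
Proof.
rewrite /b normrM -[leRHS]mulr1; apply: ler_pM => //.
by rewrite indicE; case: (_ \in _); rewrite ?normr1 ?normr0.
Qed.

Let mb m : measurable_fun setT (b m).
Proof. by apply: measurable_funM => //; exact: measurable_indic. Qed.

Let Q m x y := b m x * T (t m) x y.

Let mQ m : measurable_fun setT (fun p : X * X => Q m p.1 p.2).
Proof.
apply: measurable_funM; last exact: mT.
exact: (measurableT_comp (mb m) measurable_fst).
Qed.

Let Qb m x y : `|Q m x y| <= Cs * K e x (t m) y.
Proof.
rewrite /Q normrM -[leRHS]mul1r; apply: ler_pM => //; exact: Tb.
Qed.

Let mK g s y : measurable_fun setT (fun x => (K g x s y)%:E).
Proof. by apply/measurable_EFinP; exact: (measurable_kern DS). Qed.

Let QC : exists C : R, 0 < C /\ forall m y, (\int[mu]_x `|Q m x y|%:E <= C%:E)%E.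
Proof.
have [C [C0 HC]] := kern_integralC DS cov e0.
exists (Cs * C); split; first by rewrite mulr_gt0.
move=> m y; apply: (@le_trans _ _ (Cs%:E * \int[mu]_x (K e x (t m) y)%:E)%E).
  by apply: lower_integral_leZ => // x; rewrite lee_fin// kern_ge0.
by rewrite [leRHS]EFinM; apply: lee_wpmul2l; [rewrite lee_fin ltW|exact: HC].
Qed.

Let QM m x : exists M : R, forall y, `|Q m x y| <= M.
Proof.
exists (Cs / V x (t m)) => y; apply: le_trans (Qb m x y) _.
by apply: ler_wpM2l; [exact: ltW|apply: (kern_le_Vol DS) => //; exact: ltW].
Qed.

Let A m y := Rintegral mu setT (Q m ^~ y).

(** The columns of S integrate to 1, so h y is the integral of h y S x y over x, and the two
    integrands are compared. Near y the difference is small because T is close to S and h is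
    continuous; away from y half of the kernel decay is spent to gain (t m / s)^(e / 2). *)
Let A_cvg y : A m y @[m --> \oo] --> h y.
Proof.
have [C [C0 HC]] := @kern_integralC _ _ _ _ _ _ _ DS _ _ cov (e / 2) ltac:(by rewrite divr_gt0).
apply/cvgrPdist_le => e1 e10.
pose e2 := e1 / (2 * Cs * C).
have e20 : 0 < e2 by rewrite divr_gt0 ?mulr_gt0.
have [c1 [c11 near_rho]] := admissible_near DS RA ler01.
have [s1 s10 Hs1] := ch y e20.
pose s := Num.min s1 (rho y).
have s0 : 0 < s by rewrite lt_min s10 rho0.
(* A common lower bound for rho and rho_maj / C3 on the ball of radius s about y: once t m < tau,
   that whole ball lies in E m. *)
pose tau := rho y / (c1 * C3).
have c10 : 0 < c1 by exact: lt_le_trans c11.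
have tau0 : 0 < tau by rewrite divr_gt0// mulr_gt0.
have C31 := admissible_ge1 DS RA y.
have nearx x : d x y < s -> [/\ tau <= rho_maj d rho C3 a x / C3 , tau <= rho x & `|h x - h y| < e2].
  rewrite lt_min => /andP[xs xr].
  have xr' : rho y <= c1 * rho x by apply: near_rho; rewrite mul1r (dm_sym DS) ltW.
  have xm := rho_le_maj RA x.
  split.
  - rewrite /tau invfM mulrA; apply: ler_wpM2r; first by rewrite invr_ge0 ltW.
    by rewrite ler_pdivrMr// mulrC; apply: le_trans xr' _; apply: ler_wpM2l => //; exact: ltW.
  - rewrite /tau ler_pdivrMr ?mulr_gt0// mulrA mulrC -[leLHS]mul1r.
    apply: ler_pM => //; first exact: ltW.
    by rewrite mulrC.
  - by rewrite distrC; apply: Hs1; rewrite (dm_sym DS).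
have [N1 HN1] := @exp_half_small _ (tau * e2 `^ e^-1) ltac:(by rewrite mulr_gt0 ?powR_gt0).
have [N2 HN2] := @exp_half_small _ (s * e2 `^ (e / 2)^-1) ltac:(by rewrite mulr_gt0 ?powR_gt0).
have [N3 HN3] := @exp_half_small _ (tau / 2) ltac:(by rewrite divr_gt0).
exists (maxn N1 (maxn N2 N3)) => // m /=; rewrite !geq_max => /and3P[m1 m2 m3].
have k1 : (t m / tau) `^ e <= e2.
  have := HN1 m m1; rewrite -/(t m) mulrC -ler_pdivrMr// => q.
  apply: le_trans (le_powRl (ltW e0) _ q) _; first by rewrite divr_ge0 ?ltW.
  by rewrite -powRrM mulVf ?gt_eqF// powRr1 ?(ltW e20).
have k2 : (t m / s) `^ (e / 2) <= e2.
  have e20' : 0 < e / 2 by rewrite divr_gt0.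
  have := HN2 m m2; rewrite -/(t m) mulrC -ler_pdivrMr// => q.
  apply: le_trans (le_powRl (ltW e20') _ q) _; first by rewrite divr_ge0 ?ltW.
  by rewrite -powRrM mulVf ?gt_eqF// powRr1 ?(ltW e20).
have k3 : t m < tau by have := HN3 m m3; rewrite -/(t m); lra.
have pt x : `|Q m x y - h y * S (t m) x y| <= 2 * Cs * e2 * K (e / 2) x (t m) y.
  have Kh0 := kern_ge0 d mu (e / 2) x (t m) y.
  have Ke0 := kern_ge0 d mu e x (t m) y.
  have xy0 := dm_ge0 DS x y.
  have [xy|xy] := ltP (d x y) s.
    have [g1 g2 g3] := nearx _ xy.
    have bE : b m x = h x.
      by rewrite /b indicE mem_set ?mulr1// /E/=; exact: lt_le_trans g1.
    have KK : K e x (t m) y <= K (e / 2) x (t m) y.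
      by apply: (kern_exponent DS _ _ (t0 m)); have := e0; lra.
    rewrite /Q bE (_ : _ - _ = h x * (T (t m) x y - S (t m) x y) +
      (h x - h y) * S (t m) x y); last by ring.
    apply: le_trans (ler_normD _ _) _; rewrite !normrM.
    have x0 := rho0 x.
    have u1 : `|h x| * `|T (t m) x y - S (t m) x y| <= Cs * e2 * K (e / 2) x (t m) y.
      apply: (@le_trans _ _ (1 * (Cs * (t m / (t m + rho x)) `^ e * K e x (t m) y))).
        by apply: ler_pM => //; exact: TS.
      rewrite mul1r; apply: ler_pM => //; first by rewrite mulr_ge0 ?powR_ge0// ltW.
      apply: ler_wpM2l; first exact: ltW.
      apply: le_trans k1; apply: le_powRl; [exact: ltW| |].
        by rewrite divr_ge0 ?addr_ge0 ?ltW.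
      apply: ler_wpM2l; first exact: ltW.
      by rewrite lef_pV2 ?posrE ?addr_gt0//; have := t0 m; lra.
    have u2 : `|h x - h y| * `|S (t m) x y| <= Cs * e2 * K (e / 2) x (t m) y.
      apply: (@le_trans _ _ (e2 * (Cs * K e x (t m) y))).
        by apply: ler_pM => //; [exact: ltW|exact: Sb].
      by rewrite mulrCA mulrA; apply: ler_wpM2l => //; rewrite mulr_ge0 ?ltW.
    by move: u1 u2; rewrite -!mulrA; lra.
  have u : K e x (t m) y <= e2 * K (e / 2) x (t m) y.
    rewrite kern_split//; apply: ler_wpM2r => //; apply: le_trans k2.
    have tm := t0 m.
    apply: le_powRl; first by rewrite divr_ge0// ltW.
      by rewrite divr_ge0 ?addr_ge0 ?(ltW tm).
    apply: ler_wpM2l; first exact: ltW.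
    by rewrite lef_pV2 ?posrE ?ltr_wpDr//; lra.
  apply: le_trans (ler_normB _ _) _.
  have v1 := Qb m x y.
  have v2 : `|h y * S (t m) x y| <= Cs * K e x (t m) y.
    by rewrite normrM -[leRHS]mul1r; apply: ler_pM => //; exact: Sb.
  have v3 : Cs * K e x (t m) y <= Cs * (e2 * K (e / 2) x (t m) y).
    by apply: ler_wpM2l => //; exact: ltW.
  by move: v1 v2 v3; rewrite -!mulrA; lra.
have lS : L1 mu (fun x => S (t m) x y).
  have mSy : measurable_fun setT (fun x => S (t m) x y).
    exact: (measurableT_comp (mS (t0 m)) (pair2_measurable y)).
  apply/integrableP; split; first exact/measurable_EFinP.
  have [C' [C'0 HC']] := kern_integralC DS cov e0.
  apply: (@le_lt_trans _ _ (Cs%:E * \int[mu]_x (K e x (t m) y)%:E)%E).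
    apply: lower_integral_leZ => // x; rewrite ?lee_fin ?kern_ge0//.
    exact: Sb.
  apply: lte_mul_pinfty => //; first by rewrite lee_fin ltW.
  by apply: le_lt_trans (HC' y (t m) (t0 m)) _; rewrite ltry.
have lQ : L1 mu (Q m ^~ y).
  have [C' [C'0 HC']] := QC.
  apply/integrableP; split.
    by apply/measurable_EFinP; exact: (measurableT_comp (mQ m) (pair2_measurable y)).
  by apply: le_lt_trans (HC' m y) _; rewrite ltry.
have lhS : L1 mu (fun x => h y * S (t m) x y) by exact: (integrableZl measurableT (h y) lS).
rewrite distrC /A.
have -> : h y = Rintegral mu setT (fun x => h y * S (t m) x y).
  by rewrite RintegralZl// S1// mulr1.
rewrite -RintegralB// -lee_fin.
have mQS : measurable_fun setT (fun x => Q m x y - h y * S (t m) x y).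
  by apply: measurable_funB; exact: (L1_measurable (mu := mu)).
apply: le_trans (abs_Rintegral_le mu mQS) _.
apply: (@le_trans _ _ ((2 * Cs * e2)%:E * \int[mu]_x (K (e / 2) x (t m) y)%:E)%E).
  have Ce0 : 0 < 2 * Cs * e2 by apply: mulr_gt0 => //; exact: mulr_gt0.
  apply: (lower_integral_leZ _ Ce0) => // x; rewrite lee_fin ?kern_ge0//.
apply: (@le_trans _ _ ((2 * Cs * e2)%:E * C%:E)%E).
  by apply: lee_wpmul2l; [rewrite lee_fin; nonneg|exact: HC].
rewrite -EFinM lee_fin /e2 le_eqVlt; apply/orP; left; apply/eqP; field.
by rewrite !gt_eqF.
Qed.

(** The integral of f h is the limit of those of A m f, by dominated convergence with majorant C
    |f|. By Fubini each of these is the integral of b m times T_{t m} f, and b m vanishes off E m,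
    where t m < rho. *)
Lemma pairing_le_Tplus_rho :
  ((Rintegral mu setT (fun x => (f x * h x)%R))%:E <= \int[mu]_x Tplus_rho mu rho T f x)%E.
Proof.
have [C [C0 HC]] := QC.
have fub m := kernel_fubini (ltW C0) (mQ m) (HC m) (QM m) lf.
have Bm m : ((Rintegral mu setT (fun y => (A m y * f y)%R))%:E <= \int[mu]_x Tplus_rho mu rho T f x)%E.
  have [l1 l2 ->] := fub m.
  apply: (@le_trans _ _ (`|Rintegral mu setT (fun x => Rintegral mu setT (fun y => Q m x y * f y)%R)|%:E)).
    by rewrite lee_fin ler_norm.
  apply: le_trans (abs_Rintegral_le mu (L1_measurable l2)) _.
  apply: le_lower_integral => // x.
  rewrite (_ : Rintegral _ _ _ = b m x * kop mu (T (t m)) f x); last first.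
    rewrite /kop -RintegralZl//.
      by apply: eq_Rintegral => y _; rewrite /Q mulrA.
    apply: (L1_bounded_mul (M := Cs / V x (t m))) => //.
      exact: (measurableT_comp (mT (t0 m)) (pair1_measurable x)).
    move=> y; apply: le_trans (Tb x y (t0 m)) _.
    by apply: ler_wpM2l; [exact: ltW|apply: (kern_le_Vol DS) => //; exact: ltW].
  have [xE|xE] := pselect (E m x); last first.
    by rewrite /b indicE memNset// mulr0 mul0r normr0; exact: Tplus_rho_ge0.
  apply: (@le_trans _ _ (`|kop mu (T (t m)) f x|%:E)).
    by rewrite lee_fin normrM ler_piMl.
  apply: ereal_sup_ubound; exists (t m) => //=.
  by rewrite t0/= Ex.
have lfh : L1 mu (fun x => f x * h x).
  have := L1_bounded_mul mh h1 lf; congr (L1 mu _); apply/funext => x; exact: mulrC.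
rewrite Rintegral_EFin//.
have cv : (\int[mu]_y (A m y * f y)%:E)%E @[m --> \oo] --> (\int[mu]_y (f y * h y)%:E)%E.
  apply: (@dominated_cvg _ _ _ mu setT measurableT _ _ (fun y => (C * `|f y|)%:E)).
  - by move=> m; have [l1 _ _] := fub m; apply/measurable_EFinP; exact: L1_measurable l1.
  - move=> y _; apply: cvg_EFin; first by apply: nearW.
    by rewrite mulrC; apply: cvgM; [exact: A_cvg|exact: cvg_cst].
  - by [].
  - exact: (integrableZl measurableT C (integrable_norm lf)).
  - move=> m y _; rewrite /= lee_fin normrM; apply: ler_wpM2r => //.
    rewrite -lee_fin; apply: le_trans (abs_Rintegral_le mu _) (HC m y).
    exact: (measurableT_comp (mQ m) (pair2_measurable y)).
rewrite -(cvg_lim _ cv)//; apply: lime_le; first by apply/cvg_ex; eexists; exact: cv.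
by apply: nearW => m; have [l1 _ _] := fub m; rewrite -Rintegral_EFin.
Qed.

End pairing.

Lemma L1_le_Tplus_rho : (\int[mu]_x `|f x|%:E <= \int[mu]_x Tplus_rho mu rho T f x)%E.
Proof.
apply/lee_addgt0Pr => z z0; have [h [ch h1 hz]] := L1_norm_dcontinuous DS lf z0.
by apply: le_trans hz _; apply: leeD => //; exact: pairing_le_Tplus_rho.
Qed.

End lower_bound.

End comparison.

(** * Smoothing of test functions *)


(** The decay exponent is twice the regularity exponent: in [approx_pointwise] one factor (t / (t +
    d))^e is exchanged for smallness in eta, and what remains is the integrable kernel with exponent
    e. *)
Record good_kernel (R : realType) dsp (X : measurableType dsp) (d : X -> X -> R)
    (mu : {sigma_finite_measure set X -> \bar R}) (S : R -> X -> X -> R) (e Cs : R) : Prop :=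
  GoodKernel {
    gk_measurable : forall t, 0 < t -> measurable_fun setT (fun p : X * X => S t p.1 p.2);
    gk_size : forall t x y, 0 < t -> `|S t x y| <= Cs * kern d mu (2 * e) x t y;
    gk_left : forall t x x' y, 0 < t -> d x x' <= t / 2 ->
      `|S t x y - S t x' y| <= Cs * (d x x' / t) `^ e * kern d mu (2 * e) x t y;
    gk_right : forall t x y y', 0 < t -> d y y' <= t / 2 ->
      `|S t x y - S t x y'| <= Cs * (d y y' / t) `^ e * kern d mu (2 * e) x t y;
    gk_integral : forall t y, 0 < t -> Rintegral mu setT (fun z => S t z y) = 1 }.

Section approximation.
Context (R : realType) dsp (X : measurableType dsp) (d : X -> X -> R)
  (mu : {sigma_finite_measure set X -> \bar R}) (D n : R).
Hypothesis DS : doubling_space d mu D n.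
Local Notation V := (Vol d mu).
Local Notation K := (kern d mu).
Variables (bc : nat -> X) (br : nat -> R).
Hypothesis cov : covering_family d bc br.

Lemma Rintegral_dominated (h k : X -> R) (b : R) : measurable_fun setT h ->
  (forall z, `|h z| <= k z) -> (\int[mu]_z (k z)%:E <= b%:E)%E ->
  L1 mu h /\ `|Rintegral mu setT h| <= b.
Proof.
move=> mh hk kb.
have ib : (\int[mu]_z `|h z|%:E <= b%:E)%E.
  by apply: le_trans kb; apply: le_lower_integral => // z; rewrite lee_fin.
split; last by rewrite -lee_fin; apply: le_trans (abs_Rintegral_le mu mh) ib.
apply/integrableP; split; first exact/measurable_EFinP.
by apply: le_lt_trans ib _; rewrite ltry.
Qed.

Lemma kern_double (e : R) (x : X) (t : R) (y : X) : 0 < t ->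
  K (2 * e) x t y = (t / (t + d x y)) `^ e * K e x t y.
Proof. by move=> t0; rewrite (kern_split DS)// (_ : 2 * e / 2 = e)//; field. Qed.

Lemma kern_move_double (e t : R) (z z' y : X) : 0 < e -> 0 < t -> d z z' <= t / 2 ->
  K (2 * e) z t y <= 2 `^ (2 * e) * (D * 2 `^ n) * K e z' t y.
Proof.
move=> e0 t0 zz; apply: le_trans (kern_move DS y _ t0 zz) _.
  by rewrite mulr_ge0// ltW.
have D0 := doubling_D0 DS; apply: ler_wpM2l; first by nonneg.
by apply: (kern_exponent DS _ _ t0); lra.
Qed.

Lemma kern_conv_add (e : R) : 0 < e -> exists C : R, 0 < C /\
  forall (x y : X) (t s : R), 0 < t -> t <= s ->
  (\int[mu]_z (K e z t y * (K e x s y + K e x s z))%:E <= (C * K e x s y)%:E)%E.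
Proof.
move=> e0; have [C [C0 HC]] := kern_integralC DS cov e0.
have [C' [C'0 HC']] := kern_conv DS cov e0.
exists (C + C'); split; first exact: addr_gt0.
move=> x y t s t0 ts.
have m1 : measurable_fun setT (fun z => K e z t y) by exact: (measurable_kern DS).
have m2 : measurable_fun setT (fun z => K e x s z) by exact: (measurable_kern DS).
under eq_integral do rewrite mulrDr EFinD.
rewrite ge0_integralD//; last 4 first.
- by move=> z _; rewrite lee_fin mulr_ge0 ?kern_ge0.
- by apply/measurable_EFinP; exact: measurable_funM.
- by move=> z _; rewrite lee_fin mulr_ge0 ?kern_ge0.
- by apply/measurable_EFinP; exact: measurable_funM.
rewrite mulrDl EFinD; apply: leeD; last exact: HC'.
under eq_integral do rewrite EFinM.
rewrite ge0_integralZr//; last 3 first.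
- exact/measurable_EFinP.
- by move=> z _; rewrite lee_fin kern_ge0.
- by rewrite lee_fin kern_ge0.
rewrite EFinM; apply: lee_wpmul2r; first by rewrite lee_fin kern_ge0.
exact: HC.
Qed.

(* [r] is the scale of the size bound and [s <= r] that of the regularity. *)
Definition test_fun (e : R) (x : X) (r s A : R) (phi : X -> R) :=
  (forall y, `|phi y| <= A * K e x r y) /\
  (forall y y', d y y' <= s / 2 ->
     `|phi y - phi y'| <= A * (d y y' / s) `^ e * K e x r y).

Lemma test_fun_measurable (e : R) (x : X) (r s A : R) (phi : X -> R) :
  0 < e -> 0 < s -> 0 <= A -> test_fun e x r s A phi -> measurable_fun setT phi.
Proof.
move=> e0 s0 A0 [_ H]; apply: (dcontinuous_measurable DS) => y z z0.
pose b := A * K e x r y + 1.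
have b0 : 0 < b by rewrite ltr_wpDl// mulr_ge0// kern_ge0.
pose u := (z / (2 * b)) `^ e^-1.
have u0 : 0 < u by rewrite powR_gt0// divr_gt0// mulr_gt0.
exists (s * Num.min (1 / 2) u); first by rewrite mulr_gt0// lt_min u0 divr_gt0.
move=> y'; rewrite mulrC -ltr_pdivrMr// lt_min => /andP[y1 y2].
have y0 := dm_ge0 DS y y'.
have yn : d y y' <= s / 2 by move: y1; rewrite ltr_pdivrMr// => /ltW; rewrite mulrC mulrA mulr1.
apply: le_lt_trans (H y y' yn) _.
have p1 : (d y y' / s) `^ e <= z / (2 * b).
  apply: le_trans (le_powRl (ltW e0) _ (ltW y2)) _; first by rewrite divr_ge0// ltW.
  by rewrite -powRrM mulVf ?gt_eqF// powRr1// divr_ge0 ?mulr_ge0 ?(ltW z0) ?(ltW b0).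
rewrite mulrAC; apply: (@le_lt_trans _ _ (b * (z / (2 * b)))).
  by apply: ler_pM; rewrite ?powR_ge0// ?mulr_ge0 ?kern_ge0// /b lerDl.
rewrite (_ : b * _ = z / 2); last by field; rewrite gt_eqF.
by rewrite ltr_pdivrMr//; lra.
Qed.

Variables (S : R -> X -> X -> R) (e Cs : R).
Hypothesis e0 : 0 < e.
Hypothesis Cs0 : 0 < Cs.
Hypothesis SG : good_kernel d mu S e Cs.

Let mS := gk_measurable SG.
Let Sb := gk_size SG.
Let Sl := gk_left SG.
Let Sr := gk_right SG.
Let S1 := gk_integral SG.

Let cm : R := 2 `^ (2 * e) * (D * 2 `^ n).
Let cm0 : 0 < cm. Proof. by rewrite !mulr_gt0 ?powR_gt0// (doubling_D0 DS). Qed.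

Let kern_near (t : R) (z z' y : X) : 0 < t -> d z z' <= t / 2 ->
  K (2 * e) z t y <= cm * K e z' t y.
Proof. exact: kern_move_double. Qed.

Let kern_dbl (t : R) (z y : X) : 0 < t -> K (2 * e) z t y <= K e z t y.
Proof. by move=> t0; apply: (kern_exponent DS _ _ t0); have := e0; lra. Qed.

(** The increment of phi is at most A m^e times kernel values, with m = d y z / s for close points
    (regularity) and m = 1 for distant ones (size). In both cases m t / (t + d z y) <= 2 eta, which
    is where the spare factor of the decay of S goes. *)
Let approx_pointwise (x y z : X) (r s eta A : R) (phi : X -> R) :
  0 < eta -> 0 < s -> 0 <= A -> test_fun e x r s A phi ->
  `|phi y - phi z| * `|S (eta * s) z y| <=
    A * Cs * (2 * eta) `^ e * (K e z (eta * s) y * (K e x r y + K e x r z)).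
Proof.
move=> h0 s0 A0 [H1 H2]; set t := eta * s; have t0 : 0 < t by rewrite mulr_gt0.
have yz0 := dm_ge0 DS y z.
have w0 : 0 <= K e x r y + K e x r z by rewrite addr_ge0 ?kern_ge0.
have q0 : 0 <= t / (t + d z y).
  by rewrite divr_ge0 ?addr_ge0 ?(dm_ge0 DS)// ltW.
have td : 0 < t + d z y by rewrite ltr_wpDr// (dm_ge0 DS).
have [m [m0 m1 m2]] : exists m, [/\ 0 <= m,
    `|phi y - phi z| <= A * m `^ e * (K e x r y + K e x r z) &
    m * (t / (t + d z y)) <= 2 * eta].
  have [yz|yz] := leP (d y z) (s / 2).
    exists (d y z / s); split; first by rewrite divr_ge0// ltW.
      apply: le_trans (H2 y z yz) _; apply: ler_wpM2l; first by rewrite mulr_ge0 ?powR_ge0.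
      by rewrite lerDl kern_ge0.
    rewrite (dm_sym DS z y) in td *.
    rewrite mulrA ler_pdivrMr// mulrAC ler_pdivrMr// /t.
    have := t0; rewrite /t => t0'.
    apply: (@le_trans _ _ (2 * (eta * s) * (eta * s + d y z))); last by rewrite -!mulrA; lra.
    rewrite mulrC -[leLHS]mul1r -!mulrA ler_pM// ?mulr_ge0 ?(ltW h0) ?(ltW s0)//; first by lra.
    by apply: ler_wpM2l; [exact: ltW|apply: ler_wpM2l; [exact: ltW|lra]].
  exists 1; split => //.
    rewrite powR1 mulr1 mulrDr; apply: le_trans (ler_normB _ _) _.
    by apply: lerD; exact: H1.
  rewrite mul1r ler_pdivrMr// (dm_sym DS z y) /t mulrDr.
  apply: (@le_trans _ _ (2 * eta * d y z)); last by rewrite lerDr mulr_ge0 ?mulr_ge0// ltW.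
  rewrite -mulrA mulrCA; apply: ler_wpM2l; [exact: ltW|].
  by move: yz; rewrite ltr_pdivrMr//; lra.
apply: (@le_trans _ _ ((A * m `^ e * (K e x r y + K e x r z)) * (Cs * K (2 * e) z t y))).
  by apply: ler_pM => //; exact: Sb.
rewrite kern_double//.
have mq : m `^ e * (t / (t + d z y)) `^ e <= (2 * eta) `^ e.
  by rewrite -powRM//; apply: le_powRl; [exact: ltW|rewrite mulr_ge0|].
rewrite [leLHS](_ : _ = (m `^ e * (t / (t + d z y)) `^ e) *
  (A * Cs * (K e z t y * (K e x r y + K e x r z)))); last by ring.
rewrite [leRHS](_ : _ = (2 * eta) `^ e *
  (A * Cs * (K e z t y * (K e x r y + K e x r z)))); last by ring.
apply: ler_wpM2r => //; apply: mulr_ge0; first by rewrite mulr_ge0// ltW.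
by apply: mulr_ge0 => //; exact: kern_ge0.
Qed.

(** The kernel is evaluated at pi z instead of z so that, after Fubini, the pairing with f sees S_t
    f only at freely chosen points near z. *)
Definition kern_smooth (t : R) (pi : X -> X) (phi : X -> R) (y : X) : R :=
  Rintegral mu setT (fun z => phi z * S t (pi z) y).

Let measurable_Spi (t : R) (pi : X -> X) (y : X) : 0 < t -> measurable_fun setT pi ->
  measurable_fun setT (fun z => S t (pi z) y).
Proof.
move=> t0 mpi.
by have := measurableT_comp (mS t0) (measurable_fun_pair mpi (measurable_cst y)).
Qed.

Lemma kern_smooth_bound (x : X) (r s t A : R) (pi : X -> X) (phi : X -> R) :
  0 < s -> 0 < t -> 0 < r -> 0 <= A -> measurable_fun setT pi -> (forall z, d (pi z) z <= t / 2) ->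
  test_fun e x r s A phi ->
  exists M : R, 0 <= M /\ forall y, (\int[mu]_z `|phi z * S t (pi z) y|%:E <= M%:E)%E.
Proof.
move=> s0 t0 rr0 A0 mpi piz H.
have [C [C0 HC]] := kern_integralC DS cov e0.
have V0 : 0 <= (V x r)^-1 by rewrite invr_ge0 (Vol_ge0 d mu).
have b0 : 0 <= A * (V x r)^-1 * (Cs * cm) by nonneg.
exists (A * (V x r)^-1 * (Cs * cm) * C); split; first by nonneg.
move=> y; rewrite EFinM.
apply: (@le_trans _ _ ((A * (V x r)^-1 * (Cs * cm))%:E * \int[mu]_z (K e z t y)%:E)%E); last first.
  by apply: lee_wpmul2l => //; exact: HC.
rewrite -ge0_integralZl_EFin//; last 2 first.
- by move=> z _; rewrite lee_fin kern_ge0.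
- by apply/measurable_EFinP; exact: (measurable_kern DS).
apply: le_lower_integral => // z; rewrite lee_fin normrM -[leRHS]mulrA; apply: ler_pM => //.
  case: H => H _; apply: le_trans (H z) _; apply: ler_wpM2l => //.
  by apply: (kern_le_Vol DS) => //; exact: ltW.
apply: le_trans (Sb _ _ t0) _; rewrite -mulrA; apply: ler_wpM2l; first exact: ltW.
exact: kern_near.
Qed.

Lemma kern_smooth_integrable (x y : X) (r s t A : R) (pi : X -> X) (phi : X -> R) :
  0 < s -> 0 < t -> 0 < r -> 0 <= A -> measurable_fun setT pi -> (forall z, d (pi z) z <= t / 2) ->
  test_fun e x r s A phi -> L1 mu (fun z => phi z * S t (pi z) y).
Proof.
move=> s0 t0 rr0 A0 mpi piz H.
have [M [M0 HM]] := kern_smooth_bound s0 t0 rr0 A0 mpi piz H.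
apply/integrableP; split.
  apply/measurable_EFinP; apply: measurable_funM; last exact: measurable_Spi.
  exact: test_fun_measurable H.
by apply: le_lt_trans (HM y) _; rewrite ltry.
Qed.

(** Size: phi y is the integral of phi y S z y, and the difference splits into an increment of phi,
    small by [approx_pointwise], and an increment of S from z to pi z, small because d (pi z) z <=
    eta t. Regularity: phi is regular at the scale s and its smoothing at eta s, so measuring both
    at eta^2 s gains at least eta^e. *)
Lemma test_fun_smooth : exists C : R, 0 < C /\
  forall (x : X) (r s eta A : R) (pi : X -> X) (phi : X -> R),
  0 < eta -> eta <= 2^-1 -> 0 < s -> s <= r -> 0 <= A ->
  measurable_fun setT pi -> (forall z, d (pi z) z <= eta * (eta * s)) ->
  test_fun e x r s A phi ->
  test_fun e x r (eta ^+ 2 * s) (C * eta `^ e * A)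
    (fun y => phi y - kern_smooth (eta * s) pi phi y).
Proof.
have [C [C0 HC]] := kern_conv_add e0.
pose C1 := Cs * 2 `^ e * C + Cs * cm * C.
pose C2 := 1 + Cs * cm * C.
have C10 : 0 < C1.
  by apply: addr_gt0; apply: mulr_gt0 => //; apply: mulr_gt0 => //; exact: powR_gt0.
have C20 : 0 < C2 by apply: addr_gt0 => //; apply: mulr_gt0 => //; exact: mulr_gt0.
exists (C1 + C2); split; first exact: addr_gt0.
move=> x r' s eta A pi phi h0 h1 s0 sr A0 mpi piz H.
set t := eta * s; have t0 : 0 < t by rewrite mulr_gt0.
have rr0 : 0 < r' by exact: lt_le_trans sr.
have tr : t <= r'.
  by apply: le_trans sr; rewrite /t ler_piMl ?(ltW s0)//; lra.
have ht : eta * t <= t / 2 by rewrite mulrC; apply: ler_wpM2l => //; exact: ltW.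
have pz z : d (pi z) z <= t / 2 by apply: le_trans (piz z) ht.
have mphi := test_fun_measurable e0 s0 A0 H.
have lpsi y := kern_smooth_integrable y s0 t0 rr0 A0 mpi pz H.
have Kxr y : 0 <= K e x r' y by exact: kern_ge0.
have he0 : 0 <= eta `^ e by exact: powR_ge0.
have mKK y : measurable_fun setT (fun z => (K e z t y * (K e x r' y + K e x r' z))%:E).
  apply/measurable_EFinP; apply: measurable_funM; first exact: (measurable_kern DS).
  by apply: measurable_funD => //; exact: (measurable_kern DS).
have KK0 y z : 0 <= K e z t y * (K e x r' y + K e x r' z).
  by rewrite mulr_ge0 ?addr_ge0 ?kern_ge0.
have Zint (b : R) y : 0 <= b ->
    (\int[mu]_z (b * (K e z t y * (K e x r' y + K e x r' z)))%:E <= (b * C * K e x r' y)%:E)%E.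
  move=> b0; under eq_integral do rewrite EFinM.
  rewrite ge0_integralZl_EFin//; last by move=> z _; rewrite lee_fin.
  by rewrite -mulrA EFinM; apply: lee_wpmul2l => //; exact: HC.
have mSy y : measurable_fun setT (fun z => S t z y).
  by have := measurableT_comp (mS t0) (pair2_measurable y).
have size y : `|phi y - kern_smooth t pi phi y| <= C1 * eta `^ e * A * K e x r' y.
  have lSy : L1 mu (fun z => S t z y).
    have [C' [C'0 HC']] := kern_integralC DS cov e0.
    have [] := @Rintegral_dominated (fun z => S t z y) (fun z => Cs * K e z t y) (Cs * C') => //.
    - move=> z; apply: le_trans (Sb _ _ t0) _; apply: ler_wpM2l; first exact: ltW.
      exact: kern_dbl.
    - under eq_integral do rewrite EFinM.
      rewrite ge0_integralZl_EFin//; last 3 first.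
      + by move=> z _; rewrite lee_fin kern_ge0.
      + by apply/measurable_EFinP; exact: (measurable_kern DS).
      + exact: ltW.
      by rewrite [leRHS]EFinM; apply: lee_wpmul2l; [rewrite lee_fin ltW|exact: HC'].
  have lS : L1 mu (fun z => phi y * S t z y) by exact: (integrableZl measurableT (phi y) lSy).
  have -> : phi y - kern_smooth t pi phi y =
      Rintegral mu setT (fun z => phi y * S t z y - phi z * S t (pi z) y).
    by rewrite (RintegralB measurableT lS (lpsi y)) (RintegralZl _ measurableT lSy) S1// mulr1.
  have [] := @Rintegral_dominated (fun z => phi y * S t z y - phi z * S t (pi z) y)
    (fun z => (A * Cs * (2 * eta) `^ e + A * Cs * eta `^ e * cm) *
       (K e z t y * (K e x r' y + K e x r' z)))
    ((A * Cs * (2 * eta) `^ e + A * Cs * eta `^ e * cm) * C * K e x r' y) => //.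
  - apply: measurable_funB; apply: measurable_funM => //.
    exact: measurable_Spi.
  - move=> z; rewrite (_ : _ - _ = (phi y - phi z) * S t z y +
      phi z * (S t z y - S t (pi z) y)); last by ring.
    apply: le_trans (ler_normD _ _) _; rewrite !normrM mulrDl; apply: lerD.
      exact: approx_pointwise.
    have H1 := H.1 z.
    have zpz : d z (pi z) <= t / 2 by rewrite (dm_sym DS).
    have H2 := Sl y t0 zpz.
    apply: (@le_trans _ _ ((A * K e x r' z) * (Cs * eta `^ e * (cm * K e z t y)))).
      apply: ler_pM => //; apply: le_trans H2 _; apply: ler_pM.
      + by nonneg.
      + exact: kern_ge0.
      + apply: ler_wpM2l; first exact: ltW.
        apply: le_powRl; first exact: ltW.
          by rewrite divr_ge0 ?(dm_ge0 DS)// ltW.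
        by rewrite ler_pdivrMr// (dm_sym DS).
      + by apply: kern_near => //; rewrite (dm_refl DS) divr_ge0// ltW.
    rewrite [leLHS](_ : _ = A * Cs * eta `^ e * cm * (K e z t y * K e x r' z)); last by ring.
    apply: ler_wpM2l; first by nonneg.
    by apply: ler_wpM2l; [exact: kern_ge0|rewrite lerDr].
  - by apply: Zint; nonneg.
  move=> _ /le_trans; apply; rewrite powRM ?(ltW h0)// /C1.
  by rewrite le_eqVlt; apply/orP; left; apply/eqP; ring.
split => [y|y y' yy].
  apply: le_trans (size y) _; apply: ler_wpM2r => //; apply: ler_wpM2r => //.
  by apply: ler_wpM2r => //; rewrite lerDl ltW.
have e2s : 0 < eta ^+ 2 * s by rewrite mulr_gt0// exprn_gt0.
have yy0 := dm_ge0 DS y y'.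
have e2le : eta ^+ 2 * s <= t.
  by rewrite /t expr2 -mulrA ler_piMl ?(ltW t0)//; lra.
have yt : d y y' <= t / 2.
  by apply: le_trans yy _; apply: ler_wpM2r => //; rewrite invr_ge0.
have ys : d y y' <= s / 2.
  apply: le_trans yt _; apply: ler_wpM2r; first by rewrite invr_ge0.
  by rewrite /t ler_piMl ?(ltW s0)//; lra.
have sE : d y y' / s = eta ^+ 2 * (d y y' / (eta ^+ 2 * s)).
  by field; rewrite !gt_eqF.
have tE : d y y' / t = eta * (d y y' / (eta ^+ 2 * s)).
  by rewrite /t; field; rewrite !gt_eqF.
have u0 : 0 <= d y y' / (eta ^+ 2 * s) by rewrite divr_ge0// ltW.
set u := d y y' / (eta ^+ 2 * s) in sE tE u0 *.
have B1 : `|phi y - phi y'| <= eta `^ e * A * u `^ e * K e x r' y.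
  apply: le_trans (H.2 y y' ys) _; apply: ler_wpM2r => //.
  rewrite mulrC [leRHS]mulrAC; apply: ler_wpM2r => //.
  rewrite sE powRM ?exprn_ge0 ?(ltW h0)//; apply: ler_wpM2r; first exact: powR_ge0.
  apply: le_powRl; [exact: ltW|by rewrite exprn_ge0 ?(ltW h0)|].
  by rewrite expr2 ler_piMl ?(ltW h0)//; lra.
have B2 : `|kern_smooth t pi phi y - kern_smooth t pi phi y'| <= Cs * cm * C * (eta `^ e * A * u `^ e * K e x r' y).
  rewrite /kern_smooth -(RintegralB measurableT (lpsi y) (lpsi y')).
  have [] := @Rintegral_dominated (fun z => phi z * S t (pi z) y - phi z * S t (pi z) y')
    (fun z => A * Cs * (eta `^ e * u `^ e) * cm * (K e z t y * (K e x r' y + K e x r' z)))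
    (A * Cs * (eta `^ e * u `^ e) * cm * C * K e x r' y) => //.
  - by apply: measurable_funB; apply: measurable_funM => //; exact: measurable_Spi.
  - move=> z; rewrite -mulrBr normrM.
    apply: (@le_trans _ _ ((A * K e x r' z) * (Cs * (eta `^ e * u `^ e) * (cm * K e z t y)))).
      apply: ler_pM => //; first exact: H.1.
      apply: le_trans (Sr _ t0 yt) _; rewrite tE powRM ?(ltW h0)//.
      apply: ler_wpM2l; last exact: kern_near.
      by nonneg.
    rewrite [leLHS](_ : _ = A * Cs * (eta `^ e * u `^ e) * cm * (K e z t y * K e x r' z)); last by ring.
    apply: ler_wpM2l; first by nonneg.
    by apply: ler_wpM2l; [exact: kern_ge0|rewrite lerDr].
  - by apply: Zint; nonneg.
  move=> _ /le_trans; apply.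
  by rewrite le_eqVlt; apply/orP; left; apply/eqP; ring.
rewrite (_ : _ - _ - _ = (phi y - phi y') - (kern_smooth t pi phi y - kern_smooth t pi phi y')); last by ring.
apply: le_trans (ler_normB _ _) _; apply: le_trans (lerD B1 B2) _.
rewrite [leLHS](_ : _ = C2 * (eta `^ e * A * u `^ e * K e x r' y)); last by rewrite /C2; ring.
rewrite [leRHS](_ : _ = (C1 + C2) * (eta `^ e * A * u `^ e * K e x r' y)); last by ring.
apply: ler_wpM2r; first by nonneg.
by rewrite lerDr ltW.
Qed.

End approximation.

(** * The grand maximal function *)


Section near_minimizers.
Context (R : realType) dsp (X : measurableType dsp) (d : X -> X -> R)
  (mu : {measure set X -> \bar R}) (D n : R).
Hypothesis DS : doubling_space d mu D n.

(** Measurability of pi needs no property of u: pi is constant on the cells of a countable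
    partition, z being assigned to the first ball of the dense sequence that contains it. The
    infimum may not be attained, hence the slack tau. *)
Lemma near_minimizer (y : nat -> X) (delta tau : R) (u : X -> R) : 0 < delta -> 0 < tau ->
  (forall x e, 0 < e -> exists i, d x (y i) < e) ->
  exists (pi : X -> X) (N : X -> nat),
  [/\ measurable_fun setT pi, forall z, d (y (N z)) z < delta,
      forall z, d (pi z) z <= 2 * delta &
      forall z, `|u (pi z)| <= inf [set `|u w| | w in dball d (y (N z)) delta] + tau].
Proof.
move=> d0 t0 Hy.
have /choice[cc Hcc] : forall k, exists w, d (y k) w < delta /\
    `|u w| <= inf [set `|u w| | w in dball d (y k) delta] + tau.
  move=> k; have hi : has_inf [set `|u w| | w in dball d (y k) delta].
    split; first by exists `|u (y k)|; exists (y k) => //; rewrite /dball /= (dm_refl DS).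
    by exists 0 => _ [w _ <-].
  have [_ [w wB <-] Hw] := inf_adherent t0 hi; exists w; split => //.
  exact: ltW.
have ex z : exists k, d (y k) z < delta.
  by have [i] := Hy z _ d0; exists i; rewrite (dm_sym DS).
pose N z := ex_minn (ex z).
have NP z : d (y (N z)) z < delta /\ forall k, d (y k) z < delta -> (N z <= k)%N.
  by rewrite /N; case: ex_minnP.
exists (cc \o N), N; split.
- move=> _ Y mY; rewrite setTI.
  rewrite (_ : _ @^-1` Y = \bigcup_(k in [set k | Y (cc k)])
      (dball d (y k) delta `\` \bigcup_(l in `I_k) dball d (y l) delta)).
    apply: bigcup_measurable => k _; apply: measurableD; first exact: (measurable_dball DS).
    by apply: bigcup_measurable => l _; exact: (measurable_dball DS).
  apply/seteqP; split => [z Yz|z [k Yk [zk nz]]].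
    exists (N z) => //; have [h1 h2] := NP z; split => // -[l /= lN zl].
    by have := h2 l zl; rewrite leqNgt lN.
  rewrite /preimage /=; suff -> : N z = k by [].
  have [h1 h2] := NP z; apply/eqP; rewrite eqn_leq h2//= leqNgt.
  by apply/negP => lt; apply: nz; exists (N z).
- by move=> z; have [] := NP z.
- move=> z /=; have [h1 _] := NP z; have [h2 _] := Hcc (N z).
  have := dm_triangle DS (y (N z)) (cc (N z)) z; rewrite (dm_sym DS (cc (N z)) (y (N z))); lra.
- by move=> z /=; have [] := Hcc (N z).
Qed.

End near_minimizers.

Section grand_maximal.
Context (R : realType) dsp (X : measurableType dsp) (d : X -> X -> R)
  (mu : {sigma_finite_measure set X -> \bar R}) (D n : R).
Hypothesis DS : doubling_space d mu D n.
Local Notation V := (Vol d mu).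
Local Notation K := (kern d mu).
Variables (bc : nat -> X) (br : nat -> R).
Hypothesis cov : covering_family d bc br.
Local Notation M := (maxfun d mu bc br).
Variables (rho : X -> R) (C3 a : R).
Hypothesis RA : admissible_weight d rho C3 a.

Let rho0 := aw_gt0 RA.
Let C30 := aw_const RA.
Let a01 := aw_exponent RA.
Let adm := aw_bound RA.
Local Notation EE := (Eop d mu rho C3 a).

(** Tonelli and [kern_conv] (this is where t <= rho x enters) replace the composition by a multiple
    of the kernel at scale rho x, which is dominated by W at the critical scale. *)
Lemma far_integral (e : R) : 0 < e -> exists C : R, 0 < C /\
  forall (f : X -> R) (x : X) (t : R), measurable_fun setT f -> 0 < t -> t <= rho x ->
  (\int[mu]_z ((K e x (rho x) z)%:E * \int[mu]_y (K e z t y * `|f y|)%:E)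
    <= C%:E * EE (e * a) f x)%E.
Proof.
move=> e0; have [C [C0 HC]] := kern_conv DS cov e0.
have [C' [C'0 HC']] := kern_le_wker DS RA e0.
exists (C * C'); split; first exact: mulr_gt0.
move=> f x t mf t0 tr.
have mF : measurable_fun setT (fun p : X * X =>
    (K e x (rho x) p.1 * (K e p.1 t p.2 * `|f p.2|))%:E).
  apply/measurable_EFinP; apply: measurable_funM.
    exact: (measurable_kern DS).
  apply: measurable_funM; first exact: (measurable_kern DS).
  by apply: measurableT_comp => //; exact: (measurableT_comp mf measurable_snd).
have F0 (p : X * X) : (0 <= (K e x (rho x) p.1 * (K e p.1 t p.2 * `|f p.2|))%:E)%E.
  by rewrite lee_fin; nonneg.
have -> : (\int[mu]_z ((K e x (rho x) z)%:E * \int[mu]_y (K e z t y * `|f y|)%:E) =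
    \int[mu]_z \int[mu]_y (K e x (rho x) z * (K e z t y * `|f y|))%:E)%E.
  apply: eq_integral => z _; rewrite -ge0_integralZl_EFin ?kern_ge0//.
  - by move=> y _; rewrite lee_fin; nonneg.
  - apply/measurable_EFinP; apply: measurable_funM; first exact: (measurable_kern DS).
    exact: measurableT_comp.
rewrite (fubini_tonelli _ mF F0)/= /Eop -ge0_integralZl_EFin//; last 3 first.
- by move=> y _; rewrite mule_ge0 ?wker_ge0.
- apply: emeasurable_funM.
    exact: (measurableT_comp (measurable_wker DS RA _) (pair1_measurable x)).
  by apply/measurable_EFinP; exact: measurableT_comp.
- by nonneg.
apply: le_lower_integral => y; first by apply: integral_ge0 => z _; exact: (F0 (z, y)).
have -> : (\int[mu]_z (K e x (rho x) z * (K e z t y * `|f y|))%:E =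
    `|f y|%:E * \int[mu]_z (K e z t y * K e x (rho x) z)%:E)%E.
  rewrite -ge0_integralZl_EFin//.
  - by apply: eq_integral => z _; rewrite -EFinM; congr EFin; ring.
  - by move=> z _; rewrite lee_fin; nonneg.
  - by apply/measurable_EFinP; apply: measurable_funM; exact: (measurable_kern DS).
rewrite muleA [leRHS]muleC; apply: lee_wpmul2l => //.
apply: le_trans (HC x y _ _ t0 tr) _; rewrite !EFinM -muleA.
apply: lee_wpmul2l; first by rewrite lee_fin ltW.
by have [_ _] := HC' x y (rho x) (rho0 x); apply.
Qed.

Variables (S : R -> X -> X -> R) (e Cs : R).
Hypothesis e0 : 0 < e.
Hypothesis Cs0 : 0 < Cs.
Hypothesis SG : good_kernel d mu S e Cs.

Let mS := gk_measurable SG.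
Let Sb := gk_size SG.
Let Sl := gk_left SG.
Let Sr := gk_right SG.
Let S1 := gk_integral SG.

Let Sbound (t : R) (x : X) : 0 < t -> exists M : R, forall y, `|S t x y| <= M.
Proof.
move=> t0; exists (Cs * (V x t)^-1) => y; apply: le_trans (Sb _ _ t0) _.
apply: ler_wpM2l; first exact: ltW.
by apply: (kern_le_Vol DS) => //; have := e0; lra.
Qed.

Let mS2 (t : R) (x : X) : 0 < t -> measurable_fun setT (S t x).
Proof. by move=> t0; exact: (measurableT_comp (mS t0) (pair1_measurable x)). Qed.

Lemma pairing_smooth (x : X) (r s t A : R) (pi : X -> X) (phi f : X -> R) :
  0 < s -> 0 < t -> 0 < r -> 0 <= A -> measurable_fun setT pi ->
  (forall z, d (pi z) z <= t / 2) -> test_fun d mu e x r s A phi -> L1 mu f ->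
  [/\ L1 mu (fun y => kern_smooth mu S t pi phi y * f y),
      L1 mu (fun z => phi z * kop mu (S t) f (pi z)) &
      Rintegral mu setT (fun y => kern_smooth mu S t pi phi y * f y) =
      Rintegral mu setT (fun z => phi z * kop mu (S t) f (pi z))].
Proof.
move=> s0 t0 r0 A0 mpi piz H lf.
have [B [B0 HB]] := kern_smooth_bound DS cov e0 Cs0 SG s0 t0 r0 A0 mpi piz H.
have mphi := test_fun_measurable DS e0 s0 A0 H.
have mQ : measurable_fun setT (fun p : X * X => phi p.1 * S t (pi p.1) p.2).
  apply: measurable_funM; first exact: (measurableT_comp mphi measurable_fst).
  have mp : measurable_fun setT (fun p : X * X => (pi p.1, p.2)).
    by apply: measurable_fun_pair => //; exact: (measurableT_comp mpi measurable_fst).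
  exact: (measurableT_comp (mS t0) mp).
have QM z : exists B', forall y, `|phi z * S t (pi z) y| <= B'.
  have [B' HB'] := Sbound (pi z) t0; exists (`|phi z| * B') => y.
  by rewrite normrM; apply: ler_wpM2l.
have [l1 l2 E] := @kernel_fubini _ _ _ mu (fun z y => phi z * S t (pi z) y) B f B0 mQ HB QM lf.
have kE : (fun z => Rintegral mu setT (fun y => phi z * S t (pi z) y * f y)) =
    (fun z => phi z * kop mu (S t) f (pi z)).
  apply/funext => z; under eq_Rintegral do rewrite -mulrA.
  rewrite RintegralZl//; have [B' HB'] := Sbound (pi z) t0.
  exact: (L1_bounded_mul (mS2 (pi z) t0) HB' lf).
by split => //; [rewrite -kE|rewrite -kE].
Qed.

(** * Local minima of the smoothed function and their averages *)

Section averages.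
Variables (y : nat -> X) (eta p : R) (f : X -> R).
Hypothesis dense : forall x z, 0 < z -> exists i, d x (y i) < z.
Hypothesis eta0 : 0 < eta.
Hypothesis eta1 : eta <= 2^-1.
Hypothesis p1 : 1 < p.
Hypothesis lf : L1 mu f.

(** After j smoothing steps the regularity scale is eta^(2 j) 2^k; the next kernel acts at eta times
    that scale. Only countably many scales occur, which keeps [local_min_max] measurable. *)
Definition step_scale (k : int) (j : nat) : R := eta ^+ (2 * j).+1 * 2 ^ k.
Local Notation t := step_scale.

Let t0 k j : 0 < t k j.
Proof. by rewrite mulr_gt0 ?exprn_gt0// exprz_gt0. Qed.

Let B k j i := dball d (y i) (eta * t k j / 2).
Let amin k j i := inf [set `|kop mu (S (t k j)) f w| | w in B k j i].
Let E k j := [set w | t k j < rho_maj d rho C3 a w / C3].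

(* Each term is constant on its ball, so it is bounded both by its value at any point
   of the ball and by averages over the ball. *)
Definition local_min_max (z : X) : \bar R :=
  ereal_sup [set (amin i.1.1 i.1.2 i.2 * \1_(B i.1.1 i.1.2 i.2) z * \1_(E i.1.1 i.1.2) z)%:E
    | i in [set: int * nat * nat]].
Local Notation v := local_min_max.

Let amin_ge0 k j i : 0 <= amin k j i.
Proof.
apply: lb_le_inf => [|_ [w _ <-]//]; exists `|kop mu (S (t k j)) f (y i)|, (y i) => //.
by rewrite /B/dball/= (dm_refl DS) divr_gt0// mulr_gt0.
Qed.

Lemma measurable_local_min_max : measurable_fun setT v.
Proof.
apply: measurable_ereal_sup_count => -[[k j] i] /=.
apply/measurable_EFinP; apply: measurable_funM; last first.
  apply: measurable_indic; rewrite /E -[X in measurable X]setTI.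
  apply: (measurable_fun_ltr _ _ measurableT (Y := [set true])) => //.
  by apply: measurable_funM => //; exact: (measurable_rho_maj DS RA).
by apply: measurable_funM => //; apply: measurable_indic; exact: (measurable_dball DS).
Qed.

Lemma local_min_max_ge0 z : (0 <= v z)%E.
Proof.
apply: le_trans (ereal_sup_ubound _); last by exists (0%:Z, 0%N, 0%N).
by rewrite lee_fin mulr_ge0 ?mulr_ge0.
Qed.

Lemma local_min_max_le z : (v z <= Tplus_rho mu rho S f z)%E.
Proof.
apply: ge_ereal_sup => _ [[[k j] i] _ <-] /=.
have Tge := Tplus_rho_ge0 mu S f (rho0 z).
have [zB|zB] := pselect (B k j i z); last by rewrite indicE memNset// mulr0 mul0r.
have [zE|zE] := pselect (E k j z); last by rewrite [X in _ * X]indicE memNset// mulr0.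
rewrite !indicE !mem_set// !mulr1.
apply: (@le_trans _ _ (`|kop mu (S (t k j)) f z|%:E)).
  rewrite lee_fin; apply: ge_inf; last by exists z.
  by exists 0 => _ [w _ <-].
apply: ereal_sup_ubound; exists (t k j) => //=; rewrite t0/=.
apply: lt_le_trans zE _; rewrite ler_pdivrMr// mulrC.
exact: (rho_maj_le DS RA).
Qed.

Lemma local_min_max_ge k j i z : d (y i) z < eta * t k j / 2 ->
  t k j < rho_maj d rho C3 a z / C3 -> ((amin k j i)%:E <= v z)%E.
Proof.
move=> zB zE; apply: ereal_sup_ubound; exists (k, j, i) => //=.
by rewrite !indicE !mem_set// !mulr1.
Qed.

Definition local_min_root (z : X) : \bar R := poweR (v z) p^-1.
Local Notation g := local_min_root.

Lemma local_min_root_ge0 z : (0 <= g z)%E.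
Proof. exact: poweR_ge0. Qed.

Lemma measurable_local_min_root : measurable_fun setT g.
Proof. exact: (measurableT_comp (measurable_poweR _) measurable_local_min_max). Qed.

Lemma local_min_rootX z : poweR (g z) p = v z.
Proof.
rewrite /local_min_root -poweRrM mulVf ?poweRe1 ?local_min_max_ge0//.
by rewrite gt_eqF// (lt_trans ltr01).
Qed.

Variable c1 : R.
Hypothesis c11 : 1 <= c1.
Hypothesis near_rho : forall x z, d x z <= 2 * rho x -> rho x <= c1 * rho z.
Hypothesis eta_c1 : eta * (c1 * C3) <= 1.

(* With w the minimum: w = (w ^ (1/p)) ^ (p - 1) * w ^ (1/p), the first factor being
   estimated by an average of g and the second by g z. *)
Lemma near_bound (x z : X) (k : int) (j i : nat) (G : R) : 0 <= G ->
  2 ^ k < rho x -> d x z <= rho x -> d (y i) z < eta * t k j / 2 ->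
  M g x = G%:E ->
  ((amin k j i)%:E <=
    ((D * 16 `^ n * (D * (8 * ((2 ^ k + d x z) / (eta * t k j))) `^ n) * G) `^ (p - 1))%:E * g z)%E.
Proof.
move=> G0 kr xz zB MG; set T := t k j in zB *; have T0 : 0 < T := t0 k j.
set r : R := 2 ^ k in kr *; have r0 : 0 < r by rewrite exprz_gt0.
have xz0 := dm_ge0 DS x z.
have Tr : T <= eta * r.
  rewrite /T /step_scale exprS -mulrA; apply: ler_wpM2l; first exact: ltW.
  rewrite ler_piMl ?(ltW r0)//; apply: exprn_ile1; first exact: ltW.
  by have := eta1; lra.
have eT : eta * T <= T / 2 by rewrite mulrC; apply: ler_wpM2l => //; exact: ltW.
have eT0 : 0 < eta * T by exact: mulr_gt0.
have Tr2 : T <= r / 2.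
  by apply: le_trans Tr _; rewrite mulrC; apply: ler_wpM2l => //; exact: ltW.
have c10 : 0 < c1 by exact: lt_le_trans c11.
have p0 : 0 < p by exact: lt_trans p1.
set w := amin k j i; have w0 : 0 <= w := amin_ge0 k j i.
(* The whole small ball stays within 2 rho x of x, so rho there is at least rho x / c1; with eta c1
   C3 <= 1 the scale T is then below rho_maj / C3 and the cut-off in [v] is 1. *)
have Bv z' : d (y i) z' < eta * T / 2 -> (w%:E <= v z')%E.
  move=> zB'; apply: local_min_max_ge => //; rewrite -/T.
  have tr := dm_triangle DS z x z'; have tr2 := dm_triangle DS (y i) z z'.
  rewrite (dm_sym DS z (y i)) in tr2.
  have rz : rho x <= c1 * rho z' by apply: near_rho; lra.
  have := rho_le_maj RA z' => rm.
  have h1 : T < rho x / (c1 * C3).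
    apply: le_lt_trans Tr _; rewrite ltr_pdivlMr ?mulr_gt0//.
    apply: le_lt_trans kr; rewrite mulrAC ler_piMl// ltW//.
  apply: lt_le_trans h1 _; rewrite invfM mulrA; apply: ler_wpM2r.
    by rewrite invr_ge0 ltW.
  rewrite ler_pdivrMr// mulrC; apply: le_trans rz _.
  by apply: ler_wpM2l => //; exact: ltW.
have Bg z' : d (y i) z' < eta * T / 2 -> ((w `^ p^-1)%:E <= g z')%E.
  move=> /Bv h; rewrite -poweR_EFin; apply: gt0_ler_poweR => //.
  - by rewrite invr_ge0 ltW.
  - by rewrite in_itv/= lee_fin w0 leey.
  - by rewrite in_itv/= local_min_max_ge0 leey.
set Y := D * 16 `^ n * (D * (8 * ((r + d x z) / (eta * T))) `^ n) * G.
have D0 := doubling_D0 DS.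
have Vy0 : 0 < V (y i) (eta * T / 2) by apply: (Vol_gt0 DS); exact: divr_gt0.
have rho_r : 0 < 2 * (r + d x z) by rewrite mulr_gt0// ltr_wpDr.
have wY : w `^ p^-1 <= Y.
  have h1 : ((w `^ p^-1 * V (y i) (eta * T / 2))%:E <=
      (D * 16 `^ n * V x (2 * (r + d x z)) * G)%:E)%E.
    rewrite [leRHS]EFinM -MG.
    apply: le_trans (ball_integral_le_maxfun DS cov x
      measurable_local_min_root local_min_root_ge0 rho_r).
    apply: (@le_trans _ _ (\int[mu]_(z' in dball d (y i) (eta * T / 2)) g z')%E).
      have mB := measurable_dball DS (y i) (eta * T / 2).
      rewrite EFinM -(measure_dball DS) ?divr_gt0// -integral_cst//.
      apply: ge0_le_integral => //.
      - by move=> z' _; rewrite lee_fin powR_ge0.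
      - exact: (measurable_funTS measurable_local_min_root).
    apply: ge0_subset_integral => //.
    - exact: (measurable_dball DS).
    - exact: (measurable_dball DS).
    - exact: (measurable_funTS measurable_local_min_root).
    - by move=> z' _; exact: local_min_root_ge0.
    - move=> z'; rewrite /dball/= => zB'.
      have tr := dm_triangle DS z x z'; have tr2 := dm_triangle DS (y i) z z'.
      rewrite (dm_sym DS z (y i)) in tr2; lra.
  (* The ball about x of radius 2 (r + d x z) contains the small ball; the distance of the centres
     plus this radius is at most 4 (r + d x z), which is 8 (r + d x z) / (eta T) times the small
     radius eta T / 2. *)
  have h2 : V x (2 * (r + d x z)) <=
      D * (8 * ((r + d x z) / (eta * T))) `^ n * V (y i) (eta * T / 2).
    apply: (le_Vol_ratio DS); first exact: divr_gt0.
      rewrite mulrA ler_pdivlMr// mul1r; lra.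
    rewrite (_ : 8 * _ * _ = 4 * (r + d x z)); last by field; rewrite !gt_eqF.
    have tr := dm_triangle DS z x (y i); rewrite (dm_sym DS z (y i)) in tr; lra.
  rewrite -(ler_pM2r Vy0); move: h1; rewrite lee_fin => /le_trans; apply.
  apply: (@le_trans _ _ (D * 16 `^ n * (D * (8 * ((r + d x z) / (eta * T))) `^ n *
      V (y i) (eta * T / 2)) * G)).
    by apply: ler_wpM2r => //; apply: ler_wpM2l => //; nonneg.
  by rewrite /Y le_eqVlt; apply/orP; left; apply/eqP; ring.
have wE : w = (w `^ p^-1) `^ (p - 1) * w `^ p^-1.
  have pE : p^-1 * (p - 1) + p^-1 = 1 by field; rewrite gt_eqF.
  by rewrite -powRrM -powRD ?pE ?powRr1// oner_eq0.
rewrite [in leLHS]wE EFinM; apply: lee_pmul => //.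
- by rewrite lee_fin powR_ge0.
- by rewrite lee_fin powR_ge0.
- rewrite lee_fin; apply: le_powRl; [by have := p1; lra|exact: powR_ge0|exact: wY].
- exact: Bg.
Qed.

End averages.

(** * One smoothing step and its iteration *)

Section steps.
Variables (y : nat -> X) (eta p c1 : R).
Hypothesis dense : forall x z, 0 < z -> exists i, d x (y i) < z.
Hypothesis eta0 : 0 < eta.
Hypothesis eta1 : eta <= 2^-1.
Hypothesis p1 : 1 < p.
Hypothesis np : n * (p - 1) = e / 8.
Hypothesis c11 : 1 <= c1.
Hypothesis near_rho : forall x z, d x z <= 2 * rho x -> rho x <= c1 * rho z.
Hypothesis eta_c1 : eta * (c1 * C3) <= 1.
Local Notation g := (local_min_root y eta p).

Let Ca := D * 16 `^ n * (D * 8 `^ n).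
(** The loss per step: the scale ratio grows by eta^(-2) each time and enters with the power n (p -
    1) = e / 8. *)
Let Q : R := (eta^-1) `^ (e / 4).

Let Ca0 : 0 < Ca.
Proof. have := doubling_D0 DS => D0; rewrite /Ca; positive. Qed.

(** The ratio (r + d x z) / (eta T) is eta^(-2 (j + 1)) times (r + d x z) / r. The first factor
    produces Q^(j + 1); the second, to the power e / 8, is absorbed by half of the decay of
    [K e]. *)
Let Y_le (x z : X) (r T G : R) (j : nat) : 0 < r -> 0 <= G -> T = eta ^+ (2 * j).+1 * r ->
  (D * 16 `^ n * (D * (8 * ((r + d x z) / (eta * T))) `^ n) * G) `^ (p - 1) * K e x r z <=
  Ca `^ (p - 1) * Q ^+ j.+1 * G `^ (p - 1) * K (e / 2) x r z.
Proof.
move=> r0 G0 ->; have xz0 := dm_ge0 DS x z; have D0 := doubling_D0 DS.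
have rd0 : 0 < r + d x z by rewrite ltr_wpDr.
have ei0 : 0 <= eta^-1 by rewrite invr_ge0 ltW.
rewrite (_ : (r + d x z) / (eta * (eta ^+ (2 * j).+1 * r)) =
    (eta^-1 ^+ 2) ^+ j.+1 * ((r + d x z) / r)); last first.
  rewrite -exprM (_ : (2 * j.+1 = (2 * j).+2)%N); last by rewrite mulnS.
  rewrite exprVn !exprS; have := exprn_gt0 (2 * j) eta0.
  by move: (eta ^+ (2 * j)) => w w0; field; rewrite !gt_eqF.
have u0 : 0 <= (eta^-1 ^+ 2) ^+ j.+1 by nonneg.
have w0 : 0 <= (r + d x z) / r by nonneg.
set m := (eta^-1 ^+ 2) ^+ j.+1 * ((r + d x z) / r).
have m0 : 0 <= m by rewrite /m; exact: mulr_ge0.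
rewrite (powRM n (ler0n R 8) m0) (_ : D * 16 `^ n * (D * _) * G = Ca * m `^ n * G); last first.
  by rewrite /Ca; ring.
have Can0 : 0 <= Ca by exact: ltW.
have mn0 : 0 <= m `^ n by exact: powR_ge0.
rewrite (powRM (p - 1) (mulr_ge0 Can0 mn0) G0) (powRM (p - 1) Can0 mn0).
rewrite -powRrM np /m (powRM (e / 8) u0 w0).
have -> : ((eta^-1 ^+ 2) ^+ j.+1) `^ (e / 8) = Q ^+ j.+1.
  rewrite -powR_expr; last by nonneg.
  congr (_ ^+ _); rewrite /Q -powR_mulrn// -powRrM; congr (_ `^ _); by field.
have key : ((r + d x z) / r) `^ (e / 8) * K e x r z <= K (e / 2) x r z.
  rewrite (kern_split DS e)// mulrA ler_piMl ?kern_ge0//.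
  apply: (@le_trans _ _ (((r + d x z) / r) `^ (e / 2) * (r / (r + d x z)) `^ (e / 2))).
    apply: ler_wpM2r; first exact: powR_ge0.
    apply: ler_powR; last by have := e0; lra.
    by rewrite ler_pdivlMr// mul1r lerDl.
  rewrite -powRM//; last by nonneg.
  by rewrite mulf_div (mulrC r) divff ?powR1// mulf_neq0// gt_eqF.
rewrite [leLHS](_ : _ = Ca `^ (p - 1) * Q ^+ j.+1 * G `^ (p - 1) *
  (((r + d x z) / r) `^ (e / 8) * K e x r z)); last by ring.
by apply: ler_wpM2l => //; rewrite /Q; nonneg.
Qed.

Lemma step_bound : exists CZ : R, 0 < CZ /\
  forall (f phi : X -> R) (x : X) (k : int) (j : nat) (A tau G Ef : R),
  L1 mu f -> 0 <= A -> 0 < tau -> 0 <= G -> 0 <= Ef -> 2 ^ k < rho x ->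
  M (g f) x = G%:E -> EE (e * a) f x = Ef%:E ->
  test_fun d mu e x (2 ^ k) (eta ^+ (2 * j) * 2 ^ k) A phi ->
  exists pi : X -> X, [/\ measurable_fun setT pi,
    forall z, d (pi z) z <= eta * (eta * (eta ^+ (2 * j) * 2 ^ k)) &
    `|Rintegral mu setT (fun z => phi z *
        kop mu (S (eta * (eta ^+ (2 * j) * 2 ^ k))) f (pi z))|
      <= A * (Q ^+ j.+1 * (CZ * (tau + G `^ p + Ef)))].
Proof.
have [K1 [K10 HK1]] := kern_integral DS cov e0.
have e20 : 0 < e / 2 by rewrite divr_gt0.
have [K2 [K20 HK2]] := kern_maxfun DS cov e20.
have [K3 [K30 HK3]] := far_integral e0.
have D0 := doubling_D0 DS.
pose cm : R := 2 `^ (2 * e) * (D * 2 `^ n).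
have cm0 : 0 < cm by rewrite /cm; positive.
pose cf : R := 2 `^ e * (D * 2 `^ n).
have cf0 : 0 < cf by rewrite /cf; positive.
exists (K1 + Ca `^ (p - 1) * K2 + cf * (Cs * cm) * K3); split; first by positive.
move=> f phi x k j A tau G Ef lf A0 tau0 G0 Ef0 kr MG EEf H.
set r : R := 2 ^ k in kr H *; have r0 : 0 < r by rewrite exprz_gt0.
set s := eta ^+ (2 * j) * r in H *; have s0 : 0 < s by rewrite mulr_gt0// exprn_gt0.
set t := eta * s; have t0 : 0 < t by rewrite mulr_gt0.
have tE : t = step_scale eta k j by rewrite /t /s /step_scale exprS mulrA.
have sr : s <= r.
  rewrite /s ler_piMl ?(ltW r0)//; apply: exprn_ile1; first exact: ltW.
  by have := eta1; lra.
have ts : t <= s by rewrite /t ler_piMl ?(ltW s0)//; have := eta1; lra.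
have trho : t <= rho x by apply: le_trans ts _; apply: le_trans sr _; exact: ltW.
have delta0 : 0 < eta * t / 2 by rewrite divr_gt0// mulr_gt0.
(* With delta = eta t / 2 the selection moves points by at most eta t, as [test_fun_smooth] demands,
   and its balls are those of [local_min_max]. *)
have [pi [N [mpi HN piz piN]]] := near_minimizer DS (kop mu (S t) f) delta0 tau0 dense.
have piz' z : d (pi z) z <= eta * t.
  by apply: le_trans (piz z) _; rewrite mulrC divfK.
have pit z : d (pi z) z <= t / 2.
  by apply: le_trans (piz' z) _; rewrite mulrC; apply: ler_wpM2l => //; exact: ltW.
exists pi; split => //.
have [_ l2 _] := pairing_smooth s0 t0 r0 A0 mpi pit H lf.
have mf := L1_measurable lf.
have mg : measurable_fun setT (g f) by exact: measurable_local_min_root.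
have g0 z : (0 <= g f z)%E by exact: local_min_root_ge0.
pose b := Ca `^ (p - 1) * Q ^+ j.+1 * G `^ (p - 1).
have Q0 : 0 < Q by rewrite /Q powR_gt0// invr_gt0.
have b0 : 0 <= b by rewrite /b; nonneg.
pose U z := (\int[mu]_w (K e z t w * `|f w|)%:E)%E.
have U0 z : (0 <= U z)%E by apply: integral_ge0 => w _; rewrite lee_fin; nonneg.
have mU : measurable_fun setT U.
  apply: (measurable_fun_fubini_tonelli_F (fun p : X * X => (K e p.1 t p.2 * `|f p.2|)%:E)).
    apply/measurable_EFinP; apply: measurable_funM; first exact: (measurable_kern DS).
    by apply: measurableT_comp => //; exact: (measurableT_comp mf measurable_snd).
  by move=> p'; rewrite lee_fin; nonneg.
pose T1 z := ((A * tau)%:E * (K e x r z)%:E)%E.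
pose T2 z := ((A * b)%:E * ((K (e / 2) x r z)%:E * g f z))%E.
pose T3 z := ((A * (cf * (Cs * cm)))%:E * ((K e x (rho x) z)%:E * U z))%E.
have T10 z : (0 <= T1 z)%E by rewrite /T1 mule_ge0// lee_fin; nonneg.
have T20 z : (0 <= T2 z)%E.
  by rewrite /T2 mule_ge0 ?mule_ge0// lee_fin; nonneg.
have T30 z : (0 <= T3 z)%E.
  by rewrite /T3 mule_ge0 ?mule_ge0// lee_fin; nonneg.
have mT1 : measurable_fun setT (fun z => (K e x r z)%:E).
  by apply/measurable_EFinP; exact: (measurable_kern DS).
have mT2 : measurable_fun setT (fun z => (K (e / 2) x r z)%:E * g f z)%E.
  by apply: emeasurable_funM => //; apply/measurable_EFinP; exact: (measurable_kern DS).
have mT3 : measurable_fun setT (fun z => (K e x (rho x) z)%:E * U z)%E.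
  by apply: emeasurable_funM => //; apply/measurable_EFinP; exact: (measurable_kern DS).
(* Within distance rho x of x, T1 pays for the slack tau and T2 for the near-minimum, through
   [near_bound]. Beyond it the cut-off by rho may fail, and T3 uses only the size of S, the kernel
   at scale 2^k being dominated there by the one at scale rho x. *)
have pt z : (`|phi z * kop mu (S t) f (pi z)|%:E <= T1 z + T2 z + T3 z)%E.
  have Kr0 := kern_ge0 d mu e x r z.
  rewrite normrM EFinM; have [xz|xz] := leP (d x z) (rho x).
    apply: le_trans (leeDl _ (T30 z)).
    have HNz := HN z; rewrite tE in HNz.
    have hb := near_bound eta0 eta1 p1 c11 near_rho eta_c1 G0 kr xz HNz MG.
    rewrite -tE in hb.
    apply: (@le_trans _ _ ((A * K e x r z)%:E *
        (inf [set `|kop mu (S t) f w| | w in dball d (y (N z)) (eta * t / 2)] + tau)%:E)%E).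
      apply: lee_pmul => //; rewrite lee_fin; first exact: H.1.
      exact: piN.
    rewrite EFinD addeC muleDr//.
    apply: leeD; first by rewrite /T1 -!EFinM lee_fin mulrAC.
    rewrite /T2; apply: le_trans (lee_wpmul2l _ hb) _; first by rewrite lee_fin; nonneg.
    rewrite !muleA; apply: lee_wpmul2r => //; rewrite -!EFinM lee_fin.
    rewrite -[leLHS]mulrA -[leRHS]mulrA; apply: ler_wpM2l => //; rewrite mulrC.
    by apply: Y_le => //; rewrite tE.
  apply: le_trans (leeDr _ _); last by rewrite adde_ge0.
  rewrite /T3 muleA.
  have xr : K e x r z <= cf * K e x (rho x) z.
    have rx := rho0 x; have xz0 := dm_ge0 DS x z.
    apply: (kern_comparison DS) => //; first exact: ltW.
    - by rewrite ler1n.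
    - rewrite ler_pdivrMr ?ltr_wpDr// mulrAC mulrA ler_pdivlMr ?ltr_wpDr//.
      by rewrite mulrC mulrDl mulrDr; nra.
    - by rewrite (dm_refl DS); lra.
  rewrite (_ : (A * _)%:E * _ * _ = (A * (cf * K e x (rho x) z))%:E * ((Cs * cm)%:E * U z))%E; last first.
    by rewrite !muleA -!EFinM; congr (_ * _)%E; congr EFin; ring.
  apply: lee_pmul => //.
    rewrite lee_fin; apply: le_trans (H.1 z) _; exact: ler_wpM2l.
  apply: le_trans (abs_Rintegral_le mu _) _.
    by apply: measurable_funM => //; exact: mS2.
  rewrite /U -ge0_integralZl_EFin//; last 3 first.
  + by move=> w _; rewrite lee_fin; nonneg.
  + apply/measurable_EFinP; apply: measurable_funM; first exact: (measurable_kern DS).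
    exact: measurableT_comp.
  + by nonneg.
  apply: le_lower_integral => // w; rewrite -EFinM lee_fin normrM mulrA.
  apply: ler_wpM2r => //; apply: le_trans (Sb _ _ t0) _; rewrite -mulrA.
  by apply: ler_wpM2l; [exact: ltW|exact: (kern_move_double DS)].
rewrite -lee_fin; apply: le_trans (abs_Rintegral_le mu (L1_measurable l2)) _.
apply: (@le_trans _ _ (\int[mu]_z (T1 z + T2 z + T3 z))%E).
  exact: le_lower_integral.
have mT1' : measurable_fun setT T1 by exact: measurable_funeM.
have mT2' : measurable_fun setT T2 by exact: measurable_funeM.
have mT3' : measurable_fun setT T3 by exact: measurable_funeM.
rewrite ge0_integralD//; [|by move=> z _; exact: adde_ge0|exact: emeasurable_funD].
rewrite ge0_integralD//.
have QQ : 1 <= Q ^+ j.+1.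
  apply: exprn_ege1; apply: powR_ge1; last by have := e0; lra.
  by rewrite invf_ge1//; have := eta1; lra.
have I1 : (\int[mu]_z T1 z <= (A * tau * K1)%:E)%E.
  rewrite /T1 ge0_integralZl_EFin//; last 2 first.
  - by move=> z _; rewrite lee_fin kern_ge0.
  - by nonneg.
  by rewrite [leRHS]EFinM; apply: lee_wpmul2l; [rewrite lee_fin; nonneg|exact: HK1].
have I2 : (\int[mu]_z T2 z <= (A * b * (K2 * G))%:E)%E.
  rewrite /T2 ge0_integralZl_EFin//; last 2 first.
  - by move=> z _; rewrite mule_ge0// lee_fin kern_ge0.
  - by nonneg.
  rewrite [leRHS]EFinM; apply: lee_wpmul2l; first by rewrite lee_fin; nonneg.
  by rewrite EFinM -MG; exact: HK2.
have I3 : (\int[mu]_z T3 z <= (A * (cf * (Cs * cm)) * (K3 * Ef))%:E)%E.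
  rewrite /T3 ge0_integralZl_EFin//; last 2 first.
  - by move=> z _; rewrite mule_ge0// lee_fin kern_ge0.
  - by nonneg.
  rewrite [leRHS]EFinM; apply: lee_wpmul2l; first by rewrite lee_fin; nonneg.
  by rewrite EFinM -EEf; exact: HK3.
apply: le_trans (leeD (leeD I1 I2) I3) _; rewrite -!EFinD lee_fin.
have GE : G `^ p = G `^ (p - 1) * G.
  have [->|Gn0] := eqVneq G 0; first by rewrite mulr0 powR0// gt_eqF// (lt_trans ltr01).
  transitivity (G `^ (p - 1 + 1)); first by rewrite subrK.
  by rewrite powRD ?Gn0 ?implybT// powRr1.
have Gp0 := powR_ge0 G p.
rewrite (_ : _ + _ = A * (tau * K1 + Q ^+ j.+1 * (Ca `^ (p - 1) * K2 * G `^ p) +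
  cf * (Cs * cm) * K3 * Ef)); last by rewrite /b GE; ring.
apply: ler_wpM2l => //.
have c20 : 0 <= Ca `^ (p - 1) * K2 by nonneg.
have c30 : 0 <= cf * (Cs * cm) * K3 by nonneg.
move: QQ Gp0 c20 c30; move: (Q ^+ _) (G `^ p) (Ca `^ _ * K2) (cf * (Cs * cm) * K3).
move=> q u v w q1 u0 v0 w0; have K10' := ltW K10; have tau0' := ltW tau0.
apply: (@le_trans _ _ (q * (tau * K1 + v * u + w * Ef))).
  rewrite !mulrDr; apply: lerD; [apply: lerD => //|]; by rewrite ler_peMl ?mulr_ge0.
apply: ler_wpM2l; first by lra.
rewrite -subr_ge0 (_ : _ - _ = K1 * u + K1 * Ef + v * tau + v * Ef + w * tau + w * u); last by ring.
by nonneg.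
Qed.

(** Unlike [Grho] it tests one fixed exponent e, with [kern] bounds and no closure condition, so
    that the class is stable under smoothing. *)
Definition grand_max (f : X -> R) (x : X) : \bar R :=
  ereal_sup [set `|Rintegral mu setT (fun z => f z * phi z)|%:E | phi in
    [set phi | exists r, 0 < r < rho x /\ test_fun d mu e x r r 1 phi]].

Let test_fun_integrable (f phi : X -> R) (x : X) (r s A : R) : 0 < r -> 0 < s -> 0 <= A ->
  L1 mu f -> test_fun d mu e x r s A phi -> L1 mu (fun z => phi z * f z) /\
  `|Rintegral mu setT (fun z => phi z * f z)| <=
    A * ((V x r)^-1 * fine (\int[mu]_z `|f z|%:E)%E).
Proof.
move=> r0 s0 A0 lf H; have mphi := test_fun_measurable DS e0 s0 A0 H.
have V0 : 0 <= (V x r)^-1 by rewrite invr_ge0 (Vol_ge0 d mu).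
have hb z : `|phi z| <= A * (V x r)^-1.
  apply: le_trans (H.1 z) _; apply: ler_wpM2l => //.
  by apply: (kern_le_Vol DS) => //; exact: ltW.
have l := L1_bounded_mul mphi hb lf; split => //.
rewrite -lee_fin; apply: le_trans (abs_Rintegral_le mu (L1_measurable l)) _.
rewrite mulrA [leRHS]EFinM fineK; last by rewrite ge0_fin_numE ?integral_ge0//; exact: L1_fin.
have mf := L1_measurable lf.
rewrite -ge0_integralZl_EFin//; last 2 first.
- by apply/measurable_EFinP; exact: measurableT_comp.
- by nonneg.
apply: le_lower_integral => // z; rewrite lee_fin normrM.
by apply: ler_wpM2r.
Qed.

(** Each step multiplies the norm of the remaining test function by at most q^2 and the cost by Q =
    1 / q, so the contributions form a geometric series of ratio q and the remainder after N steps
    is a multiple of q^N. *)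
Lemma grand_max_pointwise (CT : R) : 0 < CT ->
  (forall (x : X) (r s A : R) (pi : X -> X) (phi : X -> R), 0 < s -> s <= r -> 0 <= A ->
    measurable_fun setT pi -> (forall z, d (pi z) z <= eta * (eta * s)) ->
    test_fun d mu e x r s A phi ->
    test_fun d mu e x r (eta ^+ 2 * s) (CT * eta `^ e * A)
      (fun z => phi z - kern_smooth mu S (eta * s) pi phi z)) ->
  CT * eta `^ (e / 2) <= 1 ->
  exists C : R, 0 < C /\ forall (f : X -> R) (x : X), L1 mu f ->
  (grand_max f x <= C%:E * (poweR (M (g f) x) p + EE (e * a) f x))%E.
Proof.
move=> CT0 HT CTe; have [CZ [CZ0 HZ]] := step_bound.
have e40 : 0 < e / 4 by rewrite divr_gt0.
pose q : R := eta `^ (e / 4); have q0 : 0 < q by rewrite powR_gt0.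
have q1 : q < 1 by apply: powR_lt1 => //; rewrite (ltW eta0)/=; have := eta1; lra.
have ei0 : 0 <= eta^-1 by rewrite invr_ge0 ltW.
have qQ : q * Q = 1 by rewrite /q /Q -powRM ?(ltW eta0)// mulfV ?gt_eqF// powR1.
have Q0 : 0 < Q by rewrite /Q powR_gt0// invr_gt0.
(* Half of the gain, eta^(e / 2), pays for the constant CT; the other half is q^2. *)
have thetaq : CT * eta `^ e <= q ^+ 2.
  rewrite (_ : eta `^ e = eta `^ (e / 2) * q ^+ 2).
    by rewrite mulrA ler_piMl// exprn_ge0// ltW.
  rewrite /q -powR_mulrn ?powR_ge0// -powRrM -powRD; last by rewrite (gt_eqF eta0) implybT.
  by congr (_ `^ _); field.
have thetaQ : CT * eta `^ e * Q <= q.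
  by rewrite -[leRHS]mulr1 -qQ mulrA -expr2; apply: ler_wpM2r => //; exact: ltW.
have q10 : 0 < 1 - q by rewrite subr_gt0.
pose C := 2 `^ e * (Q * (CZ / (1 - q))).
have C0 : 0 < C by rewrite /C; positive.
exists C; split => // f x lf.
have M0 : (0 <= M (g f) x)%E.
  apply: (maxfun_ge0 DS) => [|z]; first exact: (cf_gt0 cov).
  exact: local_min_root_ge0.
have E0 : (0 <= EE (e * a) f x)%E by exact: Eop_ge0.
case EM : (M (g f) x) M0 => [G| |//]; last first.
  move=> _; rewrite poweRyr; last by rewrite gt_eqF// (lt_trans ltr01).
  by rewrite addye ?gt0_muley ?lte_fin ?leey// gt_eqF// (lt_le_trans _ E0)// ltNye.
rewrite lee_fin => G0.
case EF : (EE (e * a) f x) E0 => [Ef| |//]; last first.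
  move=> _; rewrite poweR_EFin addey// gt0_muley ?lte_fin// leey//.
rewrite lee_fin => Ef0; rewrite poweR_EFin -EFinD -EFinM.
apply: ge_ereal_sup => _ [phi [r [/andP[r0 rr] H]] <-].
(* [local_min_max] knows only dyadic initial scales; replacing r by 2^k costs the factor 2^e in the
   norm of phi. *)
have [k /andP[kr rk]] := dyadic_bracket r0.
have k0 : 0 < 2 ^ k :> R by rewrite exprz_gt0.
have rk2 : r <= 2 * 2 ^ k by move: rk; rewrite expfzDr// expr1z mulrC => /ltW.
have two0 : 0 <= 2 `^ e :> R by exact: powR_ge0.
have H' : test_fun d mu e x (2 ^ k) (eta ^+ (2 * 0) * 2 ^ k) (2 `^ e) phi.
  rewrite muln0 expr0 mul1r; split => [z|z z' zz].
    apply: le_trans (H.1 z) _; rewrite mul1r.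
    by apply: (kern_scale DS) => //; exact: ltW.
  have zr : d z z' <= r / 2.
    by apply: le_trans zz _; apply: ler_wpM2r => //; rewrite invr_ge0.
  apply: le_trans (H.2 z z' zr) _; rewrite mul1r mulrAC mulrC.
  have zz0 := dm_ge0 DS z z'; apply: ler_pM; rewrite ?powR_ge0 ?kern_ge0//.
    by apply: (kern_scale DS) => //; exact: ltW.
  apply: le_powRl; first exact: ltW.
    by rewrite divr_ge0// ltW.
  by apply: ler_wpM2l => //; rewrite lef_pV2 ?posrE.
set I1 := fine (\int[mu]_z `|f z|%:E)%E.
have I10 : 0 <= I1 by apply: fine_ge0; exact: integral_ge0.
pose F := (V x (2 ^ k))^-1 * I1.
have F0 : 0 <= F by rewrite /F mulr_ge0// invr_ge0 (Vol_ge0 d mu).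
(* Induction on the number N of remaining steps, with the position j, the norm A and the test
   function generalised. At N = 0 the crude bound |f|_1 / V x 2^k is used. *)
have iter : forall (N j : nat) (A tau : R) (psi : X -> R), 0 <= A -> 0 < tau ->
    test_fun d mu e x (2 ^ k) (eta ^+ (2 * j) * 2 ^ k) A psi ->
    `|Rintegral mu setT (fun z => psi z * f z)| <=
      A * (Q ^+ j.+1 * (CZ * (tau + G `^ p + Ef) / (1 - q) + q ^+ N * F)).
  have Q1 : 1 <= Q.
    apply: powR_ge1; last exact: ltW.
    by rewrite invf_ge1//; have := eta1; lra.
  elim=> [|N ih] j A tau psi A0 tau0 Hpsi.
    have s0 : 0 < eta ^+ (2 * j) * 2 ^ k by rewrite mulr_gt0// exprn_gt0.
    have [_ /le_trans] := test_fun_integrable k0 s0 A0 lf Hpsi; apply.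
    apply: ler_wpM2l => //; rewrite expr0 mul1r -/I1 -/F.
    have Z0 : 0 <= CZ * (tau + G `^ p + Ef) / (1 - q) by nonneg.
    apply: (@le_trans _ _ (1 * (CZ * (tau + G `^ p + Ef) / (1 - q) + F))).
      by rewrite mul1r lerDr.
    by apply: ler_wpM2r; [exact: addr_ge0|exact: exprn_ege1].
  have s0 : 0 < eta ^+ (2 * j) * 2 ^ k by rewrite mulr_gt0// exprn_gt0.
  have kx : 2 ^ k < rho x by exact: le_lt_trans rr.
  have [pi [mpi piz hstep]] := HZ f psi x k j A tau G Ef lf A0 tau0 G0 Ef0 kx EM EF Hpsi.
  have sk : eta ^+ (2 * j) * 2 ^ k <= 2 ^ k.
    rewrite ler_piMl ?(ltW k0)//; apply: exprn_ile1; first exact: ltW.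
    by have := eta1; lra.
  set s := eta ^+ (2 * j) * 2 ^ k in s0 piz hstep sk Hpsi *.
  have es0 : 0 < eta * s by rewrite mulr_gt0.
  have pit z : d (pi z) z <= eta * s / 2.
    by apply: le_trans (piz z) _; rewrite mulrC; apply: ler_wpM2l => //; exact: ltW.
  have [l1 _ E1] := pairing_smooth s0 es0 k0 A0 mpi pit Hpsi lf.
  have Hd := HT x (2 ^ k) s A pi psi s0 sk A0 mpi piz Hpsi.
  rewrite {1}/s mulrA -exprD (_ : 2 + 2 * j = 2 * j.+1)%N in Hd; last by rewrite mulnS.
  have [l2 _] := test_fun_integrable k0 s0 A0 lf Hpsi.
  have ih' := ih _ _ _ _ _ tau0 Hd.
  have -> : Rintegral mu setT (fun z => psi z * f z) =
      Rintegral mu setT (fun z => (psi z - kern_smooth mu S (eta * s) pi psi z) * f z) +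
      Rintegral mu setT (fun z => psi z * kop mu (S (eta * s)) f (pi z)).
    rewrite -E1; under [X in _ = X + _]eq_Rintegral do rewrite mulrBl.
    by rewrite (RintegralB measurableT l2 l1) subrK.
  apply: le_trans (ler_normD _ _) _.
  have tA0 : 0 <= CT * eta `^ e * A by nonneg.
  apply: le_trans (lerD (ih' tA0) hstep) _.
  set Z := CZ * (tau + G `^ p + Ef); have Z0 : 0 <= Z by rewrite /Z; nonneg.
  rewrite (exprS Q j.+1) (exprS q N).
  have P0 : 0 <= Q ^+ j.+1 by nonneg.
  have qN0 : 0 <= q ^+ N by nonneg.
  have ZE : Z = (1 - q) * (Z / (1 - q)) by field; rewrite gt_eqF.
  have ZZ0 : 0 <= Z / (1 - q) by nonneg.
  rewrite [X in _ + X](_ : _ = A * (Q ^+ j.+1 * ((1 - q) * (Z / (1 - q))))); last by rewrite -ZE.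
  move: (Z / (1 - q)) (q ^+ N) (Q ^+ j.+1) P0 qN0 ZZ0 => W u P P0 u0 W0.
  rewrite [leLHS](_ : _ = A * (P * (CT * eta `^ e * Q * (W + u * F) + (1 - q) * W))); last by ring.
  apply: ler_wpM2l => //; apply: ler_wpM2l => //.
  have WF0 : 0 <= W + u * F by nonneg.
  apply: le_trans (lerD (ler_wpM2r WF0 thetaQ) (lexx _)) _.
  by rewrite le_eqVlt; apply/orP; left; apply/eqP; ring.
rewrite lee_fin; under eq_Rintegral do rewrite mulrC.
apply/ler_addgt0Pr => z z0.
have z20 : 0 < z / 2 by rewrite divr_gt0.
(* N and tau may depend on f, x and phi, because C does not: one half of z absorbs the remainder q^N
   F and the other half the slack tau. The added 1 keeps b positive. *)
pose b := 2 `^ e * Q * (F + 1).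
have b0 : 0 < b.
  have F1 : 0 < F + 1 by rewrite ltr_wpDl.
  by rewrite /b; positive.
have [N HN] : exists N, q ^+ N <= z / 2 / b.
  have aq : `|q| < 1 by rewrite gtr0_norm.
  have [N _ HN] := (cvgrPdist_le _ _).1 (cvg_expr aq) (z / 2 / b) ltac:(by rewrite divr_gt0).
  exists N; have := HN N (leqnn N); rewrite /= sub0r normrN; apply: le_trans.
  exact: ler_norm.
have tau0 : 0 < z / 2 / C by rewrite divr_gt0.
apply: le_trans (iter N 0%N (2 `^ e) (z / 2 / C) phi two0 tau0 H') _.
rewrite expr1.
have h1 : 2 `^ e * Q * (q ^+ N * F) <= z / 2.
  apply: (@le_trans _ _ (2 `^ e * Q * ((F + 1) * (z / 2 / b)))); last first.
    by rewrite mulrA -/b mulrC divfK ?gt_eqF.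
  apply: ler_wpM2l; first by nonneg.
  rewrite mulrC; apply: ler_pM => //; first by nonneg.
  by rewrite lerDl.
rewrite [leLHS](_ : _ = C * (G `^ p + Ef) + C * (z / 2 / C) + 2 `^ e * Q * (q ^+ N * F)); last first.
  by rewrite /C; ring.
have -> : C * (z / 2 / C) = z / 2 by rewrite mulrC divfK ?gt_eqF.
by rewrite -addrA; apply: lerD => //; rewrite [leRHS]splitr; apply: lerD.
Qed.

End steps.

Lemma grand_max_integral : exists C : R, 0 < C /\ forall f : X -> R, L1 mu f ->
  (\int[mu]_x grand_max f x <=
    C%:E * (\int[mu]_x Tplus_rho mu rho S f x + \int[mu]_x `|f x|%:E))%E.
Proof.
have [CT [CT0 HT]] := test_fun_smooth DS cov e0 Cs0 SG.
have [[x0 _]|X0] := pselect (exists x0 : X, True); last first.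
  have T0 : setT = set0 :> set X by apply/seteqP; split => // x _; apply: X0; exists x.
  by exists 1; split => // f _; rewrite T0 !integral_set0 adde0 mule0.
(* p is fixed before eta, with n (p - 1) = e / 8, so the loss exponent e / 4 does not depend on
   eta. *)
have n0 := ds_n0 DS; pose p := 1 + e / 8 / n.
have p1 : 1 < p by rewrite ltrDl !divr_gt0.
have np : n * (p - 1) = e / 8 by rewrite /p; field; rewrite gt_eqF.
have [c1 [c11 near_rho]] := admissible_near DS RA (ler0n R 2).
have [y dense] := separable DS x0.
have c10 : 0 < c1 by exact: lt_le_trans c11.
have e20 : 0 < e / 2 by rewrite divr_gt0.
pose u := CT^-1 `^ (e / 2)^-1.
have u0 : 0 < u by rewrite powR_gt0// invr_gt0.
(* The three constraints serve, in order, the geometry of a smoothing step, the contraction CT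
   eta^(e / 2) <= 1, and the cut-off by rho on small balls. *)
pose eta := Num.min 2^-1 (Num.min u (c1 * C3)^-1).
have eta0 : 0 < eta by rewrite !lt_min u0 !invr_gt0 ltr0n mulr_gt0.
have eta1 : eta <= 2^-1 by rewrite ge_min lexx.
have etau : eta <= u by rewrite !ge_min lexx orbT.
have eta_c1 : eta * (c1 * C3) <= 1.
  by rewrite -ler_pdivlMr ?mulr_gt0// mul1r !ge_min lexx !orbT.
have CTe : CT * eta `^ (e / 2) <= 1.
  rewrite mulrC -ler_pdivlMr// mul1r.
  apply: le_trans (le_powRl (ltW e20) (ltW eta0) etau) _.
  by rewrite /u -powRrM mulVf ?gt_eqF// powRr1// invr_ge0 ltW.
have [C1 [C10 H1]] := grand_max_pointwise dense eta0 eta1 p1 np c11 near_rho eta_c1 CT0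
  (fun x r s A pi phi => HT x r s eta A pi phi eta0 eta1) CTe.
have [C2 [C20 H2]] := maxfun_strong_type DS bc (cf_gt0 cov) p1.
have ea0 : 0 < e * a by rewrite mulr_gt0//; have /andP[] := a01.
have [C4 [C40 H4]] := Eop_integral DS RA ea0.
exists (C1 * (C2 + C4)); split; first by positive.
move=> f lf; have mf := L1_measurable lf.
pose g := local_min_root y eta p f.
have mg : measurable_fun setT g by exact: measurable_local_min_root.
have g0 z : (0 <= g z)%E by exact: local_min_root_ge0.
have mM : measurable_fun setT (fun x => poweR (M g x) p).
  exact: (measurableT_comp (measurable_poweR p) (measurable_maxfun DS bc br g)).
have mE : measurable_fun setT (EE (e * a) f) by exact: (measurable_Eop DS RA).
have Tge x := Tplus_rho_ge0 mu S f (rho0 x).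
apply: (@le_trans _ _ (C1%:E * \int[mu]_x (poweR (M g x) p + EE (e * a) f x))%E).
  rewrite -ge0_integralZl_EFin//; last 3 first.
  - by move=> x _; rewrite adde_ge0 ?poweR_ge0 ?Eop_ge0.
  - exact: emeasurable_funD.
  - exact: ltW.
  apply: le_lower_integral => x; last exact: H1.
  have x0' := rho0 x; apply: le_trans (ereal_sup_ubound _); last first.
    exists (cst 0) => //; exists (rho x / 2); split.
      by rewrite divr_gt0//= ltr_pdivrMr//; lra.
    split => [z|z z' _]; first by rewrite /= normr0 mul1r kern_ge0.
    by rewrite /= subrr normr0; nonneg.
  by rewrite lee_fin.
rewrite EFinM -muleA; apply: lee_wpmul2l; first by rewrite lee_fin ltW.
rewrite ge0_integralD//; last 2 first.
- by move=> x _; exact: poweR_ge0.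
- by move=> x _; exact: Eop_ge0.
have I1 : (\int[mu]_x poweR (M g x) p <= C2%:E * \int[mu]_x Tplus_rho mu rho S f x)%E.
  apply: le_trans (H2 g mg g0) _; apply: lee_wpmul2l; first by rewrite lee_fin ltW.
  apply: le_lower_integral => x; first exact: poweR_ge0.
  by rewrite /g local_min_rootX//; exact: local_min_max_le.
have T0 : (0 <= \int[mu]_x Tplus_rho mu rho S f x)%E by exact: integral_ge0.
have F0 : (0 <= \int[mu]_x `|f x|%:E)%E by exact: integral_ge0.
apply: le_trans (leeD I1 (H4 f mf)) _.
rewrite [leRHS]muleDr ?ge0_adde_def ?inE//; apply: leeD; apply: lee_wpmul2r => //; rewrite lee_fin.
- by rewrite lerDl ltW.
- by rewrite lerDr ltW.
Qed.

End grand_maximal.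

(** * The bump kernel and test functions *)


Section bump_kernel.
Context (R : realType) dsp (X : measurableType dsp) (d : X -> X -> R)
  (mu : {sigma_finite_measure set X -> \bar R}) (D n : R).
Hypothesis DS : doubling_space d mu D n.
Local Notation V := (Vol d mu).
Local Notation K := (kern d mu).

(* Equal to 1 on the ball of radius t and to 0 outside the ball of radius 2 t. *)
Definition bump (t : R) (z y : X) : R := Num.min 1 (Num.max 0 (2 - d z y / t)).

Lemma bump_ge0 t z y : 0 <= bump t z y.
Proof. by rewrite /bump le_min ler01 le_max lexx. Qed.

Lemma bump_le1 t z y : bump t z y <= 1.
Proof. by rewrite /bump ge_min lexx. Qed.

Lemma bump_near t z y : 0 < t -> d z y <= t -> bump t z y = 1.
Proof.
move=> t0 zy; have q : d z y / t <= 1 by rewrite ler_pdivrMr// mul1r.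
by rewrite /bump max_r ?min_l//; lra.
Qed.

Lemma bump_far t z y : 0 < t -> 2 * t <= d z y -> bump t z y = 0.
Proof.
move=> t0 zy; have q : 2 <= d z y / t by rewrite ler_pdivlMr.
by rewrite /bump max_l ?min_r//; lra.
Qed.

Lemma bump_sym t z y : bump t z y = bump t y z.
Proof. by rewrite /bump (dm_sym DS). Qed.

Lemma bump_lipschitz t z z' y : 0 < t -> `|bump t z y - bump t z' y| <= d z z' / t.
Proof.
move=> t0; have T1 := dm_triangle DS z z' y; have T2 := dm_triangle DS z' z y.
rewrite (dm_sym DS z' z) in T1.
have q1 : d z' y / t <= d z z' / t + d z y / t.
  by rewrite -mulrDl; apply: ler_wpM2r => //; rewrite invr_ge0 ltW.
have q2 : d z y / t <= d z z' / t + d z' y / t.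
  by rewrite -mulrDl; apply: ler_wpM2r => //; rewrite invr_ge0 ltW.
by rewrite ler_norml; apply: clamp_lipschitz; lra.
Qed.

Lemma measurable_bump t : measurable_fun setT (fun p : X * X => bump t p.1 p.2).
Proof.
apply: measurable_minr => //; apply: measurable_maxr => //.
apply: measurable_funB => //; apply: measurable_funM => //.
exact: (measurable_dist2 DS).
Qed.

Let mb t y : measurable_fun setT (fun w => bump t w y).
Proof. exact: (measurableT_comp (measurable_bump t) (pair2_measurable y)). Qed.

Definition bump_mass (t : R) (y : X) : R := Rintegral mu setT (fun w => bump t w y).

Let indic_ball (y : X) (s : R) : 0 < s ->
  (\int[mu]_w (\1_(dball d y s) w)%:E = (V y s)%:E)%E.
Proof.
move=> s0; rewrite integral_indic//; last exact: (measurable_dball DS).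
by rewrite setIT (measure_dball DS).
Qed.

Lemma bump_integrable t y : 0 < t -> L1 mu (fun w => bump t w y).
Proof.
move=> t0; have t20 : 0 < 2 * t by rewrite mulr_gt0.
have [] := @Rintegral_dominated _ _ _ mu (fun w => bump t w y)
  (fun w => \1_(dball d y (2 * t)) w) (V y (2 * t)) => //; last by rewrite indic_ball.
move=> w; rewrite ger0_norm ?bump_ge0// indicE.
have [wy|wy] := ltP (d y w) (2 * t).
  by rewrite mem_set// bump_le1.
by rewrite bump_far// (dm_sym DS).
Qed.

Lemma le_bump_mass t y : 0 < t -> V y t <= bump_mass t y.
Proof.
move=> t0; rewrite -lee_fin /bump_mass Rintegral_EFin; last exact: bump_integrable.
rewrite -indic_ball//; apply: le_lower_integral => w; rewrite lee_fin//.
rewrite indicE; case: (boolP (w \in _)) => [|_]; last exact: bump_ge0.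
by rewrite inE /dball/= => yw; rewrite bump_near// (dm_sym DS) ltW.
Qed.

Lemma bump_mass_gt0 t y : 0 < t -> 0 < bump_mass t y.
Proof. by move=> t0; apply: lt_le_trans (le_bump_mass y t0); exact: (Vol_gt0 DS). Qed.

Lemma bump_mass_lipschitz t y y' : 0 < t -> d y y' <= t / 2 ->
  `|bump_mass t y - bump_mass t y'| <= d y y' / t * V y (3 * t).
Proof.
move=> t0 yy; have t30 : 0 < 3 * t by rewrite mulr_gt0.
have yy0 : 0 <= d y y' / t by rewrite divr_ge0 ?(dm_ge0 DS)// ltW.
have l1 := bump_integrable y t0; have l2 := bump_integrable y' t0.
rewrite /bump_mass -(RintegralB measurableT l1 l2).
have [] := @Rintegral_dominated _ _ _ mu (fun w => bump t w y - bump t w y')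
  (fun w => d y y' / t * \1_(dball d y (3 * t)) w) (d y y' / t * V y (3 * t)) => //.
- exact: measurable_funB.
- move=> w; rewrite indicE; have [wy|wy] := ltP (d y w) (3 * t).
    by rewrite mem_set// mulr1 !(bump_sym t w); exact: bump_lipschitz.
  have T := dm_triangle DS y' y w.
  have f1 : bump t w y = 0 by apply: bump_far => //; rewrite (dm_sym DS w y); lra.
  have f2 : bump t w y' = 0 by apply: bump_far => //; rewrite (dm_sym DS w y'); lra.
  by rewrite f1 f2 subrr normr0 mulr_ge0.
- under eq_integral do rewrite EFinM.
  rewrite ge0_integralZl_EFin//.
  + by rewrite indic_ball// -EFinM.
  + by apply/measurable_EFinP; apply: measurable_indic; exact: (measurable_dball DS).
Qed.

(** Dividing by the mass at y makes the columns integrate to 1, as [gk_integral] asks; the price is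
    that regularity in y also involves the mass. *)
Definition bump_kernel (t : R) (z y : X) : R := bump t z y / bump_mass t y.

Lemma measurable_bump_kernel t : 0 < t ->
  measurable_fun setT (fun p : X * X => bump_kernel t p.1 p.2).
Proof.
move=> t0; apply: measurable_funM; first exact: measurable_bump.
have mm : measurable_fun setT (bump_mass t).
  apply: (measurableT_comp (fine_measurable measurableT)).
  apply: (measurable_fun_fubini_tonelli_G (fun p : X * X => (bump t p.1 p.2)%:E)).
    by apply/measurable_EFinP; exact: measurable_bump.
  by move=> p; rewrite lee_fin bump_ge0.
exact: (measurable_fun_inv (measurableT_comp mm measurable_snd)).
Qed.

Lemma bump_kernel_integral t y : 0 < t -> Rintegral mu setT (fun z => bump_kernel t z y) = 1.
Proof.
move=> t0; under eq_Rintegral do rewrite /bump_kernel mulrC.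
by rewrite (RintegralZl _ measurableT (bump_integrable y t0)) mulVf// gt_eqF// bump_mass_gt0.
Qed.

Lemma inv_Vol_le_kern (g t : R) (z y : X) : 0 <= g -> 0 < t -> d z y <= 3 * t ->
  (V y t)^-1 <= 4 `^ g * (D * 7 `^ n) * K g z t y.
Proof.
move=> g0 t0 zy; have zy0 := dm_ge0 DS z y.
have -> : (V y t)^-1 = K g y t y.
  by rewrite kern.unlock (dm_refl DS) addr0 divff ?powR1 ?mul1r// gt_eqF.
apply: (kern_comparison DS) => //.
- by rewrite ler1n.
- rewrite (dm_refl DS) addr0 divff ?gt_eqF// mulrA ler_pdivlMr ?ltr_wpDr//; lra.
- by rewrite (dm_refl DS); lra.
Qed.

(** Even after a displacement by t / 2 everything vanishes for d z y > 3 t, and inside that range 1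
    / V y t is comparable with a kernel of any decay. The Lipschitz bounds imply the Hölder bounds
    since d / t <= 1 / 2 and e <= 1. *)
Lemma bump_kernel_good (e : R) : 0 < e <= 1 -> exists Cs : R, 0 < Cs /\
  good_kernel d mu bump_kernel e Cs.
Proof.
move=> /andP[e0 e1]; have D0 := doubling_D0 DS; have D1 := ds_D1 DS.
have n0 := ds_n0 DS.
pose cK : R := 4 `^ (2 * e) * (D * 7 `^ n).
have cK0 : 0 < cK by rewrite /cK; positive.
pose cV : R := D * 3 `^ n * (D * 2 `^ n).
have cV0 : 0 < cV by rewrite /cV; positive.
exists ((1 + cV) * cK); split; first by positive.
suff main (t : R) (z z' y y' : X) : 0 < t ->
    [/\ `|bump_kernel t z y| <= (1 + cV) * cK * K (2 * e) z t y,
      d z z' <= t / 2 -> `|bump_kernel t z y - bump_kernel t z' y| <=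
        (1 + cV) * cK * (d z z' / t) `^ e * K (2 * e) z t y &
      d y y' <= t / 2 -> `|bump_kernel t z y - bump_kernel t z y'| <=
        (1 + cV) * cK * (d y y' / t) `^ e * K (2 * e) z t y].
  split; [exact: measurable_bump_kernel|..|exact: bump_kernel_integral].
  - by move=> t z y t0; have [] := main t z z y y t0.
  - by move=> t z z' y t0; have [] := main t z z' y y t0.
  - by move=> t z y y' t0; have [] := main t z z y y' t0.
move=> t0; have zy0 := dm_ge0 DS z y; have zz0 := dm_ge0 DS z z'; have yy0 := dm_ge0 DS y y'.
have KV : d z y <= 3 * t -> (V y t)^-1 <= cK * K (2 * e) z t y.
  by apply: inv_Vol_le_kern => //; rewrite mulr_ge0// ltW.
have K0 := kern_ge0 d mu (2 * e) z t y.
have Vy := Vol_gt0 DS y t0.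
have my := bump_mass_gt0 y t0.
have mVi : (bump_mass t y)^-1 <= (V y t)^-1 by rewrite lef_pV2 ?posrE// le_bump_mass.
have bm w : `|bump_kernel t w y| <= (V y t)^-1.
  rewrite ger0_norm; last by rewrite divr_ge0 ?bump_ge0// ltW.
  rewrite -[leRHS]mul1r; apply: ler_pM; rewrite ?bump_ge0 ?bump_le1 ?invr_ge0//.
  exact: ltW.
have pw u : 0 <= u <= 2^-1 -> u <= u `^ e.
  move=> /andP[u0 u1]; have [->|un] := eqVneq u 0; first exact: powR_ge0.
  rewrite -[leLHS]powRr1//; apply: ger_powR => //.
  by rewrite lt0r un u0/=; lra.
have q2 u : 0 <= u -> u <= t / 2 -> 0 <= u / t <= 2^-1.
  move=> u0 ut; rewrite divr_ge0 ?(ltW t0)//=.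
  by rewrite ler_pdivrMr// mulrC.
split.
- have [zy|zy] := leP (d z y) (3 * t); last first.
    by rewrite /bump_kernel bump_far ?mul0r ?normr0//; [nonneg|lra].
  apply: le_trans (bm z) _; apply: le_trans (KV zy) _.
  apply: ler_wpM2r => //; rewrite ler_peMl ?(ltW cK0)//; lra.
- move=> zz; have [zy|zy] := leP (d z y) (3 * t); last first.
    have T := dm_triangle DS z' z y.
    rewrite /bump_kernel !bump_far ?mul0r ?subrr ?normr0//; [nonneg|lra|lra].
  rewrite /bump_kernel -mulrBl normrM (ger0_norm (x := _^-1)) ?invr_ge0 ?(ltW my)//.
  have h1 := le_trans (bump_lipschitz z z' y t0) (pw _ (q2 _ zz0 zz)).
  apply: (@le_trans _ _ ((d z z' / t) `^ e * (cK * K (2 * e) z t y))).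
    apply: ler_pM => //; first by rewrite invr_ge0 ltW.
    by apply: le_trans mVi _; exact: KV.
  rewrite [leRHS](_ : _ = (1 + cV) * ((d z z' / t) `^ e * (cK * K (2 * e) z t y))); last by ring.
  by rewrite ler_peMl; [|nonneg|lra].
- move=> yy; have [zy|zy] := leP (d z y) (3 * t); last first.
    have T := dm_triangle DS y' z y; rewrite (dm_sym DS y' y) in T.
    rewrite /bump_kernel !bump_far ?mul0r ?subrr ?normr0//; [nonneg|lra|lra].
  have my' := bump_mass_gt0 y' t0.
  have Vy' := Vol_gt0 DS y' t0.
  (* The quotient rule separates the variation of the bump from that of its mass. *)
  have E : bump_kernel t z y - bump_kernel t z y' =
      (bump t z y - bump t z y') * (bump_mass t y)^-1 +
      bump t z y' * ((bump_mass t y' - bump_mass t y) * ((bump_mass t y)^-1 * (bump_mass t y')^-1)).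
    by rewrite /bump_kernel; field; rewrite !gt_eqF.
  have h1 : `|bump t z y - bump t z y'| <= d y y' / t.
    by rewrite !(bump_sym t z); exact: bump_lipschitz.
  have h2 : `|bump_mass t y' - bump_mass t y| <= d y y' / t * V y (3 * t).
    by rewrite distrC; exact: bump_mass_lipschitz.
  have h3 : (bump_mass t y')^-1 <= (V y' t)^-1 by rewrite lef_pV2 ?posrE// le_bump_mass.
  have h4 : V y (3 * t) <= cV * V y' t.
    apply: le_trans (ds_doubling DS y t0 _) _; first by rewrite ler1n.
    rewrite /cV -mulrA -[leRHS]mulrA -[leRHS]mulrA; apply: ler_wpM2l; first exact: ltW.
    apply: ler_wpM2l; first exact: powR_ge0.
    by apply: (le_Vol_ratio DS) => //; [rewrite ler1n|lra].
  have i0 : 0 <= (bump_mass t y)^-1 by rewrite invr_ge0 ltW.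
  have i0' : 0 <= (bump_mass t y')^-1 by rewrite invr_ge0 ltW.
  have h5 : V y (3 * t) * (bump_mass t y')^-1 <= cV.
    apply: (@le_trans _ _ (cV * V y' t * (V y' t)^-1)); last by rewrite mulfK ?gt_eqF.
    by apply: ler_pM => //; exact: (Vol_ge0 d mu).
  have hp := pw _ (q2 _ yy0 yy).
  have yt0 : 0 <= d y y' / t by have /andP[] := q2 _ yy0 yy.
  rewrite E; apply: le_trans (ler_normD _ _) _.
  rewrite !normrM (ger0_norm i0) (ger0_norm i0') (ger0_norm (bump_ge0 _ _ _)).
  have B2 : bump t z y' * (`|bump_mass t y' - bump_mass t y| *
      ((bump_mass t y)^-1 * (bump_mass t y')^-1)) <= d y y' / t * cV * (bump_mass t y)^-1.
    apply: (@le_trans _ _ (1 * (d y y' / t * V y (3 * t) *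
        ((bump_mass t y)^-1 * (bump_mass t y')^-1)))).
      apply: ler_pM => //; [exact: bump_ge0|by rewrite !mulr_ge0|exact: bump_le1|].
      by apply: ler_wpM2r => //; exact: mulr_ge0.
    rewrite mul1r [leLHS](_ : _ = d y y' / t * (V y (3 * t) * (bump_mass t y')^-1) *
      (bump_mass t y)^-1); last by ring.
    by apply: ler_wpM2r => //; exact: ler_wpM2l.
  have B1 : `|bump t z y - bump t z y'| / bump_mass t y <= d y y' / t * (bump_mass t y)^-1.
    exact: ler_wpM2r.
  apply: le_trans (lerD B1 B2) _.
  rewrite [leLHS](_ : _ = (1 + cV) * (d y y' / t * (bump_mass t y)^-1)); last by ring.
  rewrite [leRHS](_ : _ = (1 + cV) * ((d y y' / t) `^ e * (cK * K (2 * e) z t y))); last by ring.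
  apply: ler_wpM2l; first by nonneg.
  apply: ler_pM => //.
  by apply: le_trans mVi _; exact: KV.
Qed.

End bump_kernel.

(** * Passage between kernel bounds and the spaces of test functions *)

Section test_functions.
Context (R : realType) dsp (X : measurableType dsp) (d : X -> X -> R)
  (mu : {sigma_finite_measure set X -> \bar R}) (D n : R).
Hypothesis DS : doubling_space d mu D n.
Local Notation V := (Vol d mu).
Local Notation K := (kern d mu).

Lemma decay_ge0 (g : R) (x : X) (t : R) (y : X) : 0 <= decay d mu x t g y.
Proof. by rewrite mulr_ge0 ?powR_ge0// invr_ge0 addr_ge0// (Vol_ge0 d mu). Qed.

Lemma decay_exponent (g g' : R) (x : X) (t : R) (y : X) : 0 < t -> g <= g' ->
  decay d mu x t g' y <= decay d mu x t g y.
Proof.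
move=> t0 gg; apply: ler_wpM2l.
  by rewrite invr_ge0 addr_ge0// (Vol_ge0 d mu).
by apply: ger_powR => //; exact: (kern_ratio DS).
Qed.

(** Bounds at centre x and scale t become [Gbound] at another centre x1 and scale s, with a constant
    depending on how far apart these are, as measured by L. It is used with L = 1 for a uniform
    norm, and with a large L merely for membership in the space based at x1. *)
Lemma local_test_Gbound (e L C : R) : 0 < e -> 1 <= L -> 0 <= C ->
  exists C' : R, 0 < C' /\ forall (x x1 : X) (t s : R) (F : X -> R),
  0 < t -> 0 < s -> t <= L * s -> s <= L * t -> d x x1 <= L * s -> d x x1 <= L * t ->
  (forall y, `|F y| <= C * K (2 * e) x t y) ->
  (forall y y', d y y' <= t / 2 -> `|F y - F y'| <= C * (d y y' / t) `^ e * K (2 * e) x t y) ->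
  Gbound d mu x1 s e e F C'.
Proof.
move=> e0 L1 C0; have D0 := doubling_D0 DS; have L0 : 0 < L by exact: lt_le_trans L1.
pose cK (g : R) : R := (2 * (L * L)) `^ g * (D * (3 * L) `^ n).
have cK0 g : 0 < cK g by rewrite /cK; positive.
pose c2 : R := 2 `^ (2 * e) * (D * 2 `^ n).
have c20 : 0 < c2 by rewrite /c2; positive.
pose B1 := C * cK e.
pose B2 := C * (2 * L) `^ e * cK e.
pose B3 := C * cK (2 * e) * (1 + c2) * (2 * L) `^ e.
have B10 : 0 <= B1 by rewrite /B1; have := cK0 e => ?; nonneg.
have B20 : 0 <= B2 by rewrite /B2; have := cK0 e => ?; nonneg.
have B30 : 0 <= B3 by rewrite /B3; have := cK0 (2 * e) => ?; nonneg.
exists (2 * (1 + B1 + B2 + B3)); split; first by rewrite mulr_gt0//; lra.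
move=> x x1 t s F t0 s0 tL sL xs xt H1 H2.
have xx0 := dm_ge0 DS x x1.
have cmp y : [/\ t + d x y <= 2 * L * (s + d x1 y), s + d x1 y <= 2 * L * (t + d x y),
    0 < t + d x y & 0 < s + d x1 y].
  have T1 := dm_triangle DS x1 x y; have T2 := dm_triangle DS x x1 y.
  rewrite (dm_sym DS x1 x) in T2.
  have y0 := dm_ge0 DS x y; have y1 := dm_ge0 DS x1 y.
  have u1 : d x1 y <= L * d x1 y by rewrite ler_peMl.
  have u2 : d x y <= L * d x y by rewrite ler_peMl.
  split; rewrite ?ltr_wpDr// -mulrA mulrDr; lra.
have kc g y : 0 <= g -> K g x t y <= cK g * K g x1 s y.
  move=> g0; have [c1 c1' c3 c4] := cmp y.
  apply: (kern_comparison DS) => //.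
  - by lra.
  - by nonneg.
  - rewrite [leRHS]mulrA ler_pdivrMr// [leRHS]mulrAC ler_pdivlMr//.
    apply: (@le_trans _ _ (L * s * (2 * L * (t + d x y)))).
      by apply: ler_pM => //; exact: ltW.
    by rewrite le_eqVlt; apply/orP; left; apply/eqP; ring.
  - rewrite (dm_sym DS x1 x); have y0 := dm_ge0 DS x y.
    have : 0 <= L * d x y by nonneg.
    by rewrite mulrDr; move: c1'; rewrite mulrDr; lra.
have Kd y : K e x1 s y <= 2 * decay d mu x1 s e y by exact: (kern_le_decay DS).
split; first by nonneg.
split=> [y|y y' yy].
  apply: (@le_trans _ _ (B1 * K e x1 s y)).
    apply: le_trans (H1 y) _; rewrite /B1 -mulrA; apply: ler_wpM2l => //.
    apply: le_trans (kc e y _); last exact: ltW.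
    by apply: (kern_exponent DS) => //; lra.
  apply: (@le_trans _ _ (B1 * (2 * decay d mu x1 s e y))); first exact: ler_wpM2l.
  rewrite mulrA (mulrC B1); apply: ler_wpM2r; first exact: decay_ge0.
  by apply: ler_wpM2l => //; lra.
have yy0 := dm_ge0 DS y y'.
have [c1 c1' c3 c4] := cmp y.
set u := d y y' / (s + d x1 y).
have u0 : 0 <= u by rewrite /u divr_ge0// ltW.
suff h : `|F y - F y'| <= (B2 + B3) * (u `^ e * K e x1 s y).
  apply: le_trans h _; apply: (@le_trans _ _ ((B2 + B3) * (u `^ e * (2 * decay d mu x1 s e y)))).
    by apply: ler_wpM2l; [exact: addr_ge0|apply: ler_wpM2l; [exact: powR_ge0|]].
  rewrite [leLHS](_ : _ = 2 * (B2 + B3) * u `^ e * decay d mu x1 s e y); last by ring.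
  apply: ler_wpM2r; first exact: decay_ge0.
  by apply: ler_wpM2r; [exact: powR_ge0|lra].
have uK0 : 0 <= u `^ e * K e x1 s y by nonneg.
(* [Gbound] asks for regularity up to (s + d x1 y) / 2, beyond the range of the hypothesis. For the
   larger displacements the size bounds at y and y' suffice, half of the decay 2 e being turned into
   the Hölder factor. *)
have [yt|yt] := leP (d y y') (t / 2).
  apply: (@le_trans _ _ (B2 * (u `^ e * K e x1 s y))); last first.
    by apply: ler_wpM2r => //; rewrite lerDl.
  apply: le_trans (H2 y y' yt) _.
  rewrite (kern_double DS)//.
  have q0 : 0 <= t / (t + d x y) by rewrite divr_ge0// ltW.
  have q1 : 0 <= d y y' / t by rewrite divr_ge0// ltW.
  rewrite [leLHS](_ : _ = C * (((d y y' / t) `^ e * (t / (t + d x y)) `^ e) * K e x t y)); last by ring.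
  rewrite [leRHS](_ : _ = C * (((2 * L) `^ e * u `^ e) * (cK e * K e x1 s y))); last first.
    by rewrite /B2; ring.
  apply: ler_wpM2l => //.
  apply: ler_pM; rewrite ?mulr_ge0 ?powR_ge0 ?kern_ge0//; last by apply: kc; exact: ltW.
  rewrite -powRM// -powRM//; last by nonneg.
  apply: le_powRl; [exact: ltW|exact: mulr_ge0|].
  rewrite mulrA divfK ?gt_eqF// /u mulrA ler_pdivrMr// mulrAC ler_pdivlMr//.
  rewrite (mulrC (2 * L)) -mulrA; apply: ler_wpM2l => //.
apply: (@le_trans _ _ (B3 * (u `^ e * K e x1 s y))); last first.
  by apply: ler_wpM2r => //; rewrite lerDr.
apply: le_trans (ler_normB _ _) _; apply: le_trans (lerD (H1 y) (H1 y')) _.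
have e20 : 0 <= 2 * e by nonneg.
have k1 := kc (2 * e) y e20; have k2 := kc (2 * e) y' e20.
have k3 : K (2 * e) x1 s y' <= c2 * K (2 * e) x1 s y.
  have T := dm_triangle DS y' x1 y; rewrite (dm_sym DS y' y) in T.
  have y1 := dm_ge0 DS x1 y; have y1' := dm_ge0 DS x1 y'.
  apply: (kern_comparison DS) => //.
  - by rewrite ler1n.
  - rewrite ler_pdivrMr ?ltr_wpDr// mulrAC mulrA ler_pdivlMr//.
    rewrite [leRHS]mulrC; apply: ler_wpM2l; [exact: ltW|lra].
  - by rewrite (dm_refl DS); lra.
have k4 : K (2 * e) x1 s y <= (2 * L) `^ e * (u `^ e * K e x1 s y).
  rewrite (kern_double DS)// mulrA; apply: ler_wpM2r; first exact: kern_ge0.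
  rewrite -powRM//; last by nonneg.
  apply: le_powRl; [exact: ltW|by rewrite divr_ge0// ltW|].
  rewrite /u mulrA; apply: ler_wpM2r; first by rewrite invr_ge0 ltW.
  apply: le_trans sL _; rewrite (mulrC 2) -mulrA; apply: ler_wpM2l; [exact: ltW|lra].
rewrite -mulrDr [leRHS](_ : _ = C * (cK (2 * e) *
  ((1 + c2) * ((2 * L) `^ e * (u `^ e * K e x1 s y))))); last by rewrite /B3; ring.
apply: ler_wpM2l => //.
apply: (@le_trans _ _ (cK (2 * e) * ((1 + c2) * K (2 * e) x1 s y))).
  apply: le_trans (lerD k1 (le_trans k2 (ler_wpM2l (ltW (cK0 _)) k3))) _.
  by rewrite le_eqVlt; apply/orP; left; apply/eqP; ring.
apply: ler_wpM2l; first exact: ltW.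
by apply: ler_wpM2l => //; lra.
Qed.

Lemma Gbound_exponent (x : X) (t b b' g g' : R) (F : X -> R) (C : R) : 0 < t ->
  b <= b' -> g <= g' -> 0 <= b -> Gbound d mu x t b' g' F C -> Gbound d mu x t b g F C.
Proof.
move=> t0 bb gg b0 [C0 [H1 H2]]; split => //; split => [y|y y' yy].
  apply: le_trans (H1 y) _; apply: ler_wpM2l => //; exact: decay_exponent.
apply: le_trans (H2 y y' yy) _.
have yy0 := dm_ge0 DS y y'; have xy0 := dm_ge0 DS x y.
apply: ler_pM; rewrite ?decay_ge0 ?mulr_ge0 ?powR_ge0 ?decay_exponent//.
apply: ler_wpM2l => //.
have td : 0 < t + d x y by rewrite ltr_wpDr.
(* Zero displacement is separated because the power of 0 with exponent 0 is 1. *)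
have [->|yn] := eqVneq (d y y') 0.
  rewrite mul0r; have [->|bn] := eqVneq b 0; last by rewrite !powR0// gt_eqF// (lt_le_trans _ bb)// lt0r bn.
  rewrite powRr0; have [->|bn'] := eqVneq b' 0; first by rewrite powRr0.
  by rewrite powR0.
apply: ger_powR => //; rewrite divr_gt0//=; last by rewrite lt0r yn.
by rewrite ler_pdivrMr// mul1r; lra.
Qed.

Lemma Gbound_scale (x : X) (t b g : R) (F : X -> R) (C c : R) : 0 <= c ->
  Gbound d mu x t b g F C -> Gbound d mu x t b g (fun y => c * F y) (c * C).
Proof.
move=> c0 [C0 [H1 H2]]; split; first exact: mulr_ge0.
split => [y|y y' yy]; rewrite -?mulrBr normrM (ger0_norm c0) -!mulrA; apply: ler_wpM2l => //.
by rewrite mulrA; exact: H2.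
Qed.

Lemma Gbound_Gnorm (x : X) (t b g : R) (F : X -> R) (C : R) :
  Gbound d mu x t b g F C -> (Gnorm d mu x t b g F <= C%:E)%E.
Proof. by move=> H; apply: ereal_inf_lbound; exists C. Qed.

(** The infimum defining the norm need not be known to be attained, so a constant larger than 1 is
    taken. *)
Lemma Gnorm_Gbound (x : X) (t b g : R) (F : X -> R) :
  (Gnorm d mu x t b g F <= 1)%E -> Gbound d mu x t b g F 2.
Proof.
move=> h; have : (Gnorm d mu x t b g F < 2%:E)%E by apply: le_lt_trans h _; rewrite lte_fin ltr1n.
move=> /ereal_inf_lt[_ [C [C0 [H1 H2]] <-]]; rewrite lte_fin => C2.
split => //; split => [y|y y' yy].
  by apply: le_trans (H1 y) _; apply: ler_wpM2r; [exact: decay_ge0|exact: ltW].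
apply: le_trans (H2 y y' yy) _; apply: ler_wpM2r; first exact: decay_ge0.
by apply: ler_wpM2r; [exact: powR_ge0|exact: ltW].
Qed.

(** A function already in the smaller space G(eps, eps) is its own approximant. *)
Lemma G0_Gbound (x1 : X) (eps b g : R) (F : X -> R) (C : R) :
  0 <= b <= eps -> g <= eps -> Gbound d mu x1 1 eps eps F C -> G0 d mu x1 eps b g F.
Proof.
move=> /andP[b0 be] ge H; split.
  apply: le_lt_trans (Gbound_Gnorm (Gbound_exponent ltr01 be ge b0 H)) _; exact: ltry.
move=> z z0; exists F; split.
  by apply: le_lt_trans (Gbound_Gnorm H) _; exact: ltry.
apply: (@le_lt_trans _ _ 0%E); last by rewrite lte_fin.
apply: Gbound_Gnorm; split => //; split => [y|y y' _]; by rewrite !subrr ?subrr normr0 !mul0r.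
Qed.

Lemma Gbound_test_fun (e : R) (x : X) (r b g : R) (F : X -> R) (C : R) :
  0 < e -> e <= b -> e <= g -> 0 < r -> Gbound d mu x r b g F C ->
  test_fun d mu e x r r (C * (D * 2 `^ n)) F.
Proof.
move=> e0 eb eg r0 H; have [C0 [H1 H2]] := Gbound_exponent r0 eb eg (ltW e0) H.
split => [y|y y' yy].
  apply: le_trans (H1 y) _; rewrite -[leRHS]mulrA; apply: ler_wpM2l => //.
  exact: (decay_le_kern DS).
have yy0 := dm_ge0 DS y y'; have xy0 := dm_ge0 DS x y.
have yr : d y y' <= (r + d x y) / 2 by lra.
apply: le_trans (H2 y y' yr) _.
rewrite [leRHS](_ : _ = C * (d y y' / r) `^ e * (D * 2 `^ n * K e x r y)); last by ring.
apply: ler_pM; rewrite ?decay_ge0 ?mulr_ge0 ?powR_ge0//; last exact: (decay_le_kern DS).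
apply: ler_wpM2l => //; apply: le_powRl; first exact: ltW.
  by rewrite divr_ge0// addr_ge0// ltW.
apply: ler_wpM2l => //; rewrite lef_pV2 ?posrE ?ltr_wpDr//; lra.
Qed.

Lemma grand_max_ge0 (rho : X -> R) (e : R) (f : X -> R) (x : X) : 0 < rho x ->
  (0 <= grand_max d mu rho e f x)%E.
Proof.
move=> x0; apply: le_trans (ereal_sup_ubound _); last first.
  exists (cst 0) => //; exists (rho x / 2); split.
    by rewrite divr_gt0//= ltr_pdivrMr//; lra.
  split => [z|z z' _]; first by rewrite /= normr0 mul1r kern_ge0.
  by rewrite /= subrr normr0; nonneg.
by rewrite lee_fin.
Qed.

Lemma grand_max_ge (rho : X -> R) (e : R) (f phi : X -> R) (x : X) (r A : R) :
  0 < e -> 0 < A -> 0 < r < rho x -> L1 mu f -> test_fun d mu e x r r A phi ->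
  (`|Rintegral mu setT (fun z => (f z * phi z)%R)|%:E <= A%:E * grand_max d mu rho e f x)%E.
Proof.
move=> e0 A0 /andP[r0 rr] lf H.
pose psi z := A^-1 * phi z.
have A'0 : 0 <= A^-1 by rewrite invr_ge0 ltW.
have Hpsi : test_fun d mu e x r r 1 psi.
  split => [z|z z' zz]; rewrite /psi -?mulrBr normrM (ger0_norm A'0).
    by rewrite ler_pdivrMl// mulrA mulr1; exact: H.1.
  by rewrite ler_pdivrMl// !mulrA mulr1; exact: H.2.
have mpsi := test_fun_measurable DS e0 r0 ler01 Hpsi.
have hb z : `|psi z| <= 1 * (V x r)^-1.
  apply: le_trans (Hpsi.1 z) _; apply: ler_wpM2l => //.
  by apply: (kern_le_Vol DS) => //; exact: ltW.
have l := L1_bounded_mul mpsi hb lf.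
have -> : Rintegral mu setT (fun z => f z * phi z) =
    A * Rintegral mu setT (fun z => f z * psi z).
  under [in RHS]eq_Rintegral do rewrite mulrC.
  rewrite -RintegralZl//; apply: eq_Rintegral => z _.
  by rewrite /psi mulrA mulrA divff ?gt_eqF// mul1r mulrC.
rewrite normrM (gtr0_norm A0) EFinM; apply: lee_wpmul2l; first by rewrite lee_fin ltW.
by apply: ereal_sup_ubound; exists psi => //; exists r; rewrite r0 rr.
Qed.

End test_functions.

(** * The characterization *)


(* Only the upper bound [C2 * lambda ^ n] is used; [mu setT = +oo] makes the diameter infinite. *)
Lemma RD_doubling (R : realType) dsp (X : measurableType dsp) (d : X -> X -> R)
    (mu : {measure set X -> \bar R}) (x0 : X) : RD_space d mu ->
  exists D n, doubling_space d mu D n.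
Proof.
move=> [dm [dB [_ [db [_ [[kappa [n [C2 [/andP[k0 kn] [C21 H]]]]] muT]]]]]].
have [d0 [d00 [ds dt]]] := dm.
have diam (s : R) : (s%:E < ddiam d)%E.
  rewrite ltNge; apply/negP => h.
  have ds' y : d x0 y <= s.
    by rewrite -lee_fin; apply: le_trans h; apply: ereal_sup_ubound; exists x0, y.
  have s1 : 0 < s + 1 by rewrite ltr_wpDl//; apply: le_trans (ds' x0); exact: d0.
  have := (db x0 _ s1).2; rewrite (_ : dball d x0 (s + 1) = setT) ?muT ?ltxx//.
  apply/seteqP; split => // y _; rewrite /dball/=.
  by apply: le_lt_trans (ds' y) _; rewrite ltrDl.
exists C2, n; split => //.
- by move=> x r r0; have [-> ->] := db x r r0.
- exact: lt_le_trans kn.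
- by move=> x r l r0 l1; have [] := H x r l r0 (diam _) l1 (diam _).
Qed.

Lemma mule_chain (R : realType) (x y z : \bar R) (k l : R) : 0 <= k ->
  (x <= k%:E * y)%E -> (y <= l%:E * z)%E -> (x <= (k * l)%:E * z)%E.
Proof.
move=> k0 xy yz; apply: le_trans xy _; rewrite EFinM -muleA.
by apply: lee_wpmul2l.
Qed.

Section characterization.
Context (R : realType) dsp (X : measurableType dsp) (d : X -> X -> R)
  (mu : {sigma_finite_measure set X -> \bar R}) (D n : R).
Hypothesis DS : doubling_space d mu D n.
Local Notation V := (Vol d mu).
Local Notation K := (kern d mu).
Variables (rho : X -> R) (C3 a : R).
Hypothesis RA : admissible_weight d rho C3 a.

Let rho0 := aw_gt0 RA.
Let C30 := aw_const RA.
Let a01 := aw_exponent RA.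
Let adm := aw_bound RA.
Variables (eps beta gamma : R) (x1 : X) (St Tt : R -> X -> X -> R) (e1 e2 e3 C d1 d2 d3 e : R).
Hypothesis eps1 : eps <= 1.
Hypothesis be : 0 <= beta <= eps.
Hypothesis ge : gamma <= eps.
Hypothesis AS : cAOTI d mu St e1 e2 e3.
Hypothesis mT : forall t, 0 < t -> measurable_fun setT (fun p : X * X => Tt t p.1 p.2).
Hypothesis C0 : 0 < C.
Hypothesis Tb : forall t x y, 0 < t ->
  `|Tt t x y| <= C * decay d mu x t d2 y * (rho x / (t + rho x)) `^ d3.
Hypothesis TS : forall t x y, 0 < t ->
  `|Tt t x y - St t x y| <= C * (t / (t + rho x)) `^ d1 * decay d mu x t d2 y.
Hypothesis e0 : 0 < e.
Hypothesis e11 : e <= 1.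
Hypothesis ee1 : e <= e1.
Hypothesis ee2 : 2 * e <= e2.
Hypothesis ed1 : e <= d1.
Hypothesis ed2 : e <= d2.
Hypothesis ed3 : e <= d3.
Hypothesis eb : e <= beta.
Hypothesis eg : e <= gamma.
Local Notation GM := (grand_max d mu rho e).
Local Notation EE := (Eop d mu rho C3 a (e * a)).

Let DK := D * 2 `^ n.
Let DK0 : 0 < DK.
Proof. have D0 := doubling_D0 DS; rewrite /DK; positive. Qed.

Let mS t : 0 < t -> measurable_fun setT (fun p : X * X => St t p.1 p.2).
Proof. by move=> t0; have [/(_ t t0)[]] := AS. Qed.

Let decay_K (g g' t : R) (x y : X) : 0 < t -> g' <= g -> decay d mu x t g y <= DK * K g' x t y.
Proof.
move=> t0 gg; apply: le_trans (decay_le_kern DS g x y t0) _.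
by apply: ler_wpM2l; [exact: ltW|exact: (kern_exponent DS)].
Qed.

Let pow_le (u v b : R) : 0 <= u -> u <= v -> u <= 1 -> e <= b -> u `^ b <= v `^ e.
Proof.
move=> u0 uv u1 b0; apply: le_trans (le_powRl (ltW e0) u0 uv).
have [->|un] := eqVneq u 0; first by rewrite !powR0// gt_eqF// (lt_le_trans e0).
by apply: ger_powR => //; rewrite lt0r un u0.
Qed.

Let ratio_bounds (t u v : R) : 0 < t -> 0 <= u -> 0 <= v -> u <= (t + v) / 2 ->
  [/\ 0 <= u / (t + v), u / (t + v) <= u / t & u / (t + v) <= 1].
Proof.
move=> t0 u0 v0 uv; have tv : 0 < t + v by rewrite ltr_wpDr.
split; first by rewrite divr_ge0// ltW.
  by apply: ler_wpM2l => //; rewrite lef_pV2 ?posrE//; lra.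
by rewrite ler_pdivrMr// mul1r; lra.
Qed.

Let S_good : exists Cs : R, 0 < Cs /\ good_kernel d mu St e Cs.
Proof.
have [_ [C6 [C60 H]]] := AS; exists (C6 * DK); split; first exact: mulr_gt0.
(* For u <= t / 2 the ratio u / (t + d x y) is at most 1 and at most u / t, so lowering the exponent
   to e and replacing the denominator by t both enlarge the bound. *)
have hold (t u v : R) (x y : X) : 0 < t -> 0 <= u -> u <= t / 2 ->
    v <= C6 * (u / (t + d x y)) `^ e1 * decay d mu x t e2 y ->
    v <= C6 * DK * (u / t) `^ e * K (2 * e) x t y.
  move=> t0 u0 ut hv; apply: le_trans hv _; have xy0 := dm_ge0 DS x y.
  have ut' : u <= (t + d x y) / 2 by lra.
  have [b1 b2 b3] := ratio_bounds t0 u0 xy0 ut'.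
  rewrite [leRHS](_ : _ = C6 * (u / t) `^ e * (DK * K (2 * e) x t y)); last by ring.
  apply: ler_pM => //; [by nonneg|exact: decay_ge0| |exact: decay_K].
  by apply: ler_wpM2l; [exact: ltW|exact: pow_le].
split=> [|t x y t0|t x x' y t0 xx|t x y y' t0 yy|t y t0].
- exact: mS.
- have [h _] := H t t0 x x y y; apply: le_trans h _; rewrite -mulrA.
  by apply: ler_wpM2l; [exact: ltW|exact: decay_K].
- apply: hold => //; first exact: (dm_ge0 DS).
  by have [_ [h _]] := H t t0 x x' y y; apply: h; have := dm_ge0 DS x y; lra.
- apply: hold => //; first exact: (dm_ge0 DS).
  by have [_ [_ [h _]]] := H t t0 x x y y'; apply: h; have := dm_ge0 DS x y; lra.
- by have [_ [_ [_ [_ [_ ->]]]]] := H t t0 y y y y.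
Qed.

Let CT := C * DK.
Let CT0 : 0 < CT. Proof. by rewrite /CT mulr_gt0. Qed.

Let frac01 (u v : R) : 0 < u -> 0 < v -> 0 <= u / (v + u) <= 1.
Proof.
move=> u0 v0; have vu : 0 < v + u by exact: addr_gt0.
rewrite divr_ge0 ?(ltW u0) ?(ltW vu)//= ler_pdivrMr// mul1r; lra.
Qed.

Let T_far t x y : 0 < t -> `|Tt t x y| <= CT * ((rho x / (t + rho x)) `^ e * K e x t y).
Proof.
move=> t0; apply: le_trans (Tb x y t0) _; have x0 := rho0 x.
have /andP[q0 q1] := frac01 x0 t0.
rewrite [leRHS](_ : _ = C * (DK * K e x t y) * (rho x / (t + rho x)) `^ e); last first.
  by rewrite /CT; ring.
apply: ler_pM; [|exact: powR_ge0| |exact: pow_le].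
- by have := decay_ge0 d mu d2 x t y => ?; nonneg.
- by apply: ler_wpM2l; [exact: ltW|exact: decay_K].
Qed.

Let T_bound t x y : 0 < t -> `|Tt t x y| <= CT * K e x t y.
Proof.
move=> t0; apply: le_trans (T_far x y t0) _; apply: ler_wpM2l; first exact: ltW.
rewrite ler_piMl ?kern_ge0//.
have /andP[q0 q1] := frac01 (rho0 x) t0.
by have := le_powRl (ltW e0) q0 q1; rewrite powR1.
Qed.

Let TS_bound t x y : 0 < t ->
  `|Tt t x y - St t x y| <= CT * (t / (t + rho x)) `^ e * K e x t y.
Proof.
move=> t0; apply: le_trans (TS x y t0) _; have x0 := rho0 x.
have /andP[q0 q1] := frac01 t0 x0; rewrite addrC in q0 q1.
rewrite [leRHS](_ : _ = C * (t / (t + rho x)) `^ e * (DK * K e x t y)); last by rewrite /CT; ring.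
apply: ler_pM; [by nonneg|exact: decay_ge0| |exact: decay_K].
by apply: ler_wpM2l; [exact: ltW|exact: pow_le].
Qed.

Let kern_bounded (q : X -> R) (A t : R) (x : X) : 0 < t -> 0 <= A ->
  (forall y, `|q y| <= A * K e x t y) -> forall y, `|q y| <= A * (V x t)^-1.
Proof.
move=> t0 A0 H y; apply: le_trans (H y) _; apply: ler_wpM2l => //.
by apply: (kern_le_Vol DS) => //; exact: ltW.
Qed.

Let measurable_row (S : R -> X -> X -> R) t x :
  measurable_fun setT (fun p : X * X => S t p.1 p.2) -> measurable_fun setT (S t x).
Proof. by move=> mk; exact: (measurableT_comp mk (pair1_measurable x)). Qed.

Let kern2 (t : R) (x y : X) : 0 < t -> K (2 * e) x t y <= K e x t y.
Proof. by move=> t0; apply: (kern_exponent DS _ _ t0); have := e0; lra. Qed.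

Let kop_compare : exists c : R, 0 < c /\ forall (f : X -> R) (x : X) (t : R), L1 mu f -> 0 < t ->
  (t <= rho x -> (`|kop mu (Tt t) f x - kop mu (St t) f x|%:E <= c%:E * EE f x)%E) /\
  (rho x <= t -> (`|kop mu (Tt t) f x|%:E <= c%:E * EE f x)%E).
Proof.
have [Cw [Cw0 Hw]] := kern_le_wker DS RA e0.
have [Cs [Cs0 HS]] := S_good.
exists (CT * Cw); split; first exact: mulr_gt0.
move=> f x t lf t0; have mf := L1_measurable lf.
have mTx := measurable_row x (mT t0); have mSx := measurable_row x (mS t0).
have c0 : 0 <= CT * Cw by nonneg.
split=> tx.
  have Sb y : `|St t x y| <= Cs * K e x t y.
    apply: le_trans (gk_size HS x y t0) _.
    by apply: ler_wpM2l; [exact: ltW|exact: kern2].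
  have lT : L1 mu (fun y => Tt t x y * f y).
    by apply: (L1_bounded_mul mTx (kern_bounded t0 (ltW CT0) _) lf) => y; exact: T_bound.
  have lS : L1 mu (fun y => St t x y * f y).
    exact: (L1_bounded_mul mSx (kern_bounded t0 (ltW Cs0) Sb) lf).
  have -> : kop mu (Tt t) f x - kop mu (St t) f x =
      Rintegral mu setT (fun y => (Tt t x y - St t x y) * f y).
    by rewrite /kop -(RintegralB measurableT lT lS); apply: eq_Rintegral => y _; rewrite mulrBl.
  apply: (kop_le_Eop DS RA) => //; first exact: measurable_funB.
  move=> y; have [h _ _] := Hw x y t t0.
  apply: (@le_trans _ _ (CT%:E * ((t / (t + rho x)) `^ e * K e x t y)%:E)%E).
    by rewrite -EFinM lee_fin mulrA; exact: TS_bound.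
  by rewrite [(CT * Cw)%:E]EFinM -muleA; apply: lee_wpmul2l; [rewrite lee_fin ltW|exact: h].
apply: (kop_le_Eop DS RA) => // y; have [_ h _] := Hw x y t t0.
apply: (@le_trans _ _ (CT%:E * ((rho x / (t + rho x)) `^ e * K e x t y)%:E)%E).
  by rewrite -EFinM lee_fin; exact: T_far.
by rewrite [(CT * Cw)%:E]EFinM -muleA; apply: lee_wpmul2l; [rewrite lee_fin ltW|exact: h].
Qed.

Let S_le_T : exists c : R, 0 < c /\ forall f x, L1 mu f ->
  (Tplus_rho mu rho St f x <= Tplus_rho mu rho Tt f x + c%:E * EE f x)%E /\
  (Tplus mu Tt f x <= Tplus_rho mu rho St f x + c%:E * EE f x)%E.
Proof.
have [c [c0 H]] := kop_compare; exists c; split => // f x lf.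
have E0 : (0 <= c%:E * EE f x)%E by rewrite mule_ge0 ?Eop_ge0// lee_fin ltW.
split.
  apply: ge_ereal_sup => _ [t /= /andP[t0 tr] <-]; have [h _] := H f x t lf t0.
  apply: (@le_trans _ _ (`|kop mu (Tt t) f x|%:E +
      `|kop mu (Tt t) f x - kop mu (St t) f x|%:E)%E).
    rewrite lee_fin -{1}(subrK (kop mu (Tt t) f x) (kop mu (St t) f x)) addrC.
    by apply: le_trans (ler_normD _ _) _; rewrite lerD2r distrC.
  apply: leeD; last by apply: h; exact: ltW.
  by apply: ereal_sup_ubound; exists t => //=; rewrite t0 tr.
apply: ge_ereal_sup => _ [t /= t0 <-]; have [h1 h2] := H f x t lf t0.
have [tr|tr] := ltP t (rho x); last first.
  by apply: le_trans (h2 tr) _; rewrite leeDr// Tplus_rho_ge0.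
apply: (@le_trans _ _ (`|kop mu (St t) f x|%:E +
    `|kop mu (Tt t) f x - kop mu (St t) f x|%:E)%E).
  by rewrite lee_fin addrC -{1}(subrK (kop mu (St t) f x) (kop mu (Tt t) f x)) ler_normD.
apply: leeD; last by apply: h1; exact: ltW.
by apply: ereal_sup_ubound; exists t => //=; rewrite t0 tr.
Qed.

Let S_le_grand_max : exists c : R, 0 < c /\ forall f x, L1 mu f ->
  (Tplus_rho mu rho St f x <= c%:E * GM f x)%E.
Proof.
have [Cs [Cs0 HS]] := S_good; exists Cs; split => // f x lf.
apply: ge_ereal_sup => _ [t /= /andP[t0 tr] <-].
rewrite /kop; under eq_Rintegral do rewrite mulrC.
apply: (grand_max_ge DS e0 Cs0 _ lf (r := t)); first by rewrite t0 tr.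
split => [y|y y' yy].
  apply: le_trans (gk_size HS x y t0) _.
  by apply: ler_wpM2l; [exact: ltW|exact: kern2].
apply: le_trans (gk_right HS x t0 yy) _.
by apply: ler_wpM2l; [nonneg|exact: kern2].
Qed.

Let Grho_le_grand_max f x : L1 mu f ->
  (Grho d mu rho x1 eps beta gamma f x <= (2 * DK)%:E * GM f x)%E.
Proof.
move=> lf; apply: ge_ereal_sup => _ [phi [_ [r [/andP[r0 rr] /Gnorm_Gbound H]]] <-].
apply: (grand_max_ge DS e0 _ _ lf (r := r)); first by rewrite mulr_gt0.
  by rewrite r0 rr.
exact: (Gbound_test_fun DS e0 eb eg r0 H).
Qed.

Local Notation bk := (bump_kernel d mu).

(** Rows of the bump kernel have regularity and decay of exponent 1 >= eps, so a fixed multiple of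
    each has norm at most 1 at scale t and lies in the closure space based at x1. *)
Let bump_le_Grho : exists c : R, 0 < c /\ forall f x, L1 mu f ->
  (Tplus_rho mu rho bk f x <= c%:E * Grho d mu rho x1 eps beta gamma f x)%E.
Proof.
have one : ((0 : R) < 1) && ((1 : R) <= 1) by rewrite ltr01 lexx.
have [Cb [Cb0 Hb]] := bump_kernel_good DS one.
have [C' [C'0 HC']] := local_test_Gbound DS ltr01 (lexx 1) (ltW Cb0).
exists C'; split => // f x lf.
apply: ge_ereal_sup => _ [t /= /andP[t0 tr] <-].
have size y : `|bk t x y| <= Cb * K (2 * 1) x t y by exact: gk_size.
have holder y y' : d y y' <= t / 2 ->
    `|bk t x y - bk t x y'| <= Cb * (d y y' / t) `^ 1 * K (2 * 1) x t y.
  exact: gk_right.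
have H1 : Gbound d mu x t 1 1 (bk t x) C'.
  by apply: (HC' x x t t) => //; rewrite ?mul1r// (dm_refl DS) ltW.
have C'i : 0 <= C'^-1 by rewrite invr_ge0 ltW.
pose phi y := C'^-1 * bk t x y.
have b0 : 0 <= beta by have /andP[] := be.
have beps : beta <= eps by have /andP[] := be.
have N1 : (Gnorm d mu x t beta gamma phi <= 1)%E.
  have C'n : C' != 0 by rewrite gt_eqF.
  apply: Gbound_Gnorm; rewrite -(mulVf C'n).
  apply: Gbound_scale => //; apply: (Gbound_exponent DS t0 _ _ b0 H1).
    exact: le_trans eps1.
  exact: le_trans eps1.
(* This L depends on x and t, which is harmless: it only certifies finiteness of the norm at (x1,
   1), while the uniform constant C' comes from the norm at (x, t). *)
pose L := 1 + t + t^-1 + d x x1 + d x x1 / t.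
have xx0 := dm_ge0 DS x x1.
have ti0 : 0 < t^-1 by rewrite invr_gt0.
have q0 : 0 <= d x x1 / t by rewrite divr_ge0// ltW.
have L1' : 1 <= L by rewrite /L; lra.
have [C'' [C''0 HC'']] := local_test_Gbound DS ltr01 L1' (ltW Cb0).
have H2 : Gbound d mu x1 1 1 1 (bk t x) C''.
  have Lt : L * t = t + t * t + 1 + d x x1 * t + d x x1.
    by rewrite /L; field; rewrite gt_eqF.
  have tt0 : 0 <= t * t by nonneg.
  have xt0 : 0 <= d x x1 * t by nonneg.
  apply: (HC'' x x1 t 1) => //; rewrite ?mulr1 ?Lt ?/L; lra.
have G0phi : G0 d mu x1 eps beta gamma phi.
  apply: (G0_Gbound DS be ge); apply: Gbound_scale => //.
  apply: (Gbound_exponent DS ltr01 eps1 eps1 _ H2).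
  exact: le_trans beps.
have mb : measurable_fun setT phi.
  by apply: measurable_funM => //; exact: (measurable_row x (measurable_bump_kernel DS t0)).
have e1' : e <= 2 * 1 by have := e11; lra.
have hb y : `|phi y| <= C'^-1 * Cb * (V x t)^-1.
  apply: (kern_bounded t0) => [|y']; first by nonneg.
  rewrite /phi normrM (ger0_norm C'i) -mulrA; apply: ler_wpM2l => //.
  apply: le_trans (size y') _; apply: ler_wpM2l; first exact: ltW.
  exact: (kern_exponent DS).
have l := L1_bounded_mul mb hb lf.
have -> : kop mu (bk t) f x = C' * Rintegral mu setT (fun y => f y * phi y).
  under [in RHS]eq_Rintegral do rewrite mulrC.
  rewrite -RintegralZl//; apply: eq_Rintegral => y _.
  by rewrite /phi !mulrA divff ?gt_eqF// mul1r.
rewrite normrM (gtr0_norm C'0) EFinM; apply: lee_wpmul2l; first by rewrite lee_fin ltW.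
apply: ereal_sup_ubound; exists phi => //; split => //.
by exists t; rewrite t0 tr.
Qed.

(** First bound: [Grho] by [grand_max], then by [St] plus the L1 norm, then by [Tt]. Second bound:
    T^+ by [St] plus the error, then by [grand_max], the bump kernel and [Grho]. The L1 terms are
    absorbed by [NT] in the first chain and by [NB] in the second. *)
Theorem maximal_characterization : exists c : R, 0 < c /\ forall f : X -> R, L1 mu f ->
  [/\ (H1norm d mu rho x1 eps beta gamma f <= c%:E * \int[mu]_x Tplus_rho mu rho Tt f x)%E,
      (\int[mu]_x Tplus mu Tt f x <= c%:E * H1norm d mu rho x1 eps beta gamma f)%E &
      (\int[mu]_x Tplus_rho mu rho Tt f x <= \int[mu]_x Tplus mu Tt f x)%E].
Proof.
have [bc [br cov]] := dyadic_covering_family x1 DS.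
have ea0 : 0 < e * a by rewrite mulr_gt0//; have /andP[] := a01.
have [CE [CE0 HE]] := Eop_integral DS RA ea0.
have [Cs [Cs0 HS]] := S_good.
have e01 : 0 < e <= 1 by rewrite e0 e11.
(* Here the bump kernel is taken with the exponent e of [grand_max]; in [bump_le_Grho] the same
   kernel is used with exponent 1. *)
have [Cb [Cb0 Hb]] := bump_kernel_good DS e01.
have [c1 [c10 H1]] := S_le_T; have [c2 [c20 H2]] := S_le_grand_max.
have [c3 [c30 H3]] := bump_le_Grho.
have [c4 [c40 H4]] := grand_max_integral DS cov RA e0 Cs0 HS.
have [c5 [c50 H5]] := grand_max_integral DS cov RA e0 Cb0 Hb.
pose A := 2 * DK * c4 * (2 + c1 * CE).
pose B := (c2 * (2 * c5) + c1 * CE) * c3.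
have A0 : 0 < A by rewrite /A; positive.
have B0 : 0 < B by rewrite /B; positive.
exists (A + B); split; first exact: addr_gt0.
move=> f lf; have mf := L1_measurable lf.
set N : \bar R := (\int[mu]_x `|f x|%:E)%E.
set TT : \bar R := (\int[mu]_x Tplus_rho mu rho Tt f x)%E.
have N0 : (0 <= N)%E by exact: integral_ge0.
have TT0 : (0 <= TT)%E by apply: integral_ge0 => x _; exact: Tplus_rho_ge0.
have TP0 x : (0 <= Tplus mu Tt f x)%E.
  by apply: le_trans (ereal_sup_ubound _); [|exists 1 => //=]; rewrite lee_fin.
have TTP : (TT <= \int[mu]_x Tplus mu Tt f x)%E.
  apply: le_lower_integral => x; first exact: Tplus_rho_ge0.
  apply: ge_ereal_sup => _ [t /= /andP[t0 tr] <-].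
  by apply: ereal_sup_ubound; exists t.
have mEE : measurable_fun setT (fun x => c1%:E * EE f x)%E.
  by apply: measurable_funeM; exact: (measurable_Eop DS RA).
have EE0 x : (0 <= c1%:E * EE f x)%E by rewrite mule_ge0 ?Eop_ge0// lee_fin ltW.
have IE : (\int[mu]_x (c1%:E * EE f x) <= (c1 * CE)%:E * N)%E.
  rewrite ge0_integralZl_EFin//; last 3 first.
  - by move=> x _; exact: Eop_ge0.
  - exact: (measurable_Eop DS RA).
  - exact: ltW.
  by rewrite EFinM -muleA; apply: lee_wpmul2l; [rewrite lee_fin ltW|exact: HE].
have add_le (F U : X -> \bar R) : (forall x, 0 <= F x)%E -> (forall x, 0 <= U x)%E ->
    (forall x, F x <= U x + c1%:E * EE f x)%E ->
    (\int[mu]_x F x <= \int[mu]_x U x + (c1 * CE)%:E * N)%E.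
  move=> F0 U0 FU; apply: le_trans (leeD (lexx _) IE).
  rewrite -[X in (_ <= X + _)%E]mul1e; apply: lower_integral_le_affine => // x.
  by rewrite mul1e.
have NT : (N <= TT)%E.
  apply: (L1_le_Tplus_rho DS cov RA e0 (Cs := CT + Cs) _ mS mT) => //.
  - exact: addr_gt0.
  - move=> t x y t0; apply: le_trans (gk_size HS x y t0) _.
    apply: ler_pM; rewrite ?kern_ge0 ?kern2 ?(ltW Cs0)//; have := CT0; lra.
  - move=> t x y t0; apply: le_trans (T_bound x y t0) _.
    apply: ler_wpM2r; [exact: kern_ge0|lra].
  - move=> t x y t0; apply: le_trans (TS_bound x y t0) _.
    apply: ler_wpM2r; first exact: kern_ge0.
    by apply: ler_wpM2r; [exact: powR_ge0|lra].
  - exact: (gk_integral HS).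
set TB : \bar R := (\int[mu]_x Tplus_rho mu rho bk f x)%E.
(* The lower bound with both kernels equal to the bump kernel, so that their difference is 0. *)
have NB : (N <= TB)%E.
  apply: (L1_le_Tplus_rho DS cov RA e0 Cb0
    (measurable_bump_kernel DS) (measurable_bump_kernel DS)) => //.
  - move=> t x y t0; apply: le_trans (gk_size Hb x y t0) _.
    by apply: ler_wpM2l; [exact: ltW|exact: kern2].
  - move=> t x y t0; apply: le_trans (gk_size Hb x y t0) _.
    by apply: ler_wpM2l; [exact: ltW|exact: kern2].
  - by move=> t x y t0; rewrite subrr normr0; nonneg.
  - exact: (bump_kernel_integral DS).
set TS' : \bar R := (\int[mu]_x Tplus_rho mu rho St f x)%E.
set G : \bar R := (\int[mu]_x GM f x)%E.
have GM0 x : (0 <= GM f x)%E by exact: grand_max_ge0.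
have Gr0 x : (0 <= Grho d mu rho x1 eps beta gamma f x)%E.
  rewrite -(@pmule_rge0 _ c3%:E) ?lte_fin//; apply: le_trans (H3 f x lf).
  exact: Tplus_rho_ge0.
have c1E0 : 0 <= c1 * CE by nonneg.
have scaleD (k l : R) (z : \bar R) : 0 <= k -> 0 <= l -> (0 <= z)%E ->
    (k%:E * z + l%:E * z = (k + l)%:E * z)%E.
  by move=> k0 l0 z0; rewrite EFinD ge0_muleDl// lee_fin.
have E1 : (TS' <= (1 + c1 * CE)%:E * TT)%E.
  rewrite -(scaleD _ _ _ ler01 c1E0 TT0) mul1e.
  apply: le_trans (add_le _ _ (fun x => Tplus_rho_ge0 mu St f (rho0 x))
    (fun x => Tplus_rho_ge0 mu Tt f (rho0 x)) (fun x => (H1 f x lf).1)) _.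
  by apply: leeD; [exact: lexx|apply: lee_wpmul2l; [rewrite lee_fin|exact: NT]].
have E2 : (G <= (c4 * (2 + c1 * CE))%:E * TT)%E.
  apply: le_trans (H4 f lf) _; rewrite EFinM -muleA; apply: lee_wpmul2l.
    by rewrite lee_fin ltW.
  apply: le_trans (leeD E1 NT) _; rewrite -{2}(mul1e TT) (scaleD _ _ _ (addr_ge0 ler01 c1E0) ler01 TT0).
  by rewrite (_ : 1 + c1 * CE + 1 = 2 + c1 * CE); [exact: lexx|ring].
have E3 : (H1norm d mu rho x1 eps beta gamma f <= (2 * DK)%:E * G)%E.
  apply: lower_integral_leZ => //; first exact: mulr_gt0.
  by move=> x; exact: Grho_le_grand_max.
have TB0 : (0 <= TB)%E by exact: le_trans NB.
have E4 : (G <= (c5 * 2)%:E * TB)%E.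
  apply: le_trans (H5 f lf) _; rewrite EFinM -muleA; apply: lee_wpmul2l.
    by rewrite lee_fin ltW.
  rewrite -/TB -/N (mule_natl TB 2) mule2n.
  by apply: leeD; [exact: lexx|exact: NB].
have E5 : (TB <= c3%:E * H1norm d mu rho x1 eps beta gamma f)%E.
  apply: lower_integral_leZ => // x; first exact: Tplus_rho_ge0.
  exact: H3.
have E6 : (TS' <= c2%:E * G)%E.
  apply: lower_integral_leZ => // x; first exact: Tplus_rho_ge0.
  exact: H2.
have H0 : (0 <= H1norm d mu rho x1 eps beta gamma f)%E by exact: integral_ge0.
split; last exact: TTP.
  have DK20 : 0 <= 2 * DK by nonneg.
  apply: le_trans (mule_chain DK20 E3 E2) _; apply: lee_wpmul2r; first exact: TT0.
  by rewrite lee_fin mulrA -/A lerDl ltW.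
apply: (@le_trans _ _ ((c2 * (2 * c5) + c1 * CE)%:E * TB)%E).
  apply: le_trans (add_le _ _ TP0 (fun x => Tplus_rho_ge0 mu St f (rho0 x))
    (fun x => (H1 f x lf).2)) _.
  have c25 : 0 <= c2 * (2 * c5) by nonneg.
  rewrite -(scaleD _ _ _ c25 c1E0 TB0) (mulrC 2).
  apply: leeD; first exact: mule_chain (ltW c20) E6 E4.
  by apply: lee_wpmul2l; [rewrite lee_fin|exact: NB].
apply: le_trans (lee_wpmul2l _ E5) _; first by rewrite lee_fin; nonneg.
rewrite muleA -EFinM -/B; apply: lee_wpmul2r; first exact: H0.
by rewrite lee_fin lerDr ltW.
Qed.

End characterization.

Theorem theorem4p2 (R : realType) (dsp : measure_display) (X : measurableType dsp)
  (d : X -> X -> R) (mu : {measure set X -> \bar R}) (rho : X -> R)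
  (eps beta gamma : R) (x1 : X)
  (St Tt : R -> X -> X -> R) (e1 e2 e3 : R) (C d1 d2 d3 : R) :
  RD_space d mu -> admissible d rho ->
  0 < eps < 1 -> 0 < beta < eps -> 0 < gamma < eps ->
  0 < e1 <= 1 -> 0 < e2 -> 0 < e3 -> cAOTI d mu St e1 e2 e3 ->
  (forall t, 0 < t -> L2_kernel_op mu (Tt t)) ->
  (forall t x, 0 < t -> mu.-integrable setT (EFin \o Tt t x)) ->
  0 < C -> 0 < d2 <= e2 -> 0 < d1 -> 0 < d3 ->
  (forall t x y, 0 < t ->
     `|Tt t x y| <= C * decay d mu x t d2 y * (rho x / (t + rho x)) `^ d3) ->
  (forall t x y, 0 < t ->
     `|Tt t x y - St t x y| <= C * (t / (t + rho x)) `^ d1 * decay d mu x t d2 y) ->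
  (forall f : X -> R, L1 mu f ->
     ((H1norm d mu rho x1 eps beta gamma f < +oo)%E <->
        (\int[mu]_x Tplus mu Tt f x < +oo)%E) /\
     ((H1norm d mu rho x1 eps beta gamma f < +oo)%E <->
        (\int[mu]_x Tplus_rho mu rho Tt f x < +oo)%E)) /\
  (exists K : R, 0 < K /\ forall f : X -> R, L1 mu f ->
     (H1norm d mu rho x1 eps beta gamma f <= K%:E * \int[mu]_x Tplus mu Tt f x)%E /\
     (\int[mu]_x Tplus mu Tt f x <= K%:E * H1norm d mu rho x1 eps beta gamma f)%E /\
     (H1norm d mu rho x1 eps beta gamma f <= K%:E * \int[mu]_x Tplus_rho mu rho Tt f x)%E /\
     (\int[mu]_x Tplus_rho mu rho Tt f x <= K%:E * H1norm d mu rho x1 eps beta gamma f)%E).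
Proof.
move=> RD [rho0 [C3 [k0 [C30 [k00 adm]]]]] /andP[eps0 eps1] /andP[b0 be] /andP[g0 ge].
move=> /andP[e10 e11] e20 _ AS LT _ C0 /andP[d20 d2e] d10 d30 Tb TS.
suff [c [c0 H]] : exists c : R, 0 < c /\ forall f : X -> R, L1 mu f ->
  [/\ (H1norm d mu rho x1 eps beta gamma f <= c%:E * \int[mu]_x Tplus_rho mu rho Tt f x)%E,
      (\int[mu]_x Tplus mu Tt f x <= c%:E * H1norm d mu rho x1 eps beta gamma f)%E &
      (\int[mu]_x Tplus_rho mu rho Tt f x <= \int[mu]_x Tplus mu Tt f x)%E].
  have fin (u v : \bar R) : (u <= c%:E * v)%E -> (v < +oo)%E -> (u < +oo)%E.
    move=> uv v1; apply: le_lt_trans uv _; rewrite muleC.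
    have [v0|v0] := leP 0%E v.
      by rewrite -ge0_fin_numE ?mule_ge0 ?lee_fin ?(ltW c0)// fin_numM// ge0_fin_numE.
    apply: (@lt_trans _ _ 0%E); last exact: ltry.
    by rewrite muleC pmule_rlt0.
  have c0' : (0 <= c%:E)%E by rewrite lee_fin ltW.
  split=> [f lf|].
    have [h1 h2 h3] := H f lf.
    split; split => h.
    - exact: fin h2 h.
    - by apply: fin h1 _; exact: le_lt_trans h.
    - by apply: le_lt_trans h3 _; exact: fin h2 h.
    - exact: fin h1 h.
  exists c; split => // f lf; have [h1 h2 h3] := H f lf; split; last split; last split => //.
  - by apply: le_trans h1 _; exact: lee_wpmul2l.
  - exact: h2.
  - exact: le_trans h2.
have [D [n DS]] := RD_doubling x1 RD.
have [nu nuE] := sigma_finite_pack (sigma_finite_doubling DS x1).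
move: AS LT Tb TS DS; rewrite -nuE => AS LT Tb TS DS.
pose a := 1 / (1 + k0).
have k10 : 0 < 1 + k0 by exact: addr_gt0.
have a01 : 0 < a < 1 by rewrite /a divr_gt0//= ltr_pdivrMr// mul1r ltrDl.
have aE : 1 - a = k0 / (1 + k0) by rewrite /a; field; rewrite gt_eqF.
have RA : admissible_weight d rho C3 a by split => // x y; rewrite aE.
(* A single exponent for all estimates; e2 is halved because [good_kernel] asks for the decay 2
   e. *)
pose e := Num.min (Num.min (Num.min e1 (e2 / 2)) (Num.min d1 d2)) (Num.min d3 (Num.min beta gamma)).
have e0 : 0 < e by rewrite !lt_min e10 d10 d20 d30 b0 g0 divr_gt0.
have le1 : e <= e1 by rewrite !ge_min lexx.
have le2 : e <= e2 / 2 by rewrite !ge_min lexx !orbT.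
have ld1 : e <= d1 by rewrite !ge_min lexx !orbT.
have ld2 : e <= d2 by rewrite !ge_min lexx !orbT.
have ld3 : e <= d3 by rewrite !ge_min lexx !orbT.
have lb : e <= beta by rewrite !ge_min lexx !orbT.
have lg : e <= gamma by rewrite !ge_min lexx !orbT.
have le2' : 2 * e <= e2 by rewrite mulrC -ler_pdivlMr.
have b01 : 0 <= beta <= eps by rewrite !ltW.
have mT t : 0 < t -> measurable_fun setT (fun p : X * X => Tt t p.1 p.2).
  by move=> /LT[].
exact: (maximal_characterization DS RA x1 (ltW eps1) b01 (ltW ge) AS mT C0 Tb TS
  e0 (le_trans le1 e11) le1 le2' ld1 ld2 ld3 lb lg).
Qed.
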